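(* Let $n\ge 1$, $r\ge 0$ be integers, let $J:\mathbb{R}^n\to\mathbb{R}$ be twice continuously differentiable, let $\hat{\mathbb{U}}\subset\mathbb{R}^n$, and let $\mathcal{O}\subset\mathbb{R}^n$ be the set of solutions (minimizers, or maximizers, depending on the application) of the problem of optimizing $J(u)$ subject to $u\in\hat{\mathbb{U}}$; assume $\mathcal{O}$ is nonempty and compact. Let $C_{u,z},D_{u,z}\subset\mathbb{R}^{n+r}$ and, for each $\delta>0$, let $\hat F_\delta:\mathbb{R}^{n+r}\times\mathbb{R}^n\to\mathbb{R}^{n+r}$ and $\hat G_\delta:\mathbb{R}^{n+r}\to\mathbb{R}^{n+r}$ be (single-valued) functions. Write $x_{u,z}=(\hat u,\hat z)\in\mathbb{R}^n\times\mathbb{R}^r$. For $\varepsilon_a>0$ let $$\mu_{\varepsilon_a}(\tau):=\frac{2}{\varepsilon_a}\big(\sin(2\pi\kappa_1\tau),\dots,\sin(2\pi\kappa_n\tau)\big),$$ where $\kappa_1,\dots,\kappa_n>0$ are pairwise distinct rational numbers, and let $$u(\hat u,\tau):=\hat u+\frac{\varepsilon_a^2}{2}\mu_{\varepsilon_a}(\tau).$$ Assume there exists $\delta^*>0$ such that for all $\delta\in(0,\delta^*]$: (a) $C_{u,z}$ and $D_{u,z}$ are closed, their projections onto the $\hat u$-component are contained in $\hat{\mathbb{U}}$, and $\hat F_\delta$, $\hat G_\delta$ are continuous. (b) There is a compact set $\Psi\subset\mathbb{R}^r$ (independent of $\delta$) such that $\mathcal{A}:=\mathcal{O}\times\Psi$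 is SGPAS as $\delta\to0^+$ for the hybrid system $$x_{u,z}\in C_{u,z},\ \dot x_{u,z}=\hat F_\delta(x_{u,z},\nabla J(\hat u));\qquad x_{u,z}\in D_{u,z},\ x_{u,z}^+=\hat G_\delta(x_{u,z}).$$ (c) For each compact set $K\subset\mathbb{R}^{n+r}$ there exist $\varepsilon_a^*>0$ and a continuous function $\sigma:\mathbb{R}^{n+r}\to\mathbb{R}_{\ge0}$ such that for all $\varepsilon_a\in(0,\varepsilon_a^* )$ the average map $\overline F_\delta$ of $(x_{u,z},\tau)\mapsto\hat F_\delta\big(x_{u,z},J(u(\hat u,\tau))\,\mu_{\varepsilon_a}(\tau)\big)$ with respect to $\tau$ satisfies, for all $x\in K\cap C_{u,z}$, $$\overline F_\delta(x)\in \overline{\mathrm{co}}\,F\big((x+\varepsilon_a\sigma(x)\mathbb{B})\cap C_{u,z}\big)+\varepsilon_a\sigma(x)\mathbb{B},\qquad F(x_{u,z}):=\hat F_\delta(x_{u,z},\nabla J(\hat u)).$$ Then the hybrid system with state $(x_{u,z},\tau)\in\mathbb{R}^{n+r}\times\mathbb{R}_{\ge0}$, $$(x_{u,z},\tau)\in C_{u,z}\times\mathbb{R}_{\ge0}:\quad \dot x_{u,z}=\hat F_\delta\big(x_{u,z},\,J(u(\hat u,\tau))\,\mu_{\varepsilon_a}(\tau)\big),\quad \dot\tau=\frac{1}{\varepsilon_\omega},$$ $$(x_{u,z},\tau)\in D_{u,z}\times\mathbb{R}_{\ge0}:\quad x_{u,z}^+=\hat G_\delta(x_{u,z}),\quad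 \tau^+=\tau,$$ renders the set $\mathcal{A}\times\mathbb{R}_{\ge0}$ SGPAS as $(\delta,\varepsilon_a,\varepsilon_\omega)\to0^+$.
   Context: Notation. $\mathbb{B}$ is the closed Euclidean unit ball of appropriate dimension; $\overline{\mathrm{co}}$ denotes the closed convex hull; $F(S)=\{F(x):x\in S\}$; $|x|_{\mathcal{A}}$ is the Euclidean distance from $x$ to $\mathcal{A}$. Average map. For a function $f(x,\tau)$, continuous and periodic in $\tau$ with a period $T$ independent of $x$ (as is the case here, because the $\kappa_i$ are rational), the average map is $\bar f(x)=\frac1T\int_0^T f(x,s)\,ds$. Hybrid systems. A hybrid system with state $x\in\mathbb{R}^p$ is written $x\in C,\ \dot x\in F(x)$; $x\in D,\ x^+\in G(x)$ (with equalities when the maps are single-valued). A compact hybrid time domain is a set $\bigcup_{j=0}^{N-1}([t_j,t_{j+1}]\times\{j\})$ with $0=t_0\le t_1\le\dots\le t_N$; a hybrid time domain is a union of a nondecreasing sequence of compact hybrid time domains. A hybrid arc is a function $x:\mathrm{dom}(x)\to\mathbb{R}^p$ on a hybrid time domain such that $t\mapsto x(t,j)$ is locally absolutely continuous on $I_j:=\{t:(t,j)\in\mathrm{dom}(x)\}$ for each $j$ for which $I_j$ has nonempty interior. It is a solution if $x(0,0)\in C\cup D$; for each $j$ such that $I_j$ has nonempty interior, $x(t,j)\in C$ and $\dot x(t,j)\in F(x(t,j))$ for almost all $t\in I_j$; and whenever $(t,j),(t,j+1)\in\mathrm{dom}(x)$, $x(t,j)\in D$ and $x(t,j+1)\in G(x(t,j))$.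 A solution is maximal if it cannot be extended to a solution with strictly larger domain. Solutions need not be unique or complete. Class $\mathcal{KL}$: functions $\beta:\mathbb{R}_{\ge0}^2\to\mathbb{R}_{\ge0}$ nondecreasing in the first argument, nonincreasing in the second, with $\lim_{r\to0^+}\beta(r,s)=0$ for each $s$ and $\lim_{s\to\infty}\beta(r,s)=0$ for each $r$. SGPAS. A hybrid system depending on parameters $(\varepsilon_1,\dots,\varepsilon_m)$ renders a closed set $\mathcal{A}$ semi-globally practically asymptotically stable (SGPAS) as $(\varepsilon_1,\dots,\varepsilon_m)\to0^+$ if there is $\beta\in\mathcal{KL}$ such that for each $\Delta>\nu>0$ there exists $\varepsilon_1^*>0$ such that for all $\varepsilon_1\in(0,\varepsilon_1^* )$ there exists $\varepsilon_2^*>0$ such that for all $\varepsilon_2\in(0,\varepsilon_2^* )$ $\dots$ there exists $\varepsilon_m^*>0$ such that for all $\varepsilon_m\in(0,\varepsilon_m^* )$, every maximal solution with $|x(0,0)|\le\Delta$ satisfies $|x(t,j)|_{\mathcal{A}}\le\beta(|x(0,0)|_{\mathcal{A}},t+j)+\nu$ for all $(t,j)\in\mathrm{dom}(x)$. *)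

(* Defs.v *)
From HB Require Import structures.
From mathcomp Require Import all_boot all_order all_algebra.
From mathcomp Require Import all_classical all_reals all_analysis.

Set Implicit Arguments.
Unset Strict Implicit.
Unset Printing Implicit Defensive.

Import Order.TTheory GRing.Theory Num.Theory numFieldNormedType.Exports.

Local Open Scope classical_set_scope.
Local Open Scope ring_scope.

(* The library norm on row vectors is the sup norm, which induces the usual
   topology but is not the distance used to state the stability bounds. *)
Definition eucl_norm (R : realType) (p : nat) (x : 'rV[R]_p) : R :=
  Num.sqrt (\sum_i x ord0 i ^+ 2).

Definition eucl_dist (R : realType) (p : nat) (A : set 'rV[R]_p) (x : 'rV[R]_p) : R :=
  inf [set eucl_norm (x - a) | a in A].

(* A + rho B, with B the closed Euclidean unit ball *)
Definition inflate (R : realType) (p : nat) (A : set 'rV[R]_p) (rho : R) :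
    set 'rV[R]_p :=
  [set a + rho *: b | a in A & b in [set b | eucl_norm b <= 1]].

Definition closed_convex_hull (R : realType) (p : nat) (A : set 'rV[R]_p) :
    set 'rV[R]_p :=
  smallest (fun B : set 'rV[R]_p =>
    closed B /\ convex_set (B : set (convex_lmodType 'rV[R]_p))) A.

Definition grad (R : realType) (n : nat) (f : 'rV[R]_n -> R) (u : 'rV[R]_n) :
    'rV[R]_n :=
  \row_i 'D_(delta_mx ord0 i) f u.

Definition C1 (R : realType) (n : nat) (f : 'rV[R]_n -> R) : Prop :=
  (forall u, differentiable f u) /\ continuous (grad f).

Definition C2 (R : realType) (n : nat) (f : 'rV[R]_n -> R) : Prop :=
  C1 f /\ forall i, C1 (fun u => grad f u ord0 i).

Definition minimizers (R : realType) (T : Type) (f : T -> R) (U : set T) : set T :=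
  [set u | U u /\ forall v, U v -> f u <= f v].

Definition maximizers (R : realType) (T : Type) (f : T -> R) (U : set T) : set T :=
  [set u | U u /\ forall v, U v -> f v <= f u].

(* Time average of f over one period T; the integral is taken entrywise. *)
Definition average (R : realType) (X : Type) (p : nat) (T : R)
    (f : X -> R -> 'rV[R]_p) (x : X) : 'rV[R]_p :=
  \row_i (T^-1 * \int[lebesgue_measure]_(s in `[0, T]) f x s ord0 i).

(* Pairwise non-overlapping intervals ]u k, v k[ inside [a, b]. *)
Definition abs_continuous (R : realType) (p : nat) (a b : R)
    (f : R -> 'rV[R]_p) : Prop :=
  forall e, 0 < e -> exists2 d, 0 < d &
    forall (m : nat) (u v : 'I_m -> R),
      (forall k, a <= u k /\ u k <= v k /\ v k <= b) ->
      (forall k l, k != l -> v k <= u l \/ v l <= u k) ->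
      \sum_k (v k - u k) < d ->
      \sum_k eucl_norm (f (v k) - f (u k)) < e.

Definition loc_abs_continuous (R : realType) (p : nat) (I : set R)
    (f : R -> 'rV[R]_p) : Prop :=
  forall a b, a <= b -> `[a, b] `<=` I -> abs_continuous a b f.

Record hybrid_system (R : realType) (p : nat) := HybridSystem {
  flow_set : set 'rV[R]_p;
  flow_map : 'rV[R]_p -> set 'rV[R]_p;
  jump_set : set 'rV[R]_p;
  jump_map : 'rV[R]_p -> set 'rV[R]_p }.

(* N = 0 gives the empty set; [solution] requires (0, 0) to be in the domain. *)
Definition compact_hybrid_time_domain (R : realType) (E : set (R * nat)) : Prop :=
  exists (N : nat) (t : nat -> R),
    [/\ t 0%N = 0,
        (forall j, (j < N)%N -> t j <= t j.+1) &
        E = [set q | (q.2 < N)%N /\ t q.2 <= q.1 <= t q.2.+1]].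

Definition hybrid_time_domain (R : realType) (E : set (R * nat)) : Prop :=
  exists K : nat -> set (R * nat),
    [/\ (forall k, compact_hybrid_time_domain (K k)),
        (forall k, K k `<=` K k.+1) &
        E = \bigcup_k K k].

(* [hval] is total; its values outside [hdom] are irrelevant. *)
Record hybrid_signal (R : realType) (p : nat) := HybridSignal {
  hdom : set (R * nat);
  hval :> R -> nat -> 'rV[R]_p }.

Definition slice (R : realType) (p : nat) (x : hybrid_signal R p) (j : nat) : set R :=
  [set t | hdom x (t, j)].

Definition hybrid_arc (R : realType) (p : nat) (x : hybrid_signal R p) : Prop :=
  hybrid_time_domain (hdom x) /\
  forall j, (slice x j)° !=set0 -> loc_abs_continuous (slice x j) (x^~ j).

Definition solution (R : realType) (p : nat) (H : hybrid_system R p)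
    (x : hybrid_signal R p) : Prop :=
  [/\ hybrid_arc x,
      hdom x (0, 0%N) /\ (flow_set H `|` jump_set H) (x 0 0%N),
      (forall j, (slice x j)° !=set0 ->
        {ae lebesgue_measure, forall t : R, slice x j t ->
          [/\ flow_set H (x t j),
              derivable (x^~ j) t 1 &
              flow_map H (x t j) ('D_1 (x^~ j) t)]}) &
      (forall t j, hdom x (t, j) -> hdom x (t, j.+1) ->
        jump_set H (x t j) /\ jump_map H (x t j) (x t j.+1))].

Definition maximal_solution (R : realType) (p : nat) (H : hybrid_system R p)
    (x : hybrid_signal R p) : Prop :=
  solution H x /\
  forall y : hybrid_signal R p, solution H y ->
    hdom x `<=` hdom y -> (forall t j, hdom x (t, j) -> y t j = x t j) ->
    hdom y = hdom x.

Definition class_KL (R : realType) (beta : R -> R -> R) : Prop :=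
  [/\ (forall r s, 0 <= r -> 0 <= s -> 0 <= beta r s),
      (forall r1 r2 s, 0 <= r1 -> r1 <= r2 -> 0 <= s -> beta r1 s <= beta r2 s),
      (forall r s1 s2, 0 <= r -> 0 <= s1 -> s1 <= s2 -> beta r s2 <= beta r s1),
      (forall s, 0 <= s -> beta r s @[r --> 0^'+] --> (0 : R)) &
      (forall r, 0 <= r -> beta r s @[s --> +oo] --> (0 : R))].

(* [param_family R m T] is R -> ... -> R -> T with m arguments. *)
Fixpoint param_family (R : realType) (m : nat) (T : Type) : Type :=
  if m is m'.+1 then R -> param_family R m' T else T.

(* exists e_1^* > 0, for all e_1 in (0, e_1^* ), ...,
   exists e_m^* > 0, for all e_m in (0, e_m^* ), P (H e_1 ... e_m) *)
Fixpoint for_small (R : realType) (m : nat) (T : Type) (P : T -> Prop) :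
    param_family R m T -> Prop :=
  match m return param_family R m T -> Prop with
  | 0%N => fun H => P H
  | m'.+1 => fun H => exists2 estar : R, 0 < estar &
      forall e : R, 0 < e < estar -> for_small P (H e)
  end.

(* Semi-global practical asymptotic stability as the m parameters tend to 0+,
   the threshold for each parameter depending on the preceding ones. *)
Definition SGPAS (R : realType) (p m : nat)
    (H : param_family R m (hybrid_system R p)) (A : set 'rV[R]_p) : Prop :=
  exists2 beta : R -> R -> R, class_KL beta &
    forall Delta nu, 0 < nu -> nu < Delta ->
      for_small (fun S : hybrid_system R p =>
        forall x, maximal_solution S x -> eucl_norm (x 0 0%N) <= Delta ->
          forall t j, hdom x (t, j) ->
            eucl_dist A (x t j) <= beta (eucl_dist A (x 0 0%N)) (t + j%:R) + nu) H.

Definition dither (R : realType) (n : nat) (kappa : 'I_n -> rat) (eps_a tau : R) :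
    'rV[R]_n :=
  \row_i (2 / eps_a * sin (2 * pi * ratr (kappa i) * tau)).

Definition probe (R : realType) (n : nat) (kappa : 'I_n -> rat) (eps_a : R)
    (u : 'rV[R]_n) (tau : R) : 'rV[R]_n :=
  u + (eps_a ^+ 2 / 2) *: dither kappa eps_a tau.

(* Right-hand side driven by J(u) mu in place of the gradient of J; its
   average over tau is what is compared with [nominal_flow]. *)
Definition es_flow (R : realType) (n r : nat) (kappa : 'I_n -> rat)
    (J : 'rV[R]_n -> R) (Fhat : 'rV[R]_(n + r) * 'rV[R]_n -> 'rV[R]_(n + r))
    (eps_a : R) (x : 'rV[R]_(n + r)) (tau : R) : 'rV[R]_(n + r) :=
  Fhat (x, J (probe kappa eps_a (lsubmx x) tau) *: dither kappa eps_a tau).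

Definition nominal_flow (R : realType) (n r : nat) (J : 'rV[R]_n -> R)
    (Fhat : 'rV[R]_(n + r) * 'rV[R]_n -> 'rV[R]_(n + r))
    (x : 'rV[R]_(n + r)) : 'rV[R]_(n + r) :=
  Fhat (x, grad J (lsubmx x)).

Definition nominal_system (R : realType) (n r : nat) (J : 'rV[R]_n -> R)
    (C D : set 'rV[R]_(n + r))
    (Fhat : 'rV[R]_(n + r) * 'rV[R]_n -> 'rV[R]_(n + r))
    (Ghat : 'rV[R]_(n + r) -> 'rV[R]_(n + r)) : hybrid_system R (n + r) :=
  {| flow_set := C;
     flow_map := fun x => [set nominal_flow J Fhat x];
     jump_set := D;
     jump_map := fun x => [set Ghat x] |}.

(* States of the closed loop are rows (x, tau) of length (n + r) + 1. *)
Definition clock (R : realType) (q : nat) (w : 'rV[R]_(q + 1)) : R :=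
  rsubmx w ord0 ord0.

Definition prod_nonneg (R : realType) (q : nat) (A : set 'rV[R]_q) :
    set 'rV[R]_(q + 1) :=
  [set w | A (lsubmx w) /\ 0 <= clock w].

Definition es_system (R : realType) (n r : nat) (kappa : 'I_n -> rat)
    (J : 'rV[R]_n -> R) (C D : set 'rV[R]_(n + r))
    (Fhat : 'rV[R]_(n + r) * 'rV[R]_n -> 'rV[R]_(n + r))
    (Ghat : 'rV[R]_(n + r) -> 'rV[R]_(n + r))
    (eps_a eps_w : R) : hybrid_system R (n + r + 1) :=
  {| flow_set := prod_nonneg C;
     flow_map := fun w =>
       [set row_mx (es_flow kappa J Fhat eps_a (lsubmx w) (clock w))
                   (const_mx eps_w^-1)];
     jump_set := prod_nonneg D;
     jump_map := fun w => [set row_mx (Ghat (lsubmx w)) (const_mx (clock w))] |}.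

(* Main.v *)
(* For fixed delta the average map differs from the nominal field F by a quantity
   that vanishes with eps_a: F is single-valued and continuous, so the inflated
   closed convex hull of (c) lies in a small ball around F.  Averaging over one
   period of the dither, which lasts eps_w * T in real time, then shows that the
   flows of the closed loop satisfy a discretised form of x' = F(x) up to an error
   eta.  An ultrafilter limit of eta-approximate hybrid paths with eta -> 0 is a
   solution of the nominal system; a maximal extension of it satisfies the assumed
   bound, which therefore passes to all eta-approximate paths of bounded length
   with eta small enough.  Restarting this finite-horizon estimate once the
   state is close to the target extends it to the whole hybrid time domain. *)
Require Import Defs.
From HB Require Import structures.
From mathcomp Require Import all_boot all_order all_algebra.
From mathcomp Require Import all_classical all_reals all_analysis.
From mathcomp Require Import measurable_realfun ring lra.

Set Implicit Arguments.
Unset Strict Implicit.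
Unset Printing Implicit Defensive.

Import Order.TTheory GRing.Theory Num.Theory numFieldNormedType.Exports.

Local Open Scope classical_set_scope.
Local Open Scope ring_scope.

(** * Sup norm, Euclidean norm and distance *)

(** The velocity of the closed loop need not approach the nominal field, however small the
    parameters: only its increments over whole dither periods do. Approximate flows are therefore
    described by increments with an additive error, which also absorbs an incomplete last period.
    The nominal field is merely continuous, so no Gronwall comparison with one chosen trajectory is
    possible; the bound is transferred by contradiction, from the limit of paths that violate it.
    The hypothesis speaks of maximal solutions, which a limit over a bounded horizon need not be,
    hence the extension by Zorn's lemma. Compactness needs the paths to stay in a ball, while the
    reason why they stay there is the very bound being proved. A continuation argument over the flow
    intervals breaks this circle. A jump can leave any neighbourhood at once, so the radius must
    also cover images under the jump map. Hence the order of choices: [delta], the radius, the speed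
    bound [M], the error [eta], then [eps_a] and last [eps_w], in accordance with the nested
    quantifiers of [SGPAS]. *)

Lemma rv_norm_leP (R : realType) (p : nat) (x : 'rV[R]_p) (c : R) :
  0 <= c -> (`|x| <= c) <-> (forall i, `|x ord0 i| <= c).
Proof.
move=> c0; rewrite [`|x|]mx_normrE; split.
  by move=> /bigmax_leP[_ h] i; exact: (h (ord0, i)).
by move=> h; apply/bigmax_leP; split => // -[i j] _ /=; rewrite (ord1 i).
Qed.

Lemma coord_le_norm (R : realType) (p : nat) (x : 'rV[R]_p) i :
  `|x ord0 i| <= `|x|.
Proof. by have /rv_norm_leP := lexx `|x|; apply. Qed.

Lemma sum_sqr_ge0 (R : realType) (p : nat) (x : 'rV[R]_p) :
  0 <= \sum_i x ord0 i ^+ 2.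
Proof. by apply: sumr_ge0 => i _; exact: sqr_ge0. Qed.

Lemma eucl_norm_ge0 (R : realType) (p : nat) (x : 'rV[R]_p) : 0 <= eucl_norm x.
Proof. exact: sqrtr_ge0. Qed.

Lemma norm_le_eucl (R : realType) (p : nat) (x : 'rV[R]_p) :
  `|x| <= eucl_norm x.
Proof.
apply/rv_norm_leP; first exact: eucl_norm_ge0.
move=> i; rewrite -sqrtr_sqr ler_sqrt ?sum_sqr_ge0//.
rewrite (bigD1 i)//= lerDl; apply: sumr_ge0 => j _; exact: sqr_ge0.
Qed.

Lemma eucl_le_norm (R : realType) (p : nat) (x : 'rV[R]_p) :
  eucl_norm x <= p%:R * `|x|.
Proof.
rewrite -[leRHS]ger0_norm ?mulr_ge0// -sqrtr_sqr ler_wsqrtr//.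
apply: (@le_trans _ _ (\sum_(i < p) `|x| ^+ 2)).
  apply: ler_sum => i _; rewrite -real_normK ?num_real//.
  by rewrite lerXn2r ?nnegrE// coord_le_norm.
rewrite sumr_const card_ord exprMn -[leLHS]mulr_natl ler_wpM2r ?sqr_ge0//.
by rewrite -natrX ler_nat; case: p x => // p _; rewrite leq_pmulr.
Qed.

(** Nonnegativity of the sum of squares of [B * a i - S * b i], which equals [B * (A * B - S ^+ 2)];
    if [B] vanishes, so does every [b i]. *)
Lemma CauchySchwarz_sum (R : realType) (p : nat) (a b : 'I_p -> R) :
  \sum_i a i * b i <=
    Num.sqrt (\sum_i a i ^+ 2) * Num.sqrt (\sum_i b i ^+ 2).
Proof.
set A := \sum_i a i ^+ 2; set B := \sum_i b i ^+ 2.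
have A0 : 0 <= A by apply: sumr_ge0 => i _; exact: sqr_ge0.
have B0 : 0 <= B by apply: sumr_ge0 => i _; exact: sqr_ge0.
set S := \sum_i a i * b i.
have h : 0 <= B * (A * B - S ^+ 2).
  have : 0 <= \sum_i (B * a i - S * b i) ^+ 2.
    by apply: sumr_ge0 => i _; exact: sqr_ge0.
  suff -> : \sum_i (B * a i - S * b i) ^+ 2 = B * (A * B - S ^+ 2) by [].
  transitivity (\sum_i (B ^+ 2 * a i ^+ 2 - (B * S *+ 2) * (a i * b i) +
      S ^+ 2 * b i ^+ 2)).
    by apply: eq_bigr => i _; ring.
  rewrite big_split/= sumrB -!mulr_sumr -/A -/B -/S; ring.
have [B00|Bn0] := eqVneq B 0.
  have b0 i : b i = 0.
    apply/eqP; rewrite -sqrf_eq0; apply/eqP.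
    have /eqP := B00; rewrite psumr_eq0; last by move=> j _; exact: sqr_ge0.
    by move=> /allP/(_ i); rewrite mem_index_enum => /(_ isT)/= /eqP.
  by rewrite /S big1 ?mulr_ge0 ?sqrtr_ge0// => i _; rewrite b0 mulr0.
have Bp : 0 < B by rewrite lt_def Bn0.
move: h; rewrite pmulr_rge0// subr_ge0 => h.
apply: le_trans (ler_norm _) _.
by rewrite -sqrtrM// -sqrtr_sqr ler_wsqrtr.
Qed.

Lemma eucl_normD (R : realType) (p : nat) (x y : 'rV[R]_p) :
  eucl_norm (x + y) <= eucl_norm x + eucl_norm y.
Proof.
have xy0 : 0 <= eucl_norm x + eucl_norm y by rewrite addr_ge0 ?eucl_norm_ge0.
rewrite -[leRHS]ger0_norm// -sqrtr_sqr ler_wsqrtr//.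
rewrite sqrrD !sqr_sqrtr ?sum_sqr_ge0//.
have := CauchySchwarz_sum (fun i => x ord0 i) (fun i => y ord0 i).
rewrite -!/(eucl_norm _) => CS.
have -> : \sum_i (x + y) ord0 i ^+ 2 = \sum_i x ord0 i ^+ 2 +
   (\sum_i x ord0 i * y ord0 i) *+ 2 + \sum_i y ord0 i ^+ 2.
  rewrite -sumrMnl -!big_split/=; apply: eq_bigr => i _.
  by rewrite !mxE sqrrD.
by rewrite lerD2r lerD2l lerMn2r.
Qed.

Lemma eucl_normN (R : realType) (p : nat) (x : 'rV[R]_p) :
  eucl_norm (- x) = eucl_norm x.
Proof.
by rewrite /eucl_norm; congr Num.sqrt; apply: eq_bigr => i _; rewrite mxE sqrrN.
Qed.

Lemma eucl_norm_lsub (R : realType) (p q : nat) (x : 'rV[R]_(p + q)) :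
  eucl_norm (lsubmx x) <= eucl_norm x.
Proof.
rewrite ler_wsqrtr// [leRHS]big_split_ord/=.
apply: (@le_trans _ _ (\sum_i x ord0 (lshift q i) ^+ 2)).
  by apply: ler_sum => i _; rewrite mxE.
by rewrite lerDl; apply: sumr_ge0 => i _; exact: sqr_ge0.
Qed.

Lemma norm_lsub (R : realType) (p q : nat) (x : 'rV[R]_(p + q)) :
  `|lsubmx x| <= `|x|.
Proof. by apply/rv_norm_leP => // i; rewrite mxE; exact: coord_le_norm. Qed.

Lemma norm_rsub (R : realType) (p q : nat) (x : 'rV[R]_(p + q)) :
  `|rsubmx x| <= `|x|.
Proof. by apply/rv_norm_leP => // i; rewrite mxE; exact: coord_le_norm. Qed.

Section EuclideanDistance.
Variables (R : realType) (p : nat) (A : set 'rV[R]_p).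

Let has_inf_dist x : A !=set0 -> has_inf [set eucl_norm (x - a) | a in A].
Proof.
move=> [a Aa]; split; first by exists (eucl_norm (x - a)), a.
by exists 0 => _ [b _ <-]; exact: eucl_norm_ge0.
Qed.

Lemma eucl_dist_le x a : A a -> eucl_dist A x <= eucl_norm (x - a).
Proof.
move=> Aa; apply: ge_inf; last by exists a.
by apply: (has_inf_dist x _).2; exists a.
Qed.

Lemma eucl_dist_lt x (e : R) : A !=set0 -> 0 < e ->
  exists2 a, A a & eucl_norm (x - a) < eucl_dist A x + e.
Proof.
move=> A0 e0; have [_ [a Aa <-] lt] := inf_adherent e0 (has_inf_dist x A0).
by exists a.
Qed.

Lemma eucl_dist_ge0 x : 0 <= eucl_dist A x.
Proof.
(* The infimum of the empty set is 0 by convention. *)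
have [A0|/set0P/negP/negPn/eqP A0] := pselect (A !=set0); last first.
  by rewrite /eucl_dist A0 image_set0 inf0.
apply: lb_le_inf; first by case: (has_inf_dist x A0).
by move=> _ [b _ <-]; exact: eucl_norm_ge0.
Qed.

Lemma eucl_dist_lip x y : A !=set0 ->
  eucl_dist A x <= eucl_dist A y + eucl_norm (x - y).
Proof.
move=> A0; apply/ler_addgt0Pr => e e0.
have [a Aa lt] := eucl_dist_lt y A0 e0.
apply: le_trans (eucl_dist_le x Aa) _.
have -> : x - a = (x - y) + (y - a) by rewrite addrA subrK.
by have := eucl_normD (x - y) (y - a); lra.
Qed.

End EuclideanDistance.

(** * Compactness and absolutely continuous functions *)

Lemma norm_ball_compact (R : realType) (p : nat) (rho : R) :
  compact [set x : 'rV[R]_p | `|x| <= rho].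
Proof.
apply: bounded_closed_compact.
  by exists rho; split; [exact: num_real|move=> M rM x /= h; exact: le_trans h (ltW rM)].
rewrite (_ : mkset _ = (fun x : 'rV[R]_p => `|x|) @^-1` [set y | y <= rho]) //.
apply: closed_comp; last exact: closed_le.
by move=> x _; exact: norm_continuous.
Qed.

(** Near each point of [K] every large enough [M] is a bound; the near-covering form of compactness
    makes the threshold uniform. *)
Lemma compact_continuous_bounded (R : realType) (V W : normedModType R)
    (f : V -> W) (K : set V) : continuous f -> compact K ->
  exists2 M, 0 <= M & forall x, K x -> `|f x| <= M.
Proof.
move=> fc /compact_near_coveringP Kc.
have /(_ _)[] := Kc _ (pinfty_nbhs R) (fun M x => `|f x| <= M) _.
  move=> x Kx; exists ([set x' | `|f x'| < `|f x| + 1], [set M | `|f x| + 1 < M]).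
    split => /=.
      have : `|f x'| @[x' --> x] --> `|f x| by apply: cvg_norm; exact: fc.
      by move/cvgr_lt; apply; rewrite ltrDl.
    by exists (`|f x| + 1); split => //; exact: num_real.
  by move=> [x' M] [/= h1 h2]; exact/ltW/(lt_trans h1).
move=> M [Mr h]; exists (`|M| + 1); first by rewrite addr_ge0.
by apply: h; rewrite (le_lt_trans (ler_norm _))// ltrDl.
Qed.

(** Heine-Cantor with only one of the two points required to lie in [K]: the points of an inflated
    set, to which it is applied later, may leave the compact set. *)
Lemma compact_unif_continuous (R : realType) (V W : normedModType R)
    (f : V -> W) (K : set V) (e : R) : continuous f -> compact K -> 0 < e ->
  exists2 h, 0 < h & forall x y, K x -> `|x - y| <= h -> `|f x - f y| <= e.
Proof.
move=> fc /compact_near_coveringP Kc e0.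
have := Kc _ (0 : R)^'+ (fun h x => forall y, `|x - y| <= h -> `|f x - f y| <= e) _.
case.
  move=> x Kx.
  have : \forall y \near x, `|f x - f y| <= e / 2.
    by apply: cvgr_dist_le; [exact: fc|rewrite divr_gt0].
  case/nbhs_ballP => d /= d0 hd.
  exists (ball x (d / 2), [set h | h < d / 2]).
    split => /=; first by apply: nbhsx_ballx; rewrite divr_gt0.
    by apply: nbhs_right_lt; rewrite divr_gt0.
  move=> [x' h] [/= xx' hd2] y x'y.
  have h1 : `|f x - f x'| <= e / 2.
    by apply: hd; apply: le_ball xx'; lra.
  have h2 : `|f x - f y| <= e / 2.
    apply: hd; move: xx'; rewrite -!ball_normE /= => xx'.
    rewrite (_ : x - y = (x - x') + (x' - y)); last by rewrite addrA subrK.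
    have := ler_normD (x - x') (x' - y); lra.
  rewrite (_ : f x' - f y = (f x' - f x) + (f x - f y)); last by rewrite addrA subrK.
  have := ler_normD (f x' - f x) (f x - f y); rewrite (distrC (f x')); lra.
move=> d /= d0 hd; exists (d / 2); first by rewrite divr_gt0.
move=> x y Kx xy; apply: (hd (d / 2)) => //=; last by rewrite divr_gt0.
by rewrite sub0r normrN gtr0_norm ?divr_gt0//; lra.
Qed.

(** Induction along a real interval. The local step goes from a point on the left of [t] to one on
    the right, so that applied at the supremum of the good points it shows both that the supremum is
    good and that it cannot be smaller than [b]. *)
Lemma creeping (R : realType) (a b : R) (P : R -> Prop) : a <= b -> P a ->
  (forall t, a <= t <= b -> exists2 g, 0 < g &
    forall u v, a <= u -> u <= t -> t <= v -> v <= b -> t - g < u -> v < t + g ->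
      P u -> P v) -> P b.
Proof.
move=> ab Pa H; set S := [set t | a <= t <= b /\ P t].
have Sa : S a by split; rewrite ?lexx.
have hS : has_sup S by split; [exists a|exists b => t [/andP[]]].
have Sle t : S t -> t <= sup S by move=> St; apply: sup_upper_bound.
have supab : a <= sup S <= b.
  apply/andP; split; first exact: Sle.
  by apply: ge_sup; [exists a|move=> t [/andP[]]].
have [g g0 hg] := H _ supab.
have [u [/andP[au ub] Pu] ltu] := sup_adherent g0 hS.
have us : u <= sup S by apply: Sle; split => //; rewrite au ub.
case/andP: supab => as_ sb.
have step v : sup S <= v -> v <= b -> v < sup S + g -> P v.
  by move=> sv vb vg; exact: (hg u v au us sv vb ltu vg Pu).
have [eqb|neqb] := eqVneq (sup S) b; first by apply: step; rewrite -?eqb// ltrDl.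
have ltb : sup S < b by rewrite lt_neqAle neqb.
pose v := Num.min b (sup S + g / 2).
have vs : sup S < v by rewrite lt_min ltb ltrDl divr_gt0.
have vb : v <= b by rewrite ge_min lexx.
have vg : v < sup S + g.
  by rewrite gt_min; apply/orP; right; rewrite ltrD2l; lra.
have : S v by split; [rewrite (le_trans as_ (ltW vs)) vb|exact: step (ltW vs) vb vg].
by move/Sle; rewrite leNgt vs.
Qed.

(** Both increments are taken from [t] itself; since [u] and [v] lie on opposite sides of [t], the
    two error terms add up to a multiple of [v - u]. *)
Lemma derivable_local_lip (R : realType) (f : R -> R) (t c e : R) :
  derivable f t 1 -> `|'D_1 f t| <= c -> 0 < e ->
  exists2 g, 0 < g & forall u v, u <= t -> t <= v -> t - g < u -> v < t + g ->
    `|f v - f u| <= (c + e) * (v - u).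
Proof.
move=> df Dc e0.
have : \forall h \near 0^', `|'D_1 f t - h^-1 *: (f (h *: 1 + t) - f t)| <= e.
  by apply: cvgr_dist_le.
rewrite near_withinE => /nbhs_ballP[g /= g0 hg].
have est h : `|h| < g -> `|f (h + t) - f t| <= (c + e) * `|h|.
  move=> hlt; have [->|h0] := eqVneq h 0.
    by rewrite add0r subrr normr0 mulr0.
  have := hg h; rewrite -ball_normE /= sub0r normrN => /(_ hlt h0).
  rewrite /GRing.scale/= mulr1 => k.
  have hp : 0 < `|h| by rewrite normr_gt0.
  have -> : f (h + t) - f t = h * (h^-1 * (f (h + t) - f t)).
    by rewrite mulrA mulfV// mul1r.
  rewrite normrM mulrC ler_wpM2r//.
  set q := h^-1 * _ in k *.
  have := ler_normB ('D_1 f t) ('D_1 f t - q); rewrite opprB addrC subrK; lra.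
exists g => // u v ut tv gu vg.
have h1 := est (v - t); have h2 := est (u - t).
rewrite subrK ger0_norm ?subr_ge0// in h1.
rewrite subrK ler0_norm ?subr_le0// in h2.
have := ler_normB (f v - f t) (f u - f t).
rewrite opprB addrA subrK => h3.
have {}h1 := h1 ltac:(lra); have {}h2 := h2 ltac:(lra).
apply: le_trans h3 _; apply: le_trans (lerD h1 h2) _; lra.
Qed.

Lemma lebesgue_measure_itv_oc (R : realType) (u v : R) : u <= v ->
  lebesgue_measure (`]u, v]%classic : set R) = (v - u)%:E.
Proof.
move=> uv; rewrite lebesgue_measure_itv/= lte_fin; case: ltP => // vu.
by rewrite (le_anti (introT andP (conj uv vu))) subrr.
Qed.

(** Scalar counterpart of [abs_continuous]: the mean value estimates run coordinate by
    coordinate. *)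
Definition real_abs_continuous (R : realType) (a b : R) (f : R -> R) : Prop :=
  forall e, 0 < e -> exists2 d, 0 < d &
    forall (m : nat) (u v : 'I_m -> R),
      (forall k, a <= u k /\ u k <= v k /\ v k <= b) ->
      (forall k l, k != l -> v k <= u l \/ v l <= u k) ->
      \sum_k (v k - u k) < d ->
      \sum_k `|f (v k) - f (u k)| < e.

(** The exceptional null set is covered by an open set [U] of measure less than the [d] that
    absolute continuity provides for [e]. Creeping from [a] to [b] uses the derivative at regular
    points and merely records an interval inside [U] at the others; the recorded intervals have
    total length below [d], so all their increments together cost at most [e]. *)
Lemma abs_continuous_mean_value (R : realType) (a b c : R) (f : R -> R) :
  a <= b -> 0 <= c -> real_abs_continuous a b f ->
  {ae lebesgue_measure, forall t : R, a < t < b ->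
    derivable f t 1 /\ `|'D_1 f t| <= c} ->
  `|f b - f a| <= c * (b - a).
Proof.
move=> ab c0 fac fae.
suff main e : 0 < e -> `|f b - f a| <= (c + e) * (b - a) + e.
  apply/ler_addgt0Pr => e e0.
  have ba1 : 0 < (b - a) + 1 by lra.
  have := main (e / ((b - a) + 1)) (divr_gt0 e0 ba1).
  suff -> : (c + e / (b - a + 1)) * (b - a) + e / (b - a + 1) = c * (b - a) + e by [].
  by field; rewrite gt_eqF.
move=> e0; have [d d0 hd] := fac e e0.
pose mu := @lebesgue_measure R.
have [B [mB muB hB]] := fae.
(* The endpoints, where nothing is known about the derivative, are treated as exceptional points. *)
pose D := B `|` ([set a] `|` [set b]).
have mD : measurable D by do !apply: measurableU => //; exact: measurable_set1.
have muD : mu D = 0%E.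
  apply: measure_negligible => //; apply: negligibleU; first by exists B; split.
  apply: negligibleU; (apply/negligibleP; first exact: measurable_set1);
    exact: lebesgue_measure_set1.
have [|U [oU DU muU]] := lebesgue_regularity_outer mD _ d0.
  exact: (eq_ind_r (fun z => (z < +oo)%E) (ltry 0) muD).
have {}muU : (mu (U `\` D) < d%:E)%E := muU.
have mU : measurable U by exact: open_measurable.
have {}muU : (mu U < d%:E)%E.
  apply: le_lt_trans muU; rewrite -/mu -[leRHS]adde0 -muD.
  rewrite -[in leLHS](setDUK DU) setUC.
  by apply: measureU2 => //; exact: measurableD.
(* The intervals recorded up to [t]. Bounding their length by the measure of [U] within [[a, t]],
   and not of all of [U], lets the bound survive the addition of one more interval. *)
pose good t := exists m (u v : nat -> R),
  [/\ forall k, (k < m)%N -> [/\ a <= u k, u k <= v k & v k <= t],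
      forall k l, (k < m)%N -> (l < m)%N -> k != l -> v k <= u l \/ v l <= u k,
      ((\sum_(k < m) (v k - u k))%:E <= mu (U `&` `[a, t]))%E &
      `|f t - f a| <= (c + e) * (t - a) + \sum_(k < m) `|f (v k) - f (u k)|].
have : good b.
  apply: (creeping (a := a)) => //.
    exists 0%N, (fun=> 0), (fun=> 0); split => //.
      by rewrite big_ord0 measure_ge0.
    by rewrite !subrr normr0 mulr0 big_ord0 addr0.
  move=> t /andP[at_ tb].
  have [Ut|nUt] := pselect (U t).
    have /nbhs_ballP[g /= g0 gU] : nbhs t U by exact: open_nbhs_nbhs.
    exists g => // u v au ut tv vb gu vg [m [p [q [h1 h2 h3 h4]]]].
    exists m.+1, (fun k => if k == m then u else p k),
      (fun k => if k == m then v else q k).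
    have uv : u <= v by exact: le_trans tv.
    split.
    - move=> k; rewrite ltnS leq_eqVlt; case: eqVneq => [//|_ /= /h1[? ? ?]].
      by split => //; exact: le_trans uv.
    - move=> k l km lm kl.
      have [ek|nk] := eqVneq k m; have [el|nl] := eqVneq l m.
      + by move: kl; rewrite ek el eqxx.
      + have /h1[_ _ h] : (l < m)%N by rewrite ltn_neqAle nl.
        by right.
      + have /h1[_ _ h] : (k < m)%N by rewrite ltn_neqAle nk.
        by left.
      + by apply: h2 => //; rewrite ltn_neqAle ?nk ?nl.
    - rewrite big_ord_recr/= eqxx (eq_bigr (fun k : 'I_m => q k - p k)); last first.
        by move=> k _; rewrite ltn_eqF.
      have muv : mu `]u, v]%classic = (v - u)%:E := lebesgue_measure_itv_oc uv.
      rewrite EFinD -muv; apply: le_trans (leeD h3 (lexx _)) _.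
      rewrite -measureU//; last 2 first.
        by apply: measurableI => //; exact: measurable_itv.
        apply/seteqP; split => // x [[_]] /=; rewrite !in_itv/=.
        by move=> /andP[_ xu] /andP[ux _]; move: (lt_le_trans ux xu); rewrite ltxx.
      apply: le_measure; rewrite ?inE.
      + apply: measurableU => //; apply: measurableI => //; exact: measurable_itv.
      + apply: measurableI => //; exact: measurable_itv.
      + move=> x [[Ux]|] /=; rewrite !in_itv/= => /andP[xl xr].
          by split => //; rewrite xl/= (le_trans xr).
        split; last by rewrite (le_trans au (ltW xl)).
        apply: gU; rewrite /= -ball_normE/= ltr_norml; apply/andP; split; lra.
    - rewrite big_ord_recr/= eqxx (eq_bigr (fun k : 'I_m => `|f (q k) - f (p k)|)); last first.
        by move=> k _; rewrite ltn_eqF.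
      have := ler_normD (f v - f u) (f u - f a); rewrite addrA subrK.
      set S := \sum_(i < m) _ in h4 *.
      have : (c + e) * (u - a) <= (c + e) * (v - a).
        by rewrite ler_wpM2l//; lra.
      lra.
  have [dft Dft] : derivable f t 1 /\ `|'D_1 f t| <= c.
    have nDt : ~ D t by move=> /DU.
    apply: contrapT => nP; apply: nDt; left; apply: hB => /= hP; apply: nP; apply: hP.
    rewrite !lt_neqAle at_ tb !andbT; apply/andP; split; apply/eqP => eqt; apply: nUt;
      apply: DU; right; [left|right] => /=; exact: esym.
  have [g g0 hg] := derivable_local_lip dft Dft e0.
  exists g => // u v au ut tv vb gu vg [m [p [q [h1 h2 h3 h4]]]].
  have uv : u <= v by exact: le_trans tv.
  exists m, p, q; split => //.
  - by move=> k /h1[? ? ?]; split => //; exact: le_trans uv.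
  - apply: le_trans h3 _; apply: le_measure; rewrite ?inE.
    + by apply: measurableI => //; exact: measurable_itv.
    + by apply: measurableI => //; exact: measurable_itv.
    + move=> x [Ux] /=; rewrite !in_itv/= => /andP[xl xr].
      by split => //; rewrite xl/= (le_trans xr).
  - have := ler_normD (f v - f u) (f u - f a); rewrite addrA subrK.
    have := hg u v ut tv gu vg.
    lra.
move=> [m [p [q [h1 h2 h3 h4]]]].
apply: le_trans h4 _; rewrite lerD2l; apply: ltW.
apply: (hd m (fun k => p k) (fun k => q k)).
- by move=> k; have [] := h1 k (ltn_ord k).
- by move=> k l kl; apply: h2.
- rewrite -lte_fin; apply: le_lt_trans muU; apply: le_trans h3 _.
  apply: le_measure; rewrite ?inE//.
  by apply: measurableI => //; exact: measurable_itv.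
Qed.

Lemma derivable_mean_value (R : realType) (a b c : R) (f : R -> R) : a <= b ->
  (forall t, a <= t <= b -> derivable f t 1 /\ `|'D_1 f t| <= c) ->
  `|f b - f a| <= c * (b - a).
Proof.
move=> ab fd; apply/ler_addgt0Pr => e e0.
have ba1 : 0 < (b - a) + 1 by lra.
pose e' := e / (b - a + 1); have e'0 : 0 < e' by exact: divr_gt0.
suff h : `|f b - f a| <= (c + e') * (b - a).
  apply: le_trans h _; rewrite mulrDl lerD2l /e' mulrAC ler_pdivrMr//.
  by rewrite ler_wpM2l ?ltW//; lra.
apply: (creeping (P := fun t => `|f t - f a| <= (c + e') * (t - a)) ab).
  by rewrite !subrr normr0 mulr0.
move=> t tab; have [dft Dft] := fd t tab.
have [g g0 hg] := derivable_local_lip dft Dft e'0.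
exists g => // u v au ut tv vb gu vg hu.
have := ler_normD (f v - f u) (f u - f a); rewrite addrA subrK.
have := hg u v ut tv gu vg; lra.
Qed.

Lemma coord_derivable (R : realType) (p : nat) (f : R -> 'rV[R]_p) (t : R) i :
  derivable f t 1 -> derivable (fun s => f s ord0 i) t 1 /\
    'D_1 (fun s => f s ord0 i) t = ('D_1 f t) ord0 i.
Proof.
move=> df.
have h : (fun h => h^-1 *: (f (h *: (1:R) + t) ord0 i - f t ord0 i)) @ 0^' -->
    ('D_1 f t) ord0 i.
  have -> : (fun h => h^-1 *: (f (h *: (1:R) + t) ord0 i - f t ord0 i)) =
     (fun M : 'rV[R]_p => M ord0 i) \o (fun h => h^-1 *: (f (h *: (1:R) + t) - f t)).
    by apply/funext => h /=; rewrite !mxE.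
  apply: (@cvg_comp _ _ _ _ (fun M : 'rV[R]_p => M ord0 i) _ _ _ df).
  exact: coord_continuous.
by split; [apply: cvgP h|exact: cvg_lim h].
Qed.

Lemma abs_continuous_coord (R : realType) (p : nat) (a b : R)
    (f : R -> 'rV[R]_p) i :
  abs_continuous a b f -> real_abs_continuous a b (fun s => f s ord0 i).
Proof.
move=> fac e e0; have [d d0 hd] := fac e e0; exists d => // m u v h1 h2 h3.
apply: le_lt_trans (hd m u v h1 h2 h3); apply: ler_sum => k _.
have := coord_le_norm (f (v k) - f (u k)) i; rewrite !mxE => /le_trans; apply.
exact: norm_le_eucl.
Qed.

Lemma abs_continuousS (R : realType) (p : nat) (a b c d : R)
    (f : R -> 'rV[R]_p) :
  a <= c -> d <= b -> abs_continuous a b f -> abs_continuous c d f.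
Proof.
move=> ac db fac e e0; have [h h0 hd] := fac e e0; exists h => // m u v h1.
apply: hd => k; have [? [? ?]] := h1 k.
by split; [exact: le_trans ac _|split => //; exact: le_trans db].
Qed.

(** An arc is compared with an explicit Lipschitz primitive by applying the mean value inequality to
    their difference, which must be absolutely continuous. *)
Lemma real_abs_continuousB (R : realType) (a b c : R) (f g : R -> R) :
  0 <= c -> real_abs_continuous a b f ->
  (forall s t, a <= s -> s <= t -> t <= b -> `|g t - g s| <= c * (t - s)) ->
  real_abs_continuous a b (fun t => f t - g t).
Proof.
move=> c0 fac gl e e0; have e2 : 0 < e / 2 by lra.
have [d d0 hd] := fac _ e2.
pose d' := (e / 2) / (c + 1); have d'0 : 0 < d' by rewrite divr_gt0//; lra.
exists (Num.min d d'); first by rewrite lt_min d0.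
move=> m u v h1 h2; rewrite lt_min => /andP[h3 h4].
apply: (@le_lt_trans _ _ (\sum_k (`|f (v k) - f (u k)| + c * (v k - u k)))).
  apply: ler_sum => k _; have [h5 [h6 h7]] := h1 k.
  have := gl _ _ h5 h6 h7.
  have -> : f (v k) - g (v k) - (f (u k) - g (u k)) =
    (f (v k) - f (u k)) - (g (v k) - g (u k)) by ring.
  have := ler_normB (f (v k) - f (u k)) (g (v k) - g (u k)); lra.
rewrite big_split/= -mulr_sumr.
have := hd m u v h1 h2 h3.
have : c * (\sum_k (v k - u k)) <= e / 2.
  apply: (@le_trans _ _ (c * d')); first by rewrite ler_wpM2l// ltW.
  rewrite /d' mulrCA ler_piMr ?(ltW e2)// ler_pdivrMr; lra.
lra.
Qed.

Lemma periodic_primitive (R : realType) (T : R) (f : R -> R) :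
  0 < T -> continuous f -> (forall s, f (s + T) = f s) ->
  exists Phi : R -> R,
    (forall s, 0 <= s -> derivable Phi s 1 /\ 'D_1 Phi s = f s) /\
    (forall s, 0 <= s ->
      Phi (s + T) - Phi s = \int[lebesgue_measure]_(t in `[0, T]) f t).
Proof.
move=> T0 fc fT.
have fint (a b : R) : lebesgue_measure.-integrable `[a, b] (EFin \o f).
  apply: continuous_compact_integrable; first exact: segment_compact.
  by apply: continuous_subspaceT.
have [Phi [dPhi PhiT]] : exists Phi : R -> R,
    (forall s, 0 <= s -> derivable Phi s 1 /\ 'D_1 Phi s = f s) /\
    Phi T - Phi 0 = \int[lebesgue_measure]_(t in `[0, T]) f t.
  (* Starting the integral at -1 makes 0 an interior point, hence the primitive is differentiable on
     both sides there; the clock may start at 0. *)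
  exists (fun s => \int[lebesgue_measure]_(t in `[-1, s]) f t); split.
    move=> s s0; have s1 : s < s + 1 by lra.
    have m1s : -1 < s by lra.
    have [h1 h2] := continuous_FTC1_closed s1 (fint _ _) m1s (fc s).
    by split; [exact: h1|rewrite -derive1E; exact: h2].
  rewrite (@Rintegral_itvB _ f (BLeft (-1)) (BRight T) 0) ?bnd_simp//.
  - by rewrite Rintegral_itv_obnd_cbnd//; apply: integrableS (fint 0 T) => //;
      exact: subset_itv_oc_cc.
  - exact: ltW.
exists Phi; split => // s s0.
have dsh t : 0 <= t -> derivable (fun t => Phi (t + T)) t 1 /\
    'D_1 (fun t => Phi (t + T)) t = f t.
  move=> t0; have tT0 : 0 <= t + T by rewrite addr_ge0// ltW.
  have [h1 h2] := dPhi (t + T) tT0.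
  have sT : is_derive t (1:R) (id + cst T) (1 + 0).
    exact: is_deriveD.
  rewrite -[fun t => Phi (t + T)]/(Phi \o (id + cst T)).
  have dT : derivable (id + cst T) t (1:R) by exact: ex_derive.
  have d1 : differentiable (id + cst T) t by exact/derivable1_diffP.
  have d2 : differentiable Phi ((id + cst T) t) by exact/derivable1_diffP.
  split; first by apply/derivable1_diffP; exact: differentiable_comp.
  rewrite -derive1E derive1_comp// !derive1E.
  by rewrite (derive_val (f := id + cst T)) addr0 mulr1 h2 fT.
(* By periodicity [Phi (t + T) - Phi t] has derivative 0, so the increment over a period does not
   depend on where the period starts. *)
have : `|(Phi (s + T) - Phi s) - (Phi (0 + T) - Phi 0)| <= 0 * (s - 0).
  apply: (derivable_mean_value (f := fun t => Phi (t + T) - Phi t)) => //.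
  move=> t /andP[t0 ts]; have [h1 h2] := dsh t t0; have [h3 h4] := dPhi t t0.
  split; first exact: derivableB.
  by rewrite deriveB// h2 h4 subrr normr0.
rewrite mul0r normr_le0 subr_eq0 => /eqP ->.
by rewrite add0r.
Qed.

(** * Averaging *)

(** An Euler estimate in integrated form. Here [w] is any bound for the oscillation of [F] at the
    distance that [x] may travel between [s] and [t]; quantifying over it avoids choosing a modulus
    of continuity. The errors [eta] that do not scale with [t - s] account for incomplete
    periods. *)
Definition approx_flow (R : realType) (m : nat) (F : 'rV[R]_m -> 'rV[R]_m)
    (rho M eta a b : R) (x : R -> 'rV[R]_m) : Prop :=
  forall s t, a <= s -> s <= t -> t <= b ->
    `|x t - x s| <= M * (t - s) + eta /\
    forall w, (forall u v, `|u| <= rho -> `|v| <= rho ->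
        `|u - v| <= M * (t - s) + eta -> `|F u - F v| <= w) ->
      `|x t - x s - (t - s) *: F (x s)| <= (t - s) * (w + eta) + eta.

Lemma ae_monotone (R : realType) (P Q : R -> Prop) :
  {ae lebesgue_measure, forall t : R, P t} -> (forall t, P t -> Q t) ->
  {ae lebesgue_measure, forall t : R, Q t}.
Proof. by move=> hP PQ; apply: negligibleS hP => t /= nQ /PQ. Qed.

Lemma real_derivableB (R : realType) (f g : R -> R) (t : R) :
  derivable f t 1 -> derivable g t 1 ->
  derivable (fun r => f r - g r) t 1 /\
  'D_1 (fun r => f r - g r) t = 'D_1 f t - 'D_1 g t.
Proof.
move=> df dg; rewrite -[fun r => _]/(f - g); split; first exact: derivableB.
by rewrite deriveB.
Qed.

Lemma affine_derive (R : realType) (k c t : R) :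
  derivable (fun r : R => k * r + c) t 1 /\
  'D_1 (fun r : R => k * r + c) t = k.
Proof.
have h : is_derive t (1:R) (k *: id + cst c) (k *: 1 + 0).
  exact: is_deriveD.
rewrite -[fun r => _]/(k *: id + cst c); split; first exact: ex_derive.
by rewrite (derive_val (f := k *: id + cst c)) addr0 /GRing.scale/= mulr1.
Qed.

Lemma comp_affine_derive (R : realType) (f : R -> R) (k c t : R) :
  derivable f (k * t + c) 1 ->
  derivable (fun r : R => f (k * r + c)) t 1 /\
  'D_1 (fun r : R => f (k * r + c)) t = 'D_1 f (k * t + c) * k.
Proof.
move=> df; have [dg Dg] := affine_derive k c t.
have dg' : differentiable (fun r : R => k * r + c) t by exact/derivable1_diffP.
have df' : differentiable f (k * t + c) by exact/derivable1_diffP.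
split.
  apply/derivable1_diffP.
  exact: (differentiable_comp (g := f) (f := fun r : R => k * r + c)).
rewrite -derive1E.
rewrite -[fun r => f _]/(f \o (fun r : R => k * r + c)) derive1_comp//.
by rewrite !derive1E Dg.
Qed.

Section Averaging.
Variables (R : realType) (m : nat) (C : set 'rV[R]_m).
Variables (f : 'rV[R]_m -> R -> 'rV[R]_m) (F : 'rV[R]_m -> 'rV[R]_m).
Variables (T rho B M0 eta h1 eps : R).
Hypothesis T0 : 0 < T.
Hypothesis B0 : 0 <= B.
Hypothesis M00 : 0 <= M0.
Hypothesis eta0 : 0 < eta.
Hypothesis eps0 : 0 < eps.
Hypothesis f_cont : forall v, continuous (f v).
Hypothesis f_per : forall v s, f v (s + T) = f v s.
Hypothesis f_bnd : forall v s, `|v| <= rho -> 0 <= s -> `|f v s| <= B.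
Hypothesis f_unif : forall u v s, `|u| <= rho -> `|v| <= rho -> 0 <= s ->
  `|u - v| <= h1 -> `|f u s - f v s| <= eta.
Hypothesis F_bnd : forall v, `|v| <= rho -> `|F v| <= M0.
Hypothesis avg : forall v, C v -> `|v| <= rho -> `|average T f v - F v| <= eta.
(** A period lasts [eps * T], and the state moves by at most [B * (eps * T)] meanwhile. The first
    bound allows the state to be frozen inside [f] during a period; the second makes both the motion
    and the nominal drift over an incomplete period negligible. *)
Hypothesis small1 : B * (eps * T) <= h1.
Hypothesis small2 : (B + M0) * (eps * T) <= eta.

Variables (a b : R) (y : R -> 'rV[R]_(m + 1)).
Hypothesis y_ac : abs_continuous a b y.
Hypothesis y_ae : {ae lebesgue_measure, forall t : R, a < t < b ->
  derivable y t 1 /\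
  'D_1 y t = row_mx (f (lsubmx (y t)) (clock (y t))) (const_mx eps^-1)}.
Hypothesis y_C : forall t, a <= t <= b -> C (lsubmx (y t)).
Hypothesis y_clock : forall t, a <= t <= b -> 0 <= clock (y t).
Hypothesis y_rho : forall t, a <= t <= b -> `|lsubmx (y t)| <= rho.

Let x t := lsubmx (y t).

Let clockE t : clock (y t) = y t ord0 (rshift m ord0).
Proof. by rewrite /clock mxE. Qed.

Let xE t i : x t ord0 i = y t ord0 (lshift 1 i).
Proof. by rewrite /x mxE. Qed.

Let clock_affine s t : a <= s -> s <= t -> t <= b ->
  clock (y t) = eps^-1 * t + (clock (y s) - eps^-1 * s).
Proof.
move=> as_ st tb.
(* The mean value inequality with constant 0: the difference has derivative 0 almost everywhere. *)
suff : `|(clock (y t) - (eps^-1 * t + 0)) - (clock (y s) - (eps^-1 * s + 0))| <= 0 * (t - s).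
  by rewrite mul0r normr_le0 subr_eq0 => /eqP; lra.
have k0 : 0 <= eps^-1 by rewrite invr_ge0 ltW.
apply: (abs_continuous_mean_value (f := fun t => clock (y t) - (eps^-1 * t + 0))) => //.
  apply: (real_abs_continuousB k0).
    have := abs_continuous_coord (rshift m ord0) (abs_continuousS as_ tb y_ac).
    by under eq_fun do rewrite -clockE.
  by move=> p q _ pq _; rewrite !addr0 -mulrBr ger0_norm// mulr_ge0// subr_ge0.
apply: (ae_monotone y_ae) => r hr /andP[sr rt].
have [|dy Dy] := hr; first by rewrite (le_lt_trans as_ sr) (lt_le_trans rt tb).
have [d1 D1] := coord_derivable (rshift m ord0) dy.
have [d2 D2] := affine_derive eps^-1 0 r.
have -> : (fun t => clock (y t) - (eps^-1 * t + 0)) =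
  (fun t => y t ord0 (rshift m ord0) - (eps^-1 * t + 0)).
  by apply/funext => q /=; rewrite clockE.
have [d3 ->] := real_derivableB d1 d2.
by split => //; rewrite D1 D2 Dy row_mxEr mxE subrr normr0.
Qed.

Let x_lip s t : a <= s -> s <= t -> t <= b -> `|x t - x s| <= B * (t - s).
Proof.
move=> as_ st tb; apply/rv_norm_leP; first by rewrite mulr_ge0// subr_ge0.
move=> i; rewrite !mxE.
apply: (abs_continuous_mean_value (f := fun t => y t ord0 (lshift 1 i))) => //.
  exact: abs_continuous_coord (abs_continuousS as_ tb y_ac).
apply: (ae_monotone y_ae) => r hr /andP[sr rt].
have rab : a < r < b by rewrite (le_lt_trans as_ sr) (lt_le_trans rt tb).
have rab' : a <= r <= b by case/andP: rab => /ltW -> /ltW ->.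
have [dy Dy] := hr rab.
have [d1 D1] := coord_derivable (lshift 1 i) dy.
split => //; rewrite D1 Dy row_mxEl.
apply: le_trans (coord_le_norm _ _) _; exact: f_bnd (y_rho rab') (y_clock rab').
Qed.

(** With the state frozen at [v], the closed-loop field has an explicit primitive [P] along the
    clock, whose increment over a period is exactly the average. Unfreezing the state costs one
    [eta], replacing the average by [F] another. *)
Let x_period s : a <= s -> s + eps * T <= b ->
  `|x (s + eps * T) - x s - (eps * T) *: F (x s)| <= (eps * T) * (2 * eta).
Proof.
move=> as_ sb; set h := eps * T in sb *.
have h0 : 0 < h by rewrite mulr_gt0.
have ssh : s <= s + h by rewrite lerDl ltW.
have sab : a <= s <= b by rewrite as_ (le_trans ssh sb).
set v := x s.
have vr : `|v| <= rho by exact: y_rho.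
suff avg1 : `|x (s + h) - v - h *: average T f v| <= h * eta.
  have -> : x (s + h) - v - h *: F v =
    (x (s + h) - v - h *: average T f v) + h *: (average T f v - F v).
    by rewrite scalerBr addrA subrK.
  apply: le_trans (ler_normD _ _) _; rewrite normrZ gtr0_norm//.
  have := avg (y_C sab) vr.
  rewrite -/v -(ler_pM2l h0); lra.
apply/rv_norm_leP; first by rewrite mulr_ge0// ltW.
move=> i.
have fvc : continuous (fun s => f v s ord0 i).
  move=> r; apply: (@cvg_comp _ _ _ (f v) (fun M : 'rV[R]_m => M ord0 i)).
    exact: f_cont.
  exact: coord_continuous.
have fvp r : f v (r + T) ord0 i = f v r ord0 i by rewrite f_per.
have [Phi [dPhi PhiT]] := periodic_primitive T0 fvc fvp.
pose k := eps^-1; pose c := clock (y s) - eps^-1 * s.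
have k0 : 0 < k by rewrite invr_gt0.
have cs : 0 <= k * s + c by rewrite /c addrC subrK; exact: y_clock.
have cr r : s <= r -> 0 <= k * r + c.
  move=> sr; apply: le_trans cs _; by rewrite lerD2r ler_pM2l.
(* The factor [eps] cancels the clock rate that the chain rule produces. *)
pose P r := eps * Phi (k * r + c).
have dP r : s <= r -> derivable P r 1 /\ 'D_1 P r = f v (k * r + c) ord0 i.
  move=> sr; have [d1 D1] := dPhi _ (cr _ sr).
  have [d2 D2] := comp_affine_derive d1.
  rewrite -[P]/(eps \*: (fun r => Phi (k * r + c))).
  split; first exact: derivableZ.
  rewrite deriveZ// D2 D1 /GRing.scale/= mulrCA.
  by rewrite /k mulfV ?mulr1// gt_eqF.
have Psh : P (s + h) - P s = h * average T f v ord0 i.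
  rewrite /P -mulrBr.
  have -> : k * (s + h) + c = (k * s + c) + T.
    by rewrite /h /k mulrDr mulrA mulVf ?gt_eqF// mul1r addrAC.
  rewrite PhiT// mxE /h -mulrA; congr (_ * _).
  by rewrite mulrA mulfV ?gt_eqF// mul1r.
have := @abs_continuous_mean_value R s (s + h) eta (fun r => x r ord0 i - P r) ssh.
move=> /(_ (ltW eta0)) key.
have : `|(x (s + h) ord0 i - P (s + h)) - (x s ord0 i - P s)| <= eta * (s + h - s).
  apply: key.
    apply: (real_abs_continuousB B0).
      have := abs_continuous_coord (lshift 1 i) (abs_continuousS as_ sb y_ac).
      by under eq_fun do rewrite -xE.
    move=> p q sp pq qsh; apply: derivable_mean_value => // r /andP[pr rq].
    have sr := le_trans sp pr; have [d1 ->] := dP r sr.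
    by split => //; apply: le_trans (coord_le_norm _ _) _; exact: f_bnd (cr _ sr).
  apply: (ae_monotone y_ae) => r hr /andP[sr rsh].
  have rb := lt_le_trans rsh sb; have ar := le_lt_trans as_ sr.
  have [|dy Dy] := hr; first by rewrite ar.
  have [d1 D1] := coord_derivable (lshift 1 i) dy.
  have [d2 D2] := dP r (ltW sr).
  have -> : (fun r => x r ord0 i - P r) = (fun r => y r ord0 (lshift 1 i) - P r).
    by apply/funext => q /=; rewrite xE.
  have [d3 ->] := real_derivableB d1 d2.
  split => //; rewrite D1 D2 Dy row_mxEl.
  rewrite (clock_affine as_ (ltW sr) (ltW rb)) -/k -/c.
  have := coord_le_norm (f (x r) (k * r + c) - f v (k * r + c)) i.
  rewrite !mxE => /le_trans; apply; apply: f_unif => //.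
  - by apply: y_rho; rewrite !ltW.
  - exact: cr (ltW sr).
  - apply: le_trans (x_lip as_ (ltW sr) (ltW rb)) _.
    apply: le_trans small1; rewrite ler_wpM2l//; rewrite -/h; lra.
move=> bound.
have -> : (x (s + h) - v - h *: average T f v) ord0 i =
  x (s + h) ord0 i - x s ord0 i - h * average T f v ord0 i by rewrite !mxE.
rewrite -Psh; apply: le_trans (le_trans _ bound) _; last by rewrite addrC addKr mulrC.
suff -> : x (s + h) ord0 i - x s ord0 i - (P (s + h) - P s) =
  (x (s + h) ord0 i - P (s + h)) - (x s ord0 i - P s) by [].
by move: (x _ _ _) (x _ _ _) (P _) (P _) => p q u w; ring.
Qed.

(** The interval is cut into whole periods, on which [x_period] is summed, and a remainder shorter
    than a period, on which the crude speed bound [B] is affordable. *)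
Lemma averaged_approx_flow : approx_flow F rho (M0 + 2 * eta) (2 * eta) a b x.
Proof.
set h := eps * T; have h0 : 0 < h by rewrite mulr_gt0.
set M := M0 + 2 * eta.
have M0' : 0 <= M by rewrite addr_ge0// mulr_ge0// ltW.
have M0M : M0 <= M by rewrite lerDl mulr_ge0// ltW.
move=> s t as_ st tb.
have xr r : s <= r -> r <= t -> `|x r| <= rho.
  by move=> sr rt; apply: y_rho; rewrite (le_trans as_ sr) (le_trans rt tb).
have Ch N : s + N%:R * h <= t -> `|x (s + N%:R * h) - x s| <= M * (N%:R * h).
  elim: N => [_|N IH]; first by rewrite !mul0r addr0 subrr normr0 mulr0.
  have -> : s + N.+1%:R * h = s + N%:R * h + h by rewrite -natr1; ring.
  move=> Nt; have Nt' : s + N%:R * h <= t by lra.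
  have Nh0 : 0 <= N%:R * h by rewrite mulr_ge0// ltW.
  have := IH Nt'; set r := s + N%:R * h in Nt Nt' *.
  have sr : s <= r by rewrite lerDl.
  move=> {}IH; have := x_period (le_trans as_ sr) (le_trans Nt tb); rewrite -/h => p.
  have FM := F_bnd (xr _ sr Nt').
  have -> : x (r + h) - x s =
    (x (r + h) - x r - h *: F (x r)) + h *: F (x r) + (x r - x s).
    by rewrite subrK addrA subrK.
  apply: le_trans (ler_normD _ _) _.
  have := ler_normD (x (r + h) - x r - h *: F (x r)) (h *: F (x r)).
  rewrite normrZ (gtr0_norm h0).
  have : h * `|F (x r)| <= h * M0 by rewrite ler_pM2l.
  rewrite /M -natr1 in IH *; lra.
(* The number of whole periods that fit between [s] and [t]. *)
have [N [r0 rh tE]] : exists N, [/\ s + N%:R * h <= t, t - (s + N%:R * h) < h &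
    0 <= N%:R * h].
  exists (Num.truncn ((t - s) / h)).
  have q0 : 0 <= (t - s) / h by rewrite divr_ge0 ?subr_ge0// ltW.
  have /andP[q1 q2] := truncn_itv q0.
  move: q1 q2; rewrite ler_pdivlMr// ltr_pdivrMr// -natr1 => q1 q2.
  by split; [lra|lra|rewrite mulr_ge0// ltW].
set r := s + N%:R * h in r0 rh.
have sr : s <= r by rewrite lerDl.
have xtr : `|x t - x r| <= B * (t - r) by apply: x_lip => //; exact: le_trans sr.
have Bh : B * (t - r) <= B * h by rewrite ler_wpM2l// ltW.
have M0h : M0 * (t - r) <= M0 * h by rewrite ler_wpM2l// ltW.
have sm : B * h + M0 * h <= eta by rewrite -mulrDl.
have Bh0 : 0 <= B * h by rewrite mulr_ge0// ltW.
have M0h0 : 0 <= M0 * h by rewrite mulr_ge0// ltW.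
have rE : r - s = N%:R * h by rewrite /r addrC addKr.
split.
  have -> : x t - x s = (x t - x r) + (x r - x s) by rewrite addrA subrK.
  apply: le_trans (ler_normD _ _) _.
  have := Ch N r0; rewrite -/r -rE.
  have : M * (r - s) <= M * (t - s) by rewrite ler_wpM2l// lerD2r.
  lra.
move=> w Fw.
have w0 : 0 <= w.
  have := Fw (x s) (x s) (xr _ (lexx _) st) (xr _ (lexx _) st).
  rewrite !subrr normr0; apply; rewrite addr_ge0 ?mulr_ge0 ?subr_ge0//; exact: ltW.
(* In each period the base point of [F] is moved back from [x q] to [x s], at the price [w]. *)
have Dh K : s + K%:R * h <= t -> `|x (s + K%:R * h) - x s - (K%:R * h) *: F (x s)| <=
    (K%:R * h) * (w + 2 * eta).
  elim: K => [_|K IH]; first by rewrite !mul0r addr0 subrr scale0r subr0 normr0.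
  have -> : s + K.+1%:R * h = s + K%:R * h + h by rewrite -natr1; ring.
  have -> : K.+1%:R * h = K%:R * h + h by rewrite -natr1; ring.
  move=> Kt; have Kt' : s + K%:R * h <= t by lra.
  have Kh0 : 0 <= K%:R * h by rewrite mulr_ge0// ltW.
  have := Ch K Kt'.
  have := IH Kt'; set q := s + K%:R * h in Kt Kt' *.
  have sq : s <= q by rewrite lerDl.
  move=> {}IH qs; have := x_period (le_trans as_ sq) (le_trans Kt tb); rewrite -/h => p.
  have FF : `|F (x q) - F (x s)| <= w.
    apply: Fw; [exact: xr|exact: xr|].
    apply: le_trans qs _.
    have : M * (K%:R * h) <= M * (t - s) by rewrite ler_wpM2l//; rewrite /q in Kt'; lra.
    lra.
  have -> : x (q + h) - x s - (K%:R * h + h) *: F (x s) =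
    (x (q + h) - x q - h *: F (x q)) + h *: (F (x q) - F (x s)) +
    (x q - x s - (K%:R * h) *: F (x s)).
    by apply/rowP => i; rewrite !mxE; ring.
  apply: le_trans (ler_normD _ _) _.
  have := ler_normD (x (q + h) - x q - h *: F (x q)) (h *: (F (x q) - F (x s))).
  rewrite normrZ (gtr0_norm h0).
  have : h * `|F (x q) - F (x s)| <= h * w by rewrite ler_pM2l.
  lra.
have -> : x t - x s - (t - s) *: F (x s) =
  (x t - x r) + (x r - x s - (N%:R * h) *: F (x s)) - (t - r) *: F (x s).
  by rewrite -rE; apply/rowP => i; rewrite !mxE; ring.
apply: le_trans (ler_normB _ _) _; rewrite normrZ ger0_norm ?subr_ge0//.
have := ler_normD (x t - x r) (x r - x s - (N%:R * h) *: F (x s)).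
have := Dh N r0; rewrite -/r.
have Fs := F_bnd (xr _ (lexx _) st).
have : (t - r) * `|F (x s)| <= (t - r) * M0 by rewrite ler_wpM2l// subr_ge0.
have : (N%:R * h) * (w + 2 * eta) <= (t - s) * (w + 2 * eta).
  by rewrite ler_wpM2r ?addr_ge0 ?mulr_ge0 ?(ltW eta0)// -rE lerD2r.
lra.
Qed.

End Averaging.

Lemma approx_flow_le (R : realType) (m : nat) (F : 'rV[R]_m -> 'rV[R]_m)
    (rho M M' eta eta' a b : R) (x : R -> 'rV[R]_m) :
  M <= M' -> eta <= eta' ->
  approx_flow F rho M eta a b x -> approx_flow F rho M' eta' a b x.
Proof.
move=> MM ee hx s t as_ st tb; have [h1 h2] := hx s t as_ st tb.
have ts : 0 <= t - s by rewrite subr_ge0.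
have le : M * (t - s) + eta <= M' * (t - s) + eta' by rewrite lerD// ler_wpM2r.
split; first exact: le_trans le.
move=> w Fw; apply: le_trans (h2 w _) _.
  by move=> u v ur vr uv; apply: Fw => //; exact: le_trans le.
by rewrite lerD// ler_wpM2l// lerD2l.
Qed.

Lemma nonexpansive_continuous (R : realType) (V W : normedModType R)
    (f : V -> W) :
  (forall x y, `|f x - f y| <= `|x - y|) -> continuous f.
Proof.
move=> fl x; apply/cvgrPdist_lt => e e0; near=> y.
apply: le_lt_trans (fl _ _) _; near: y.
by apply: cvgr_dist_lt => //; exact: cvg_id.
Unshelve. all: by end_near. Qed.

Lemma lsubmx_continuous (R : realType) (p q : nat) :
  continuous (lsubmx : 'rV[R]_(p + q) -> 'rV[R]_p).
Proof.
apply: nonexpansive_continuous => x y.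
by apply: le_trans (norm_lsub (x - y)); rewrite linearB.
Qed.

Lemma clock_continuous (R : realType) (q : nat) :
  continuous (@clock R q).
Proof.
apply: nonexpansive_continuous => x y.
apply: le_trans (norm_rsub (x - y)); rewrite linearB.
by apply: le_trans (coord_le_norm _ ord0); rewrite /clock !mxE.
Qed.

Lemma row_continuous (R : realType) (V : topologicalType) (p : nat)
    (f : V -> 'I_p -> R) :
  (forall i, continuous (f^~ i)) -> continuous (fun x => \row_i f x i : 'rV[R]_p).
Proof.
move=> fc x; apply/cvgrPdist_lt => e e0.
have e2 : 0 < e / 2 by rewrite divr_gt0.
have : \forall y \near x, forall i, `|f x i - f y i| <= e / 2.
  by apply: filter_forall => i; apply: cvgr_dist_le => //; exact: fc.
apply: filterS => y hy; apply: (@le_lt_trans _ _ (e / 2)); last lra.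
by apply/rv_norm_leP; [exact: ltW|move=> i; rewrite !mxE].
Qed.

Lemma row_mxB (R : realType) (p q : nat) (a b : 'rV[R]_p) (c d : 'rV[R]_q) :
  row_mx a c - row_mx b d = row_mx (a - b) (c - d).
Proof. by rewrite opp_row_mx add_row_mx. Qed.

Lemma norm_row_mx_le (R : realType) (p q : nat) (a : 'rV[R]_p) (c : 'rV[R]_q) (e : R) :
  `|a| <= e -> `|c| <= e -> `|row_mx a c| <= e.
Proof.
move=> ae ce; have e0 : 0 <= e by exact: le_trans ae.
apply/rv_norm_leP => // i.
case: (split_ordP i) => j ->; rewrite ?row_mxEl ?row_mxEr.
  exact: le_trans (coord_le_norm _ _) ae.
exact: le_trans (coord_le_norm _ _) ce.
Qed.

Lemma norm_const_mx1 (R : realType) (c : R) : `|const_mx c : 'rV[R]_1| = `|c|.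
Proof.
apply/le_anti/andP; split; first by apply/rv_norm_leP => // i; rewrite mxE.
by have := coord_le_norm (const_mx c : 'rV[R]_1) ord0; rewrite mxE.
Qed.

(** A sup-norm ball is closed and convex, hence contains the hull of any set inside it. This turns
    the set-valued inclusion for the average map into a pointwise estimate. *)
Lemma closed_ball_convex_hull (R : realType) (m : nat) (G : set 'rV[R]_m)
    (c z : 'rV[R]_m) (e : R) :
  (forall g, G g -> `|g - c| <= e) -> closed_convex_hull G z -> `|z - c| <= e.
Proof.
move=> Ge /(_ [set z | `|z - c| <= e]); apply; split; last exact: Ge.
split.
  rewrite (_ : mkset _ = (fun x : 'rV[R]_m => `|x - c|) @^-1` [set y | y <= e]) //.
  apply: closed_comp; last exact: closed_le.
  move=> x _; apply: (@nonexpansive_continuous R _ R^o) => u v.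
  apply: le_trans (ler_dist_dist _ _) _.
  by rewrite opprB addrA subrK.
apply/convex_setW => u v; rewrite !inE /= => ue ve k k0 k1.
set l := k%:num in k0 k1 *; have l1 : 0 < 1 - l by rewrite subr_gt0.
rewrite inE/= [X in `|X|](_ : _ = l *: (u - c) + (1 - l) *: (v - c)).
  apply: le_trans (ler_normD _ _) _; rewrite !normrZ !gtr0_norm//.
  have := ler_wpM2l (ltW k0) ue.
  have := ler_wpM2l (ltW l1) ve.
  lra.
by apply/rowP => i; rewrite !mxE /unstable.onem -/l; ring.
Qed.

Lemma prod_nonneg_closed (R : realType) (q : nat) (A : set 'rV[R]_q) :
  closed A -> closed (prod_nonneg A).
Proof.
move=> Ac; rewrite (_ : prod_nonneg A =
  (lsubmx @^-1` A) `&` (@clock R q @^-1` [set t | 0 <= t])) //.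
apply: closedI.
  by apply: closed_comp => // x _; exact: lsubmx_continuous.
by apply: closed_comp => [x _|]; [exact: clock_continuous|exact: closed_ge].
Qed.

Lemma segment_interior (R : realType) (a b t : R) (A : set R) :
  a < t < b -> `[a, b] `<=` A -> A° t.
Proof.
move=> tab abA; apply: (@filterS _ (nbhs t) _ `]a, b[%classic).
  by move=> s /=; rewrite in_itv/= => /andP[as_ sb]; apply: abA; rewrite /= in_itv/= !ltW.
by apply: open_nbhs_nbhs; split; [exact: itv_open|rewrite /= in_itv].
Qed.

Lemma segment_interior_neq0 (R : realType) (a b : R) (A : set R) :
  a < b -> `[a, b] `<=` A -> A° !=set0.
Proof.
move=> ab abA; exists ((a + b) / 2); apply: segment_interior abA.
by apply/andP; split; lra.
Qed.

Lemma abs_continuous_unif (R : realType) (p : nat) (a b e : R)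
    (f : R -> 'rV[R]_p) : abs_continuous a b f -> 0 < e ->
  exists2 d, 0 < d & forall s t, a <= s <= b -> a <= t <= b -> `|s - t| < d ->
    `|f s - f t| < e.
Proof.
move=> fac e0; have [d d0 hd] := fac e e0; exists d => // s t.
wlog st : s t / s <= t.
  move=> h; have [st|/ltW ts] := leP s t; first exact: h.
  by move=> sab tab; rewrite distrC (distrC (f s)); exact: h.
move=> /andP[as_ sb] /andP[at_ tb] std.
have := hd 1%N (fun=> s) (fun=> t).
rewrite !big_ord1 => /(_ _ _ _)/= h; rewrite distrC.
apply: le_lt_trans (norm_le_eucl _) _; apply: h => //.
  by move=> k l; rewrite (ord1 k) (ord1 l) eqxx.
by rewrite -[t - s]ger0_norm ?subr_ge0// distrC.
Qed.

(** Solutions satisfy the flow constraint only almost everywhere. A violation at one point persists,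
    by continuity, on an interval of positive length, which is not a null set. *)
Lemma ae_closed_abs_continuous (R : realType) (p : nat) (a b : R)
    (S : set 'rV[R]_p) (f : R -> 'rV[R]_p) :
  a < b -> closed S -> abs_continuous a b f ->
  {ae lebesgue_measure, forall t : R, a < t < b -> S (f t)} ->
  forall t, a <= t <= b -> S (f t).
Proof.
move=> ab Sc fac Sae t tab; apply: contrapT => nS.
have /nbhs_ballP[e /= e0 he] : nbhs (f t) (~` S).
  by apply: open_nbhs_nbhs; split => //; exact: closed_openC.
have [d d0 hd] := abs_continuous_unif fac e0.
case/andP: (tab) => at_ tb.
(* The truncation keeps the interval inside [[a, b]], also when [t] is an endpoint. *)
pose u := Num.max a (t - d / 2); pose v := Num.min b (t + d / 2).
have uv : u < v.
  rewrite lt_min !gt_max ab/=; apply/andP; split; [|apply/andP; split]; lra.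
have [B [mB muB hB]] := Sae.
have uvB : `]u, v]%classic `\` [set b] `<=` B.
  move=> r /= []; rewrite in_itv/= gt_max le_min => /andP[/andP[ar tr] /andP[rb rt]] nrb.
  apply: hB => /= hr.
  have rltb : r < b by rewrite lt_neqAle rb andbT; apply/eqP.
  have := hr; rewrite ar rltb => /(_ isT).
  apply: (he (f r)); rewrite -ball_normE /=; apply: hd => //.
    by rewrite (ltW ar) rb.
  by rewrite ltr_norml; apply/andP; split; lra.
have : lebesgue_measure.-negligible (`]u, v]%classic : set R).
  apply: (@negligibleS _ _ _ _ (B `|` [set b])).
    by move=> r hr; have [->|nb] := pselect (r = b); [right|left; apply: uvB; split].
  apply: negligibleU; first by exists B; split.
  by apply/negligibleP; [exact: measurable_set1|exact: lebesgue_measure_set1].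
move=> /measure_negligible -/(_ (measurable_itv _)) mu0.
have := eq_trans (esym (lebesgue_measure_itv_oc (ltW uv))) mu0.
by case=> /eqP; rewrite subr_eq0 gt_eqF.
Qed.

(** * Regularity of the nominal and of the closed-loop field *)

Lemma nominal_flow_continuous (R : realType) (n r : nat) (J : 'rV[R]_n -> R)
    (Fhat : 'rV[R]_(n + r) * 'rV[R]_n -> 'rV[R]_(n + r)) :
  C1 J -> continuous Fhat -> continuous (nominal_flow J Fhat).
Proof.
move=> [_ gc] Fc x; apply: (@continuous_comp _ _ _ (fun x => (x, grad J (lsubmx x))) Fhat).
  have h1 : x' @[x' --> x] --> x by exact: cvg_id.
  have h2 : grad J (lsubmx x') @[x' --> x] --> grad J (lsubmx x).
    apply: (@continuous_comp _ _ _ lsubmx (grad J)); first exact: lsubmx_continuous.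
    exact: gc.
  exact: cvg_pair h1 h2.
exact: Fc.
Qed.

Lemma dither_continuous (R : realType) (n : nat) (kappa : 'I_n -> rat) (eps_a : R) :
  continuous (dither kappa eps_a).
Proof.
apply: row_continuous => i x; apply: cvgMr.
apply: (@continuous_comp _ _ _ (fun t => 2 * pi * ratr (kappa i) * t) sin).
  by apply: cvgMr; exact: cvg_id.
exact: continuous_sin.
Qed.

Section EsFlow.
Variables (R : realType) (n r : nat) (kappa : 'I_n -> rat) (J : 'rV[R]_n -> R).
Variables (Fhat : 'rV[R]_(n + r) * 'rV[R]_n -> 'rV[R]_(n + r)) (T eps_a : R).
Hypothesis J_C1 : C1 J.
Hypothesis Fhat_cont : continuous Fhat.
Hypothesis T0 : 0 < T.
Hypothesis T_period : periodic (dither kappa eps_a) T.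

Let f := es_flow kappa J Fhat eps_a.

Lemma es_flow_joint_continuous :
  continuous (fun w : 'rV[R]_(n + r + 1) => f (lsubmx w) (clock w)).
Proof.
have dc : continuous (fun w : 'rV[R]_(n + r + 1) => dither kappa eps_a (clock w)).
  move=> w; apply: (@continuous_comp _ _ _ (@clock R _) (dither kappa eps_a)).
    exact: clock_continuous.
  exact: dither_continuous.
move=> w.
have Jc : continuous J by move=> u; apply: differentiable_continuous; case: J_C1.
have h1 : lsubmx (lsubmx w') @[w' --> w] --> lsubmx (lsubmx w).
  by apply: (@continuous_comp _ _ _ lsubmx lsubmx); exact: lsubmx_continuous.
have h2 : probe kappa eps_a (lsubmx (lsubmx w')) (clock w') @[w' --> w] -->
    probe kappa eps_a (lsubmx (lsubmx w)) (clock w).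
  exact: (cvgD h1 (cvgZ (cvg_cst _) (dc w))).
have h3 : J (probe kappa eps_a (lsubmx (lsubmx w')) (clock w')) @[w' --> w] -->
    J (probe kappa eps_a (lsubmx (lsubmx w)) (clock w)).
  exact: (continuous_cvg _ (Jc _) h2).
have h4 := cvgZ h3 (dc w).
have h0 : lsubmx w' @[w' --> w] --> lsubmx w by exact: lsubmx_continuous.
exact: (cvg_comp _ _ (cvg_pair h0 (h4 _)) (@Fhat_cont (lsubmx w, _))).
Qed.

Lemma es_flow_row x s :
  f x s = f (lsubmx (row_mx x (const_mx s : 'rV_1))) (clock (row_mx x (const_mx s))).
Proof. by rewrite /clock row_mxKl row_mxKr mxE. Qed.

Lemma es_flow_periodic x s : f x (s + T) = f x s.
Proof. by rewrite /f /es_flow /probe T_period. Qed.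

Lemma es_flow_continuous x : continuous (f x).
Proof.
have -> : f x = (fun w : 'rV[R]_(n + r + 1) => f (lsubmx w) (clock w)) \o
  (fun s => row_mx x (const_mx s : 'rV_1)).
  by apply/funext => s /=; rewrite -es_flow_row.
move=> s; apply: continuous_comp; last exact: es_flow_joint_continuous.
apply: (@nonexpansive_continuous R R^o) => p q.
rewrite row_mxB subrr; apply: norm_row_mx_le; first by rewrite normr0.
have -> : const_mx p - const_mx q = const_mx (p - q) :> 'rV[R]_1.
  by apply/rowP => i; rewrite !mxE.
by rewrite norm_const_mx1.
Qed.

(** The clock is unbounded; periodicity brings it back to [[0, T]], so that compactness yields
    estimates uniform over all clock values. *)
Lemma es_flow_reduce s : 0 <= s ->
  exists s', 0 <= s' <= T /\ forall x, f x s = f x s'.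
Proof.
move=> s0; pose N := Num.truncn (s / T); exists (s - N%:R * T).
have q0 : 0 <= s / T by rewrite divr_ge0// ltW.
have /andP[q1 q2] := truncn_itv q0.
move: q1 q2; rewrite ler_pdivlMr// ltr_pdivrMr// -natr1 -/N => q1 q2.
split; first by apply/andP; split; lra.
move=> x; have h k u : f x (u + k%:R * T) = f x u.
  elim: k u => [u|k IH u]; first by rewrite mul0r addr0.
  by rewrite -natr1 mulrDl mul1r addrA es_flow_periodic.
by rewrite -[RHS](h N) subrK.
Qed.

Lemma es_flow_bounded rho : exists2 B, 0 <= B &
  forall x s, `|x| <= rho -> 0 <= s -> `|f x s| <= B.
Proof.
have [B B0 hB] := compact_continuous_bounded es_flow_joint_continuous
  (@norm_ball_compact R (n + r + 1) (Num.max rho T)).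
exists B => // x s xr s0; have [s' [/andP[s0' sT] ->]] := es_flow_reduce s0.
rewrite es_flow_row; apply: hB => /=; apply: norm_row_mx_le.
  by rewrite le_max xr.
by rewrite norm_const_mx1 ger0_norm// le_max sT orbT.
Qed.

Lemma es_flow_unif_continuous rho e : 0 < e -> exists2 h, 0 < h &
  forall u v s, `|u| <= rho -> `|v| <= rho -> 0 <= s -> `|u - v| <= h ->
    `|f u s - f v s| <= e.
Proof.
move=> e0.
have [h h0 hh] := compact_unif_continuous es_flow_joint_continuous
  (@norm_ball_compact R (n + r + 1) (Num.max rho T)) e0.
exists h => // u v s ur vr s0 uv.
have [s' [/andP[s0' sT] fE]] := es_flow_reduce s0; rewrite !fE.
rewrite (es_flow_row u) (es_flow_row v); apply: hh => /=.
  apply: norm_row_mx_le; first by rewrite le_max ur.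
  by rewrite norm_const_mx1 ger0_norm// le_max sT orbT.
rewrite row_mxB subrr; apply: norm_row_mx_le => //.
by rewrite normr0 ltW.
Qed.

End EsFlow.

(** The speed bound [M] comes from the nominal field and depends on [rho] alone, whereas the bound
    [B] on the closed-loop field depends on [eps_a]; therefore [B] may enter only the threshold for
    [eps_w]. The estimate on [[a, t]] assumes the bound by [rho] just up to [t], the form that a
    continuation argument can use. *)
Lemma es_solution_approx_flow (R : realType) (n r : nat) (kappa : 'I_n -> rat)
    (J : 'rV[R]_n -> R) (C D : set 'rV[R]_(n + r))
    (Fhat : 'rV[R]_(n + r) * 'rV[R]_n -> 'rV[R]_(n + r))
    (Ghat : 'rV[R]_(n + r) -> 'rV[R]_(n + r)) (T : R) :
  C1 J -> continuous Fhat -> closed C -> 0 < T ->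
  (forall eps_a : R, periodic (dither kappa eps_a) T) ->
  (forall K : set 'rV[R]_(n + r), compact K ->
      exists2 eps_a_star : R, 0 < eps_a_star &
      exists sigma : 'rV[R]_(n + r) -> R,
        [/\ continuous sigma,
            (forall x, 0 <= sigma x) &
            forall eps_a : R, 0 < eps_a < eps_a_star ->
            forall x, (K `&` C) x ->
              inflate
                (closed_convex_hull
                  [set nominal_flow J Fhat y
                    | y in inflate [set x] (eps_a * sigma x) `&` C])
                (eps_a * sigma x)
                (average T (es_flow kappa J Fhat eps_a) x)]) ->
  forall rho, exists2 M, 0 <= M & forall eta, 0 < eta ->
  exists2 eps_a_star, 0 < eps_a_star & forall eps_a, 0 < eps_a < eps_a_star ->
  exists2 eps_w_star, 0 < eps_w_star & forall eps_w, 0 < eps_w < eps_w_star ->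
  forall y, solution (es_system kappa J C D Fhat Ghat eps_a eps_w) y ->
  forall k a b, a < b -> `[a, b] `<=` slice y k ->
    forall t, a <= t <= b -> prod_nonneg C (y t k) /\
      ((forall s, a <= s <= t -> `|lsubmx (y s k)| <= rho) ->
       approx_flow (nominal_flow J Fhat) rho M eta a t (fun s => lsubmx (y s k))).
Proof.
move=> J_C1 Fc Cc T0 T_period hyp_c rho.
set F := nominal_flow J Fhat; have F_cont : continuous F by exact: nominal_flow_continuous.
pose K := [set x : 'rV[R]_(n + r) | `|x| <= rho].
have cK : compact K by exact: norm_ball_compact.
have [M0 M00 F_bnd] := compact_continuous_bounded F_cont cK.
exists (M0 + 1); first by rewrite addr_ge0.
(* Averaging yields the speed bound [M0 + 2 * eta] and the error [2 * eta]; the cap at 1 keeps the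
   speed below the already fixed [M0 + 1]. *)
move=> eta' eta'0; pose eta := Num.min eta' 1 / 2.
have eta0 : 0 < eta by rewrite divr_gt0// lt_min eta'0 ltr01.
have [etaE1 etaE2] : 2 * eta <= eta' /\ 2 * eta <= 1.
  by rewrite /eta mulrC divfK// !ge_min !lexx orbT.
have [ea0 ea0_gt0 [sigma [sc s0 hs]]] := hyp_c K cK.
have [sM sM0 sbnd] := @compact_continuous_bounded R _ R^o sigma K sc cK.
have eta2 : 0 < eta / 2 by rewrite divr_gt0.
have [hF hF0 Funif] := compact_unif_continuous F_cont cK eta2.
(* Makes [eps_a * sigma v] at most [hF], so that the hull lies within [eta / 2] of [F v], and at
   most [eta / 2], which pays for the outer inflation. *)
pose d := Num.min hF (eta / 2) / (sM + 1).
have sM1 : 0 < sM + 1 by rewrite ltr_wpDl.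
have d0 : 0 < d by rewrite divr_gt0// lt_min hF0.
exists (Num.min ea0 d); first by rewrite lt_min ea0_gt0.
move=> eps_a /andP[ea_gt0]; rewrite lt_min => /andP[ea_lt ea_d].
have avg v : C v -> `|v| <= rho -> `|average T (es_flow kappa J Fhat eps_a) v - F v| <= eta.
  move=> Cv vr.
  have esv : eps_a * sigma v <= Num.min hF (eta / 2).
    have := sbnd v vr; rewrite ger0_norm// => sv.
    apply: (@le_trans _ _ (d * (sM + 1))); last by rewrite divfK// gt_eqF.
    apply: ler_pM => //; [exact: ltW|exact: ltW|lra].
  have es0 : 0 <= eps_a * sigma v by rewrite mulr_ge0// ltW.
  move: esv; rewrite le_min => /andP[esF es2].
  have [|z hz [b /= hb <-]] := hs eps_a _ v (conj vr Cv); first by rewrite ea_gt0.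
  have b1 : `|b| <= 1 by exact: le_trans (norm_le_eucl _) hb.
  have zF : `|z - F v| <= eta / 2.
    apply: closed_ball_convex_hull hz => _ [y [[_ -> [b' /= hb' <-]] _] <-].
    rewrite distrC; apply: Funif => //.
    rewrite opprD addrA subrr sub0r normrN normrZ ger0_norm//.
    apply: le_trans esF; apply: ler_piMr => //.
    exact: le_trans (norm_le_eucl _) hb'.
  rewrite addrAC; apply: le_trans (ler_normD _ _) _.
  rewrite normrZ ger0_norm//.
  have : eps_a * sigma v * `|b| <= eps_a * sigma v by rewrite ler_piMr.
  lra.
have [B B0 f_bnd] := es_flow_bounded J_C1 Fc T0 (T_period eps_a) rho.
have [h1 h10 f_unif] := es_flow_unif_continuous J_C1 Fc T0 (T_period eps_a) rho eta0.
(* Chosen so that both smallness conditions on the motion during one period hold at once. *)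
pose ew := Num.min h1 eta / ((B + M0 + 1) * T).
have BM1 : 0 < B + M0 + 1 by rewrite ltr_wpDl// addr_ge0.
have ew0 : 0 < ew by rewrite divr_gt0 ?mulr_gt0// lt_min h10.
exists ew => // eps_w /andP[ew_gt0 ew_lt] y ysol k a b ab abs.
have small : (B + M0 + 1) * (eps_w * T) <= Num.min h1 eta.
  rewrite mulrCA mulrA -ler_pdivlMr; last exact: T0.
  rewrite -ler_pdivlMr//.
  by apply: le_trans (ltW ew_lt) _; rewrite /ew invfM mulrA mulrAC.
have ewT : 0 < eps_w * T by rewrite mulr_gt0.
have sm3 : (B + M0) * (eps_w * T) + (eps_w * T) <= Num.min h1 eta.
  by apply: le_trans small; rewrite !mulrDl mul1r.
move: sm3; rewrite le_min => /andP[sm4 sm5].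
case: ysol => -[_ yac] _ yflow _.
have sl0 : (slice y k)° !=set0 by exact: segment_interior_neq0 abs.
have y_ac := yac k sl0 a b (ltW ab) abs.
have y_ae := yflow k sl0.
have inab s : a <= s <= b -> slice y k s by move=> h; apply: abs; rewrite /= in_itv.
have S : forall t, a <= t <= b -> prod_nonneg C (y t k).
  apply: (ae_closed_abs_continuous ab (prod_nonneg_closed Cc) y_ac).
  apply: (ae_monotone y_ae) => s hs' /andP[as_ sb].
  by have [|//] := hs'; apply: inab; rewrite !ltW.
move=> t tab; split; first exact: S.
move=> yr; case/andP: tab => at_ tb.
apply: (@approx_flow_le _ _ _ _ (M0 + 2 * eta) _ (2 * eta)); [lra|lra|].
apply: (@averaged_approx_flow R (n + r) C (es_flow kappa J Fhat eps_a) F T rho B M0 eta h1 eps_w) => //.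
- by move=> v; exact: es_flow_continuous.
- by move=> v s; exact: es_flow_periodic.
- have : 0 <= M0 * (eps_w * T) by rewrite mulr_ge0// ltW.
  by rewrite mulrDl in sm4; lra.
- by apply: le_trans sm5; rewrite lerDl ltW.
- exact: abs_continuousS (lexx _) tb y_ac.
- apply: (ae_monotone y_ae) => s hs' /andP[as_ st].
  have [|_ dy Dy] := hs'; first by apply: inab; rewrite (ltW as_) (le_trans (ltW st)).
  by split.
- move=> s /andP[as_ st]; have sab : a <= s <= b by rewrite as_ (le_trans st).
  by have [] := S s sab.
- move=> s /andP[as_ st]; have sab : a <= s <= b by rewrite as_ (le_trans st).
  by have [] := S s sab.
Qed.

(** * Hybrid time domains *)

Section HybridTime.
Variable R : realType.
Implicit Types (E K : set (R * nat)) (p q : R * nat).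

Definition hybrid_length p : R := p.1 + p.2%:R.

Lemma compact_domain_mono (N : nat) (t : nat -> R) :
  (forall j, (j < N)%N -> t j <= t j.+1) ->
  forall i j, (i <= j)%N -> (j <= N)%N -> t i <= t j.
Proof.
move=> tm i j; elim: j => [|j IH]; first by rewrite leqn0 => /eqP ->.
rewrite leq_eqVlt => /predU1P[->//|]; rewrite ltnS => ij jN.
by apply: le_trans (IH ij (ltnW jN)) _; exact: tm.
Qed.

Lemma compact_domain_time_le K p q :
  compact_hybrid_time_domain K -> K p -> K q -> (p.2 < q.2)%N -> p.1 <= q.1.
Proof.
move=> [N [t [t0 tm ->]]] /= [pN /andP[_ p2]] [qN /andP[q1 _]] pq.
apply: le_trans p2 _; apply: le_trans q1.
by apply: (compact_domain_mono tm) => //; exact: ltnW.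
Qed.

Lemma compact_domain_time_ge0 K p :
  compact_hybrid_time_domain K -> K p -> 0 <= p.1.
Proof.
move=> [N [t [t0 tm ->]]] /= [pN /andP[p1 _]]; apply: le_trans p1.
by rewrite -t0; apply: (compact_domain_mono tm) => //; exact: ltnW.
Qed.

(** Time never decreases across jumps, so the length [t + j] orders the points of a domain in the
    order in which they are visited. *)
Lemma hybrid_length_lt K p q :
  compact_hybrid_time_domain K -> K p -> K q ->
  hybrid_length p <= hybrid_length q ->
  (p.2 < q.2)%N \/ (p.2 = q.2 /\ p.1 <= q.1).
Proof.
move=> cK Kp Kq; rewrite /hybrid_length.
case: (ltngtP p.2 q.2) => [| pq | ->]; first by left.
  have := compact_domain_time_le cK Kq Kp pq.
  move: pq; rewrite -(ltr_nat R); lra.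
by rewrite lerD2r; right.
Qed.

(** Inclusion of compact domains forces one to be an initial piece of the other, up to its last
    interval, because their jump times agree. *)
Lemma compact_domain_initial K K' p q :
  compact_hybrid_time_domain K -> compact_hybrid_time_domain K' -> K `<=` K' ->
  K p -> K' q -> hybrid_length q <= hybrid_length p -> K q.
Proof.
move=> cK cK' KK' Kp K'q qp.
have qp' := hybrid_length_lt cK' K'q (KK' _ Kp) qp.
move: cK cK' K'q Kp KK' => [N [t [t0 tm ->]]] [N' [t' [t'0 tm' ->]]] /=.
move=> [qN' /andP[q1 q2]] [pN /andP[p1 p2]] KK'.
(* The points just before and just after a jump of [K] belong to [K'], which bounds the jump time of
   [K'] from both sides. *)
have tt' i : (i <= p.2)%N -> t i = t' i.
  case: i => [_|i ip]; first by rewrite t0 t'0.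
  have iN : (i.+1 < N)%N by exact: leq_ltn_trans ip pN.
  have [/= _ /andP[_ h1]] : [set q | (q.2 < N')%N /\ t' q.2 <= q.1 <= t' q.2.+1] (t i.+1, i).
    by apply: KK' => /=; split; [exact: ltnW|rewrite lexx tm// ltnW].
  have [/= _ /andP[h2 _]] : [set q | (q.2 < N')%N /\ t' q.2 <= q.1 <= t' q.2.+1] (t i.+1, i.+1).
    by apply: KK' => /=; split; [exact: iN|rewrite lexx tm].
  by apply/le_anti; rewrite h1 h2.
case: qp' => [qp'|[qpE q1p]].
  split; first exact: ltn_trans qp' pN.
  by rewrite !tt'// ?q1//; exact: ltnW.
rewrite qpE; split => //; apply/andP; split; last exact: le_trans p2.
by rewrite tt' -?qpE.
Qed.

Lemma nondecreasing_subset (T : Type) (K : nat -> set T) :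
  (forall k, K k `<=` K k.+1) -> forall i j, (i <= j)%N -> K i `<=` K j.
Proof.
move=> KS i j; elim: j => [|j IH]; first by rewrite leqn0 => /eqP ->.
rewrite leq_eqVlt => /predU1P[->//|]; rewrite ltnS => ij.
exact: subset_trans (IH ij) (KS j).
Qed.

Lemma hybrid_domain_compact2 E p q : hybrid_time_domain E -> E p -> E q ->
  exists K, [/\ compact_hybrid_time_domain K, K `<=` E, K p & K q].
Proof.
move=> [K [cK KS ->]] [k1 _ K1] [k2 _ K2].
exists (K (maxn k1 k2)); split => //.
- by move=> x Kx; exists (maxn k1 k2).
- exact: (nondecreasing_subset KS (leq_maxl _ _)).
- exact: (nondecreasing_subset KS (leq_maxr _ _)).
Qed.

Lemma compact_domain_trunc K p : compact_hybrid_time_domain K -> K p ->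
  compact_hybrid_time_domain (K `&` [set q | hybrid_length q <= hybrid_length p]).
Proof.
move=> cK Kp; have [N [t [t0 tm KE]]] := cK.
have [pN /andP[p1 p2]] : (p.2 < N)%N /\ t p.2 <= p.1 <= t p.2.+1.
  by move: Kp; rewrite KE.
(* The interval of [p] becomes the last one, with its right end moved to [p.1]. *)
exists p.2.+1, (fun i => if i == p.2.+1 then p.1 else t i).
have tE i : (i <= p.2)%N -> (if i == p.2.+1 then p.1 else t i) = t i.
  by move=> ip; rewrite ltn_eqF.
split.
- exact: t0.
- move=> j jp; rewrite (tE j jp); case: eqVneq => [[->]//|njp].
  by apply: tm; exact: leq_trans jp pN.
apply/seteqP; split=> [[s i]|[s i]] /=.
  move=> [Ki ip]; have [iN /andP[s1 s2]] : (i < N)%N /\ t i <= s <= t i.+1.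
    by move: Ki; rewrite KE.
  have [/= ip2|/= [iE sp]] := hybrid_length_lt cK Ki Kp ip.
    split; first exact: ltnW.
    by rewrite (tE i (ltnW ip2)) (tE i.+1 ip2) s1 s2.
  rewrite iE in s1 *; split => //.
  by rewrite (tE p.2 (leqnn _)) eqxx sp s1.
rewrite ltnS => -[ip /andP[]]; rewrite (tE i ip) => s1.
case: eqVneq => [[iE] sp|ne s2].
  rewrite iE in s1 *.
  split; last by rewrite /hybrid_length /= lerD2r.
  by rewrite KE /= pN s1 (le_trans sp).
have ip' : (i < p.2)%N by rewrite ltn_neqAle ip andbT; apply: contra ne => /eqP ->.
have Ki : K (s, i) by rewrite KE /= s1 s2 (ltn_trans ip').
split => //; have /= := compact_domain_time_le cK Ki Kp ip'.
rewrite /hybrid_length /=; move: ip'; rewrite -(ltr_nat R); lra.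
Qed.

Lemma hybrid_domain_trunc E p : hybrid_time_domain E -> E p ->
  compact_hybrid_time_domain (E `&` [set q | hybrid_length q <= hybrid_length p]).
Proof.
move=> [L [cL LS ->]] [k _ Lp].
have -> : (\bigcup_k L k) `&` [set q | hybrid_length q <= hybrid_length p] =
    L k `&` [set q | hybrid_length q <= hybrid_length p].
  apply/seteqP; split => q [Lq qp]; split => //; last by exists k.
  have [k' _ Lq'] := Lq.
  apply: (@compact_domain_initial (L k) (L (maxn k k')) p q) => //.
    exact: nondecreasing_subset (leq_maxl _ _).
  exact: (nondecreasing_subset LS (leq_maxr _ _)).
exact: compact_domain_trunc.
Qed.

(** A union over an arbitrary chain comes without a sequence, which the definition of a hybrid time
    domain demands. A countable cofinal set of points supplies one. *)
Lemma hybrid_domain_of_trunc E : E !=set0 ->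
  (forall p, E p ->
    compact_hybrid_time_domain (E `&` [set q | hybrid_length q <= hybrid_length p])) ->
  hybrid_time_domain E.
Proof.
move=> [e0 Ee0] hE.
pose K p := E `&` [set q | hybrid_length q <= hybrid_length p].
suff [c cE cof] : exists2 c : nat -> R * nat, forall n, E (c n) &
    forall p, E p -> exists n, hybrid_length p <= hybrid_length (c n).
  (* The running maximum of [c], which makes the truncations nondecreasing. *)
  pose b := fix b n := if n is n'.+1 then
    (if hybrid_length (b n') <= hybrid_length (c n) then c n else b n') else c 0%N.
  have bE n : E (b n) by elim: n => [|n IH] /=; [exact: cE|case: ifP].
  have bS n : hybrid_length (b n) <= hybrid_length (b n.+1) by rewrite /=; case: ifP.
  have cb n : hybrid_length (c n) <= hybrid_length (b n).
    by case: n => //= n; case: (leP (hybrid_length (b n))) => // /ltW.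
  exists (fun n => K (b n)); split.
  - by move=> n; exact: hE.
  - by move=> n q [Eq qb]; split => //; exact: le_trans (bS n).
  - apply/seteqP; split => [p Ep|p [n _ []]//].
    have [n pn] := cof p Ep; exists n => //; split => //=; exact: le_trans (cb n).
have [[m Em mmax]|nomax] := pselect (exists2 m, E m &
    forall p, E p -> hybrid_length p <= hybrid_length m).
  by exists (fun=> m) => // p Ep; exists 0%N; exact: mmax.
(* If no length is largest, each rational that is exceeded selects one point beyond it; rationals
   between two lengths make the selection cofinal. *)
have sel (n : nat) : {p | E p /\ forall r : rat, unpickle n = Some r ->
    (exists2 q, E q & ratr r <= hybrid_length q) -> ratr r <= hybrid_length p}.
  apply: cid; case: (unpickle n) => [r|]; last by exists e0.
  have [[q Eq rq]|no] := pselect (exists2 q, E q & (ratr r : R) <= hybrid_length q).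
    by exists q; split => // r' [<-].
  by exists e0; split => // r' [<-] /no.
exists (fun n => sval (sel n)); first by move=> n; case: (sel n) => p [].
move=> p Ep.
have [q Eq pq] : exists2 q, E q & hybrid_length p < hybrid_length q.
  apply: contrapT => no; apply: nomax; exists p => // q Eq; rewrite leNgt.
  by apply/negP => pq; apply: no; exists q.
have [r] := rat_in_itvoo pq; rewrite in_itv /= => /andP[pr rq].
exists (pickle r); case: (sel (pickle r)) => /= s [Es hs].
apply: le_trans (ltW pr) _; apply: hs; first by rewrite pickleK.
by exists q => //; exact: ltW.
Qed.

Lemma hybrid_domain_chain (F : set (set (R * nat))) :
  F !=set0 -> (forall E, F E -> hybrid_time_domain E /\ E !=set0) ->
  total_on F subset -> hybrid_time_domain (\bigcup_(E in F) E).
Proof.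
move=> [E0 FE0] hF Ftot; apply: hybrid_domain_of_trunc.
  by have [_ [p Ep]] := hF _ FE0; exists p, E0.
move=> p [E FE Ep].
rewrite (_ : _ `&` _ = E `&` [set q | hybrid_length q <= hybrid_length p]).
  by apply: hybrid_domain_trunc => //; have [] := hF _ FE.
apply/seteqP; split => q [Fq qp]; split => //; last by exists E.
have [E' FE' E'q] := Fq.
have [E'E|EE'] := Ftot _ _ FE' FE; first exact: E'E.
have [[hE _] [hE' _]] := (hF _ FE, hF _ FE').
suff : (E `&` [set q | hybrid_length q <= hybrid_length p]) q by case.
apply: (@compact_domain_initial _
  (E' `&` [set q | hybrid_length q <= hybrid_length p]) p q) => //.
- exact: hybrid_domain_trunc.
- by apply: hybrid_domain_trunc => //; exact: EE'.
- by move=> x [Ex xp]; split => //; exact: EE'.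
- by split => //=.
Qed.

Lemma hybrid_domain_convex E a b s j : hybrid_time_domain E ->
  E (a, j) -> E (b, j) -> a <= s <= b -> E (s, j).
Proof.
move=> hE Ea Eb /andP[as_ sb].
have [K [[N [t [_ _ KE]]] KsE Ka Kb]] := hybrid_domain_compact2 hE Ea Eb.
apply: KsE; move: Ka Kb; rewrite KE /= => -[jN /andP[ta _]] [_ /andP[_ bt]].
by rewrite jN (le_trans ta as_) (le_trans sb bt).
Qed.

End HybridTime.

(** * Maximal extensions *)

Lemma negligible_subsingleton (R : realType) (A : set R) :
  (forall s t, A s -> A t -> s = t) -> lebesgue_measure.-negligible A.
Proof.
move=> A1; have [[a Aa]|A0] := pselect (A !=set0).
  have h : lebesgue_measure.-negligible [set a].
    by apply/negligibleP; [exact: measurable_set1|exact: lebesgue_measure_set1].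
  by apply: negligibleS h => s As; exact: A1.
have h : lebesgue_measure.-negligible (set0 : set R) by exact: negligible_set0.
by apply: negligibleS h => s As; case: A0; exists s.
Qed.

(* Almost every point of an interval lies between two rational points of it. *)
Lemma ae_interval_local (R : realType) (S : set R) (Q : R -> Prop) :
  (forall a b, a < b -> S a -> S b -> `[a, b] `<=` S) ->
  (forall a b, a < b -> S a -> S b ->
    {ae lebesgue_measure, forall t, a < t < b -> Q t}) ->
  {ae lebesgue_measure, forall t, S t -> Q t}.
Proof.
move=> Sc SQ.
pose N (n : nat) : set R := [set t | exists p q : rat,
  [/\ unpickle n = Some (p, q), S (ratr p), S (ratr q), (ratr p : R) < t < ratr q & ~ Q t]].
have neg0 : lebesgue_measure.-negligible (set0 : set R) by exact: negligible_set0.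
have N0 n : lebesgue_measure.-negligible (N n).
  case E : (unpickle n : option (rat * rat)) => [[p q]|]; last first.
    by apply: negligibleS neg0 => t [p [q []]]; rewrite E.
  have [[pq [Sp Sq]]|no] := pselect ((ratr p : R) < ratr q /\ S (ratr p) /\ S (ratr q)).
    apply: negligibleS (SQ _ _ pq Sp Sq) => t [p' [q' []]].
    by rewrite E => -[<- <-] _ _ tpq nQ /= h; apply: nQ; exact: h.
  apply: negligibleS neg0 => t [p' [q' []]].
  rewrite E => -[<- <-] Sp Sq /andP[pt tq] _; apply: no; split => //.
  exact: lt_trans tq.
(* Points not enclosed by two points of [S] are its minimum or its maximum. *)
have hN : lebesgue_measure.-negligible ((\bigcup_n N n) `|`
    ([set t | S t /\ forall s, S s -> t <= s] `|`
     [set t | S t /\ forall s, S s -> s <= t])).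
  apply: negligibleU; first exact: negligible_bigcup.
  apply: negligibleU; apply: negligible_subsingleton => s t [Ss hs] [St ht].
    by apply/le_anti; rewrite hs// ht.
  by apply/le_anti; rewrite hs// ht.
apply: negligibleS hN.
move=> t /= nSQ; have [St nQ] : S t /\ ~ Q t.
  by split; [apply: contrapT => h; apply: nSQ => /h|move=> Qt; apply: nSQ].
have [h|nmin] := pselect (forall s, S s -> t <= s); first by right; left.
have [h|nmax] := pselect (forall s, S s -> s <= t); first by right; right.
have [a Sa at_] : exists2 a, S a & a < t.
  by apply: contrapT => no; apply: nmin => s Ss; rewrite leNgt; apply/negP => ?; apply: no; exists s.
have [b Sb tb] : exists2 b, S b & t < b.
  by apply: contrapT => no; apply: nmax => s Ss; rewrite leNgt; apply/negP => ?; apply: no; exists s.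
have [p] := rat_in_itvoo at_; rewrite in_itv/= => /andP[ap pt].
have [q] := rat_in_itvoo tb; rewrite in_itv/= => /andP[tq qb].
have ab := lt_trans at_ tb.
left; exists (pickle (p, q)) => //; exists p, q; split => //.
- by rewrite pickleK.
- by apply: (Sc _ _ ab Sa Sb); rewrite /= in_itv/= (ltW ap) (le_trans (ltW pt) (ltW tb)).
- by apply: (Sc _ _ ab Sa Sb); rewrite /= in_itv/= (ltW qb) (le_trans (ltW at_) (ltW tq)).
- by rewrite pt tq.
Qed.

Section MaximalExtension.
Variables (R : realType) (p : nat) (H : hybrid_system R p).

(** Values off the domain are arbitrary, so extensions are ordered by inclusion of graphs and not by
    equality of functions. *)
Definition signal_graph (x : hybrid_signal R p) : set (R * nat * 'rV[R]_p) :=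
  [set g | hdom x g.1 /\ g.2 = x g.1.1 g.1.2].

Lemma solution_dom (x : hybrid_signal R p) : solution H x ->
  hybrid_time_domain (hdom x).
Proof. by case=> -[]. Qed.

(** Any two points of the union lie in the domain of a single member, so every requirement on a
    compact segment or across a jump is inherited from one solution; countably many segments suffice
    for the almost-everywhere condition. *)
Lemma solution_chain (F : set (hybrid_signal R p)) (z : hybrid_signal R p) :
  F !=set0 -> (forall y, F y -> solution H y) ->
  (forall y1 y2, F y1 -> F y2 ->
    signal_graph y1 `<=` signal_graph y2 \/ signal_graph y2 `<=` signal_graph y1) ->
  hdom z = \bigcup_(y in F) hdom y ->
  (forall y t j, F y -> hdom y (t, j) -> z t j = y t j) ->
  solution H z.
Proof.
move=> [y0 Fy0] Fsol Ftot zdom zval.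
have dsub y1 y2 : signal_graph y1 `<=` signal_graph y2 -> hdom y1 `<=` hdom y2.
  by move=> h q q1; have /(_ (conj q1 erefl))[] := h (q, y1 q.1 q.2).
have zsub y : F y -> hdom y `<=` hdom z by move=> Fy q yq; rewrite zdom; exists y.
have common q1 q2 : hdom z q1 -> hdom z q2 -> exists2 y, F y & hdom y q1 /\ hdom y q2.
  rewrite zdom => -[y1 F1 h1] [y2 F2 h2].
  have [h|h] := Ftot y1 y2 F1 F2.
    by exists y2 => //; split => //; exact: dsub h _ h1.
  by exists y1 => //; split => //; exact: dsub h _ h2.
have nonempty y : F y -> hdom y !=set0.
  by move=> /Fsol[_ [h _] _ _]; exists (0, 0%N).
have hz : hybrid_time_domain (hdom z).
  rewrite zdom -(bigcup_image F (@hdom R p) id).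
  apply: hybrid_domain_chain; first by exists (hdom y0), y0.
    by move=> _ [y Fy <-]; split; [exact/solution_dom/Fsol|exact: nonempty].
  move=> _ _ [y1 F1 <-] [y2 F2 <-].
  by case: (Ftot y1 y2 F1 F2) => /dsub; [left|right].
have seg a b j : a <= b -> hdom z (a, j) -> hdom z (b, j) ->
    exists2 y, F y & `[a, b] `<=` slice y j.
  move=> ab za zb; have [y Fy [ya yb]] := common _ _ za zb; exists y => // s.
  rewrite /= in_itv/=; apply: hybrid_domain_convex ya yb.
  exact/solution_dom/Fsol.
have yz y t j : F y -> hdom y (t, j) -> y t j = z t j.
  by move=> Fy /(zval y t j Fy).
have zconv j a b : a < b -> slice z j a -> slice z j b -> `[a, b] `<=` slice z j.
  by move=> ab za zb s; rewrite /= in_itv/=; exact: hybrid_domain_convex za zb.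
split.
- split=> // j _ a b ab abz.
  (* On a degenerate segment the slice of a member may have empty interior and give no information,
     but all increments vanish. *)
  have [eab|neab] := eqVneq a b.
    move=> e e0; exists 1 => // m u v huv _ _; rewrite big1// => k _.
    have [h1 [h2 h3]] := huv k.
    have -> : u k = v k.
      by apply/le_anti; rewrite h2 (le_trans h3)// -eab.
    rewrite subrr /eucl_norm big1 ?sqrtr0// => i _.
    by rewrite mxE expr0n.
  have {neab}ltab : a < b by rewrite lt_neqAle neab.
  have [y Fy aby] : exists2 y, F y & `[a, b] `<=` slice y j.
    have za : slice z j a by apply: abz; rewrite /= in_itv/= lexx.
    have zb : slice z j b by apply: abz; rewrite /= in_itv/= lexx andbT.
    exact: seg ab za zb.
  have [[_ yac] _ _ _] := Fsol y Fy.
  have yi : (slice y j)° !=set0 by exact: segment_interior_neq0 aby.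
  move=> e e0; have [d d0 hd] := yac j yi a b ab aby e e0; exists d => // m u v h1 h2 h3.
  have := hd m u v h1 h2 h3; congr (_ < _); apply: eq_bigr => k _.
  have [h4 [h5 h6]] := h1 k.
  rewrite !(yz y)//; apply: aby; rewrite /= in_itv/=; apply/andP; split => //.
    exact: le_trans h6.
  exact: le_trans h5.
- have [_ [h0 hCD] _ _] := Fsol _ Fy0; split; first exact: zsub h0.
  by rewrite -(yz y0).
- move=> j _; apply: ae_interval_local; first exact: zconv.
  move=> a b ab za zb; have [y Fy aby] := seg _ _ _ (ltW ab) za zb.
  have [_ _ yae _] := Fsol y Fy.
  have yi : (slice y j)° !=set0 by exact: segment_interior_neq0 aby.
  apply: (ae_monotone (yae j yi)) => t ht /andP[at_ tb].
  have yt : slice y j t by apply: aby; rewrite /= in_itv/= !ltW.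
  have [h1 h2 h3] := ht yt.
  have near_eq : \forall s \near t, y s j = z s j.
    have : (slice y j)° t by apply: segment_interior aby; rewrite at_ tb.
    by apply: filterS => s; exact: yz.
  have zt := yz y t j Fy yt.
  have dz : derivable (z^~ j) t 1 by exact: near_eq_derivable near_eq h2.
  have Dz : 'D_1 (y^~ j) t = 'D_1 (z^~ j) t by exact: near_eq_derive near_eq.
  by rewrite zt in h1 h3; rewrite Dz in h3; split; [exact: h1|exact: dz|exact: h3].
- move=> t j z1 z2; have [y Fy [y1 y2]] := common _ _ z1 z2.
  have [_ _ _ yj] := Fsol y Fy.
  by rewrite -!(yz y)//; exact: yj.
Qed.

Lemma maximal_extension (x : hybrid_signal R p) : solution H x ->
  exists y, [/\ maximal_solution H y, hdom x `<=` hdom y &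
    forall t j, hdom x (t, j) -> y t j = x t j].
Proof.
move=> xsol.
pose P (G : set (R * nat * 'rV[R]_p)) := G = set0 \/
  exists y, [/\ solution H y, G = signal_graph y & signal_graph x `<=` G].
have x0 : signal_graph x (0, 0%N, x 0 0%N) by case: xsol => _ [].
have gsub y z : signal_graph y `<=` signal_graph z ->
    hdom y `<=` hdom z /\ forall t j, hdom y (t, j) -> z t j = y t j.
  move=> yz; have h t j : hdom y (t, j) -> hdom z (t, j) /\ y t j = z t j.
    by move=> yt; have := yz (t, j, y t j) (conj yt erefl).
  by split => [[t j] /h[]|t j /h[]].
have [F FP Ftot|A [PA Amax]] := @Zorn_bigcup _ P.
  have [[G0 [FG0 G0n]]|no] := pselect (exists G, F G /\ G <> set0); last first.
    left; apply/seteqP; split=> [g [G FG Gg]|//].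
    by apply: no; exists G; split => // G0; rewrite G0 in Gg.
  right; pose F' := [set y | solution H y /\ F (signal_graph y) /\
    signal_graph x `<=` signal_graph y].
  have F'G G : F G -> G <> set0 -> exists2 y, F' y & G = signal_graph y.
    move=> FG Gn; have [//|[y [ysol Gy xG]]] := FP _ FG.
    by exists y => //; split => //; rewrite -Gy.
  have F'tot y1 y2 : F' y1 -> F' y2 ->
     signal_graph y1 `<=` signal_graph y2 \/ signal_graph y2 `<=` signal_graph y1.
    by move=> [_ [F1 _]] [_ [F2 _]]; exact: Ftot.
  pose zv t j := xget 0 [set v | exists2 y, F' y & hdom y (t, j) /\ v = y t j].
  pose z := HybridSignal (\bigcup_(y in F') hdom y) zv.
  have zval y t j : F' y -> hdom y (t, j) -> z t j = y t j.
    move=> Fy yt; rewrite /z /= /zv; case: xgetP => [v _ [y' Fy' [y't ->]]|/(_ (y t j))].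
      have [h|h] := F'tot _ _ Fy Fy'; have [_ hv] := gsub _ _ h.
        exact: hv.
      by rewrite hv.
    by case; exists y.
  have [y0 Fy0 _] := F'G _ FG0 G0n.
  have zsol : solution H z.
    by apply: (@solution_chain F' z) => //; [exists y0|move=> y []].
  have UE : \bigcup_(X in F) X = signal_graph z.
    apply/seteqP; split => [g [G FG Gg]|[[t j] v] [/= [y Fy yt] ->]].
      have [|y Fy Gy] := F'G G FG; first by move=> G0'; rewrite G0' in Gg.
      move: Gg; rewrite Gy => -[gy g2]; split; first by exists y.
      by rewrite g2; apply/esym/zval => //; case: g gy {g2} => -[].
    exists (signal_graph y); first by case: Fy => _ [].
    by split => //=; exact: zval.
  exists z; split => //; rewrite UE => -[[t j] v] [/= xt ->].
  have [_ [_ xy]] := Fy0; have [h1 h2] := gsub _ _ xy.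
  split => /=; first by exists y0 => //; exact: h1.
  by rewrite -(h2 _ _ xt); apply/esym; exact: zval Fy0 (h1 _ xt).
have Px : P (signal_graph x) by right; exists x; split.
case: PA => [A0|[y [ysol Ay xA]]].
  case: (Amax (signal_graph x)) => //; rewrite A0; split => // /(_ _ x0).
  by [].
rewrite {A}Ay in Amax xA.
have [xy1 xy2] := gsub _ _ xA.
exists y; split => //; split => // z zsol yz yzv.
apply/seteqP; split => //; apply: contrapT => nzy.
have yzg : signal_graph y `<=` signal_graph z.
  by move=> [[t j] v] [/= yt ->]; split => /=; [exact: yz|rewrite yzv].
apply: (Amax (signal_graph z)); last first.
  by right; exists z; split => //; exact: subset_trans yzg.
by split => // zy; apply: nzy; have [] := gsub _ _ zy.
Qed.

End MaximalExtension.

(** * Limits of approximate paths *)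

(** An ultrafilter converges to each of its cluster points, so limits exist without passing to
    subsequences. *)
Lemma ultra_compact_cvg (I : Type) (X : topologicalType) (U : set_system I)
    (K : set X) (u : I -> X) : UltraFilter U -> compact K ->
  (\forall i \near U, K (u i)) -> exists2 l, K l & u @ U --> l.
Proof.
move=> UU cK Ku; have PU := ultra_proper.
have [l [Kl cl]] := cK (u @ U) _ Ku.
exists l => // V Vl; have [//|nV] := in_ultra_setVsetC (u @^-1` V) UU.
have [x [nVx Vx]] := cl (~` V) V nV Vl; case: (nVx Vx).
Qed.

Lemma ultra_bounded_nat_cst (I : Type) (U : set_system I) (N : I -> nat) (B : nat) :
  UltraFilter U -> (\forall i \near U, (N i <= B)%N) ->
  exists n, \forall i \near U, N i = n.
Proof.
move=> UU; have PU := ultra_proper.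
elim: B => [|B IH] h.
  by exists 0%N; apply: filterS h => i; rewrite leqn0 => /eqP.
have [hB|hB] := in_ultra_setVsetC [set i | (N i <= B)%N] UU; first exact: IH.
exists B.+1; apply: filterS2 h hB => i h1 /= /negP; rewrite -ltnNge => h2.
by apply/eqP; rewrite eqn_leq h1.
Qed.

Lemma cvg_dist_squeeze (R : realType) (V : normedModType R) (I : Type)
    (U : set_system I) (f h : I -> V) (g : I -> R) (l : V) : Filter U ->
  (\forall i \near U, `|f i - h i| <= g i) -> g @ U --> 0 -> h @ U --> l ->
  f @ U --> l.
Proof.
move=> FU fg g0 hl; apply/cvgrPdist_le => e e0.
have e2 : 0 < e / 2 by rewrite divr_gt0.
near=> i.
have h1 : `|f i - h i| <= g i by near: i.
have h2 : `|g i| <= e / 2 by near: i; exact: cvgr0_norm_le.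
have h3 : `|l - h i| <= e / 2 by near: i; apply: cvgr_dist_le.
rewrite (_ : l - f i = (l - h i) - (f i - h i)); last first.
  by rewrite opprB addrA subrK.
have := ler_normB (l - h i) (f i - h i); have := ler_norm (g i); lra.
Unshelve. all: by end_near. Qed.

Lemma derivable_of_expansion (R : realType) (V : normedModType R) (f : R -> V)
    (t : R) (v : V) :
  (forall e, 0 < e -> exists2 d, 0 < d & forall h, `|h| < d ->
    `|f (t + h) - f t - h *: v| <= `|h| * e) ->
  derivable f t 1 /\ 'D_1 f t = v.
Proof.
move=> fv.
have h : (fun h => h^-1 *: (f (h *: (1 : R) + t) - f t)) @ 0^' --> v.
  apply/cvgrPdist_le => e e0; have [d d0 hd] := fv e e0.
  rewrite near_withinE; apply/nbhs_ballP; exists d => //= h.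
  rewrite -ball_normE /= sub0r normrN => hd' h0.
  have hp : 0 < `|h| by rewrite normr_gt0.
  rewrite -(ler_pM2l hp) -normrZ scalerBr scalerA mulfV// scale1r distrC.
  by rewrite /GRing.scale/= mulr1 (addrC h t); exact: hd.
by split; [apply: cvgP h|exact: cvg_lim h].
Qed.

Section ApproximatePaths.
Variables (R : realType) (p : nat) (C D : set 'rV[R]_p).
Variables (F G : 'rV[R]_p -> 'rV[R]_p).

(** There are [N] jumps, hence [N.+1] flow intervals, some possibly degenerate. As for solutions,
    the flow constraint concerns the nondegenerate ones only. *)
Definition approx_path (rho M eta : R) (N : nat) (T : nat -> R)
    (x : R -> nat -> 'rV[R]_p) : Prop :=
  [/\ T 0%N = 0 /\ (forall k, (k <= N)%N -> T k <= T k.+1),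
      (C `|` D) (x 0 0%N),
      (forall k, (k < N)%N -> D (x (T k.+1) k) /\
        x (T k.+1) k.+1 = G (x (T k.+1) k)),
      (forall k, (k <= N)%N -> T k < T k.+1 ->
        forall t, T k <= t <= T k.+1 -> C (x t k)) &
      (forall k, (k <= N)%N -> (forall t, T k <= t <= T k.+1 -> `|x t k| <= rho) /\
        approx_flow F rho M eta (T k) (T k.+1) (x^~ k))].

End ApproximatePaths.

Section LimitSolution.
Variables (R : realType) (p : nat) (C D : set 'rV[R]_p).
Variables (F G : 'rV[R]_p -> 'rV[R]_p) (rho M Hor : R).
Hypothesis C_closed : closed C.
Hypothesis D_closed : closed D.
Hypothesis F_cont : continuous F.
Hypothesis G_cont : continuous G.
Hypothesis M0 : 0 <= M.
Variables (eta : nat -> R) (N_ : nat -> nat) (T_ : nat -> nat -> R).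
Variable x_ : nat -> R -> nat -> 'rV[R]_p.
Hypothesis eta0 : eta @ \oo --> 0.
Hypothesis path : forall i, approx_path C D F G rho M (eta i) (N_ i) (T_ i) (x_ i).
Hypothesis horizon : forall i, T_ i (N_ i).+1 + (N_ i)%:R <= Hor.

Let Hsys := {| flow_set := C; flow_map := fun x => [set F x];
               jump_set := D; jump_map := fun x => [set G x] |}.

(** One ultrafilter provides the limits of the number of jumps, of all jump times and of the states
    at all times simultaneously, with no diagonal extraction. Bounded length limits the number of
    jumps. *)
Lemma limit_solution : exists (N : nat) (T : nat -> R) (z : hybrid_signal R p),
  [/\ solution Hsys z, hdom z (T N.+1, N) &
    forall e, 0 < e -> exists i, [/\ N_ i = N, `|x_ i 0 0%N - z 0 0%N| <= e,
      `|T_ i N.+1 - T N.+1| <= e &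
      `|x_ i (T_ i N.+1) N - z (T N.+1) N| <= e]].
Proof.
have [U [UU ooU]] := @ultraFilterLemma nat \oo _.
have PU : ProperFilter U by exact: ultra_proper.
have etaU : eta @ U --> 0 by apply: cvg_trans eta0; exact: cvg_app.
have Tmono i j k : (j <= k)%N -> (k <= (N_ i).+1)%N -> T_ i j <= T_ i k.
  have [[_ tm] _ _ _ _] := path i; exact: (compact_domain_mono (N := (N_ i).+1)).
have Tge0 i k : (k <= (N_ i).+1)%N -> 0 <= T_ i k.
  by have [[<- _] _ _ _ _] := path i; exact: Tmono.
have TleHor i k : (k <= (N_ i).+1)%N -> T_ i k <= Hor.
  move=> kN; apply: le_trans (Tmono i k _ kN (leqnn _)) _.
  by apply: le_trans (horizon i); rewrite lerDl.
have [B HB] : exists B : nat, Hor <= B%:R.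
  by exists (Num.bound `|Hor|); apply: le_trans (ler_norm _) _; apply/ltW/archi_boundP.
have [N NE] : exists N, \forall i \near U, N_ i = N.
  apply: (@ultra_bounded_nat_cst _ _ _ B) => //; near=> i.
  rewrite -(ler_nat R); apply: le_trans HB; apply: le_trans (horizon i).
  by rewrite lerDr; exact: Tge0.
have [T HT] : exists T : nat -> R, forall k, (k <= N.+1)%N -> T_ i k @[i --> U] --> T k.
  suff h k : exists l : R, (k <= N.+1)%N -> T_ i k @[i --> U] --> l.
    by have [f hf] := choice h; exists f.
  have [kN|_] := leqP k N.+1; last by exists 0.
  have [l _ hl] : exists2 l, `[0, Hor]%classic l & T_ i k @[i --> U] --> l.
    apply: ultra_compact_cvg; first exact: segment_compact.
    apply: filterS NE => i Ni; rewrite -Ni in kN.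
    by rewrite /= in_itv/= Tge0// TleHor.
  by exists l.
(* The flow intervals vary with [i], so each path is evaluated at [t] clamped to its own
   interval. *)
pose cl i k t := Num.max (T_ i k) (Num.min t (T_ i k.+1)).
have cl_in i k t : (k <= N_ i)%N -> T_ i k <= cl i k t <= T_ i k.+1.
  move=> kN; have [[_ tm] _ _ _ _] := path i.
  by rewrite le_max lexx/= ge_max tm//= ge_min lexx orbT.
have cl_mono i k s t : s <= t -> cl i k s <= cl i k t.
  move=> st; rewrite ge_max le_max lexx/= le_max; apply/orP; right.
  by rewrite le_min !ge_min st lexx !orbT.
have cl_cvg k t : (k <= N)%N -> T k <= t <= T k.+1 -> cl i k t @[i --> U] --> t.
  move=> kN /andP[Tt tT].
  have d0 : `|T_ i k - T k| + `|T_ i k.+1 - T k.+1| @[i --> U] --> 0.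
    rewrite (_ : 0 = `|T k - T k| + `|T k.+1 - T k.+1|); last by rewrite !subrr normr0 addr0.
    apply: cvgD; apply: cvg_norm; (apply: cvgB; last exact: cvg_cst); apply: HT => //.
    exact: leqW.
  apply: (@cvg_dist_squeeze R R^o nat U (fun i => cl i k t) (cst t) _ t _ _ d0 (cvg_cst t)); apply: nearW => i; rewrite /cl /=.
  have := ler_norm (T_ i k - T k); have := ler_norm (- (T_ i k.+1 - T k.+1)).
  have := normr_ge0 (T_ i k - T k); have := normr_ge0 (T_ i k.+1 - T k.+1).
  rewrite normrN => n1 n2 n3 n4; rewrite ler_norml.
  case: (leP t (T_ i k.+1)) => h1.
    by case: (leP (T_ i k) t) => h2; apply/andP; split; lra.
  by case: (leP (T_ i k) (T_ i k.+1)) => h2; apply/andP; split; lra.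
have [zv Hz] : exists zv : nat -> R -> 'rV[R]_p, forall k t, (k <= N)%N ->
    x_ i (cl i k t) k @[i --> U] --> zv k t.
  have h (kt : nat * R) : exists l : 'rV[R]_p, (kt.1 <= N)%N ->
      x_ i (cl i kt.1 kt.2) kt.1 @[i --> U] --> l.
    have [kN|_] := leqP kt.1 N; last by exists 0.
    have [|l _ hl] := ultra_compact_cvg UU (@norm_ball_compact R p rho)
      (u := fun i => x_ i (cl i kt.1 kt.2) kt.1); last by exists l.
    apply: filterS NE => i Ni; rewrite -Ni in kN.
    by have [_ _ _ _ /(_ _ kN)[h _]] := path i; apply: h; exact: cl_in.
  have [f hf] := choice h.
  by exists (fun k t => f (k, t)) => k t; exact: (hf (k, t)).
have zrho k t : (k <= N)%N -> `|zv k t| <= rho.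
  move=> kN; apply: (closed_cvg (fun y : 'rV[R]_p => `|y| <= rho) _ _ _ (Hz k t kN)).
    apply: compact_closed; first exact: norm_hausdorff.
    exact: norm_ball_compact.
  apply: filterS NE => i Ni; rewrite -Ni in kN.
  by have [_ _ _ _ /(_ _ kN)[h _]] := path i; apply: h; exact: cl_in.
(* The paths are equicontinuous up to [eta i], so evaluation at any convergent choice of times gives
   the same limit; this is applied to the moving jump times. *)
have Hz' k t (tau : nat -> R) : (k <= N)%N -> T k <= t <= T k.+1 ->
    (\forall i \near U, T_ i k <= tau i <= T_ i k.+1) -> tau @ U --> t ->
    x_ i (tau i) k @[i --> U] --> zv k t.
  move=> kN Tt tau_in taut.
  have dist0 : M * `|tau i - cl i k t| + eta i @[i --> U] --> 0.
    rewrite (_ : 0 = M * `|t - t| + 0); last by rewrite subrr normr0 mulr0 addr0.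
    apply: cvgD => //; apply: cvgMr; apply: cvg_norm; apply: cvgB => //.
    exact: cl_cvg.
  apply: (cvg_dist_squeeze _ _ dist0 (Hz k t kN)).
  near=> i; have Ni : N_ i = N by near: i.
  have kN' : (k <= N_ i)%N by rewrite Ni.
  have ti : T_ i k <= tau i <= T_ i k.+1 by near: i.
  have /andP[c1 c2] := cl_in i k t kN'.
  case/andP: ti => t1 t2.
  have [_ _ _ _ /(_ _ kN')[_ h]] := path i.
  have [tc|/ltW ct] := leP (tau i) (cl i k t).
    by rewrite distrC ler0_norm ?subr_le0// opprB; exact: (h _ _ t1 tc c2).1.
  by rewrite ger0_norm ?subr_ge0//; exact: (h _ _ c1 ct t2).1.
have Tinc k : (k <= N)%N -> T k <= T k.+1.
  move=> kN; apply: (ler_cvg_to (HT _ (leqW kN)) (HT k.+1 kN)).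
  by apply: filterS NE => i Ni; have [[_ tm] _ _ _ _] := path i; apply: tm; rewrite Ni.
have T0 : T 0%N = 0.
  have h0 : T_ i 0%N @[i --> U] --> (0 : R).
    rewrite (_ : (fun i => T_ i 0%N) = fun=> 0); first exact: cvg_cst.
    by apply/funext => i; have [[]] := path i.
  exact: (cvg_unique _ (HT 0%N (leq0n _)) h0).
have zlip k s t : (k <= N)%N -> T k <= s -> s <= t -> t <= T k.+1 ->
    `|zv k t - zv k s| <= M * (t - s).
  move=> kN Ts st tT; have Tt := le_trans Ts st; have sT := le_trans st tT.
  have lc : `|x_ i (cl i k t) k - x_ i (cl i k s) k| @[i --> U] -->
      `|zv k t - zv k s|.
    by apply: cvg_norm; apply: cvgB; exact: Hz.
  have rc : M * (cl i k t - cl i k s) + eta i @[i --> U] --> M * (t - s) + 0.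
    apply: cvgD => //; apply: cvgMr; apply: cvgB; apply: cl_cvg => //; exact/andP.
  rewrite -[leRHS]addr0; apply: (ler_cvg_to lc rc).
  apply: filterS NE => i Ni; rewrite -Ni in kN.
  have [_ _ _ _ /(_ _ kN)[_ h]] := path i.
  have /andP[c1 _] := cl_in i k s kN; have /andP[_ c2] := cl_in i k t kN.
  exact: (h _ _ c1 (cl_mono _ _ _ _ st) c2).1.
(* At scales below [d] the oscillation bound [w := e] is eventually admissible. Since [eta i]
   vanishes, the limit has a first-order expansion uniform in the base point. *)
have zest e : 0 < e -> exists2 d, 0 < d & forall k s t, (k <= N)%N ->
    T k <= s -> s <= t -> t <= T k.+1 -> t - s <= d ->
    `|zv k t - zv k s - (t - s) *: F (zv k s)| <= (t - s) * e.
  move=> e0.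
  have [h h0 Fh] := compact_unif_continuous F_cont (@norm_ball_compact R p rho) e0.
  have M1 : 0 < M + 1 by rewrite ltr_wpDl.
  pose d := (h / 2) / (M + 1); exists d; first by rewrite !divr_gt0.
  move=> k s t kN Ts st tT tsd.
  have Tt := le_trans Ts st; have sT := le_trans st tT.
  have tc : cl i k t @[i --> U] --> t by apply: cl_cvg => //; exact/andP.
  have sc : cl i k s @[i --> U] --> s by apply: cl_cvg => //; exact/andP.
  have Mh : M * (t - s) + 0 < h.
    have : (M + 1) * (t - s) <= h / 2 by rewrite mulrC -ler_pdivlMr.
    have : 0 <= t - s by rewrite subr_ge0.
    lra.
  have rc : M * (cl i k t - cl i k s) + eta i @[i --> U] --> M * (t - s) + 0.
    by apply: cvgD => //; apply: cvgMr; apply: cvgB.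
  have small : \forall i \near U, M * (cl i k t - cl i k s) + eta i < h.
    exact: cvgr_lt rc _ Mh.
  have lc : `|x_ i (cl i k t) k - x_ i (cl i k s) k -
      (cl i k t - cl i k s) *: F (x_ i (cl i k s) k)| @[i --> U] -->
      `|zv k t - zv k s - (t - s) *: F (zv k s)|.
    have Fc := cvg_comp _ _ (Hz k s kN) (@F_cont (zv k s)).
    apply: cvg_norm; apply: cvgB; first by apply: cvgB; exact: Hz.
    by apply: cvgZ; [exact: cvgB|exact: Fc].
  have rc2 : (cl i k t - cl i k s) * (e + eta i) + eta i @[i --> U] -->
      (t - s) * (e + 0) + 0.
    apply: cvgD => //; apply: cvgM; first exact: cvgB.
    by apply: cvgD => //; exact: cvg_cst.
  have -> : (t - s) * e = (t - s) * (e + 0) + 0 by rewrite !addr0.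
  apply: (ler_cvg_to lc rc2).
  near=> i.
  have Ni : N_ i = N by near: i.
  have kN' : (k <= N_ i)%N by rewrite Ni.
  have sm : M * (cl i k t - cl i k s) + eta i < h by near: i.
  have [_ _ _ _ /(_ _ kN')[_ hx]] := path i.
  have /andP[c1 _] := cl_in i k s kN'; have /andP[_ c2] := cl_in i k t kN'.
  apply: (hx _ _ c1 (cl_mono _ _ _ _ st) c2).2 => u v ur vr uv.
  by apply: Fh => //; exact: le_trans uv (ltW sm).
have zderiv k t : (k <= N)%N -> T k < t -> t < T k.+1 ->
    derivable (zv k) t 1 /\ 'D_1 (zv k) t = F (zv k t).
  move=> kN Tt tT; apply: derivable_of_expansion => e e0.
  have e2 : 0 < e / 2 by rewrite divr_gt0.
  have [d1 d10 hd1] := zest _ e2.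
  have [h h0 Fh] := compact_unif_continuous F_cont (@norm_ball_compact R p rho) e2.
  have M1 : 0 < M + 1 by rewrite ltr_wpDl.
  pose d := Num.min (Num.min d1 (h / (M + 1))) (Num.min (t - T k) (T k.+1 - t)).
  exists d; first by rewrite !lt_min d10 divr_gt0//= !subr_gt0 Tt.
  move=> r; rewrite !lt_min => /andP[/andP[r1 r2] /andP[r3 r4]].
  have [r0|r0] := leP 0 r.
    rewrite ger0_norm// in r1 r2 r3 r4 *.
    have ttr : t <= t + r by rewrite lerDl.
    have trT : t + r <= T k.+1 by lra.
    have := hd1 k t (t + r) kN (ltW Tt) ttr trT; rewrite addrC addKr.
    move=> /(_ (ltW r1)) /le_trans; apply; rewrite ler_wpM2l//; lra.
  rewrite ltr0_norm// in r1 r2 r3 r4 *.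
  have trt : t + r <= t by rewrite gerDl ltW.
  have Ttr : T k <= t + r by lra.
  have nr : t - (t + r) = - r by lra.
  have := hd1 k (t + r) t kN Ttr trt (ltW tT); rewrite nr => /(_ (ltW r1)) hz.
  have zl := zlip k _ _ kN Ttr trt (ltW tT); rewrite nr in zl.
  have FF : `|F (zv k t) - F (zv k (t + r))| <= e / 2.
    apply: Fh; first exact: zrho.
    apply: le_trans zl _.
    have : (M + 1) * - r <= h by rewrite mulrC -ler_pdivlMr// ltW.
    lra.
  (* For a negative increment the expansion is based at the left point [t + r]; moving the base
     point of [F] back to [t] costs the other [e / 2]. *)
  have -> : zv k (t + r) - zv k t - r *: F (zv k t) =
    - (zv k t - zv k (t + r) - (- r) *: F (zv k (t + r))) +
    (- r) *: (F (zv k t) - F (zv k (t + r))).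
    by apply/rowP => i; rewrite !mxE; ring.
  apply: le_trans (ler_normD _ _) _; rewrite normrN normrZ normrN ltr0_norm//.
  have : - r * `|F (zv k t) - F (zv k (t + r))| <= - r * (e / 2).
    by rewrite ler_wpM2l//; lra.
  lra.
pose E : set (R * nat) := [set q | (q.2 < N.+1)%N /\ T q.2 <= q.1 <= T q.2.+1].
pose z := @HybridSignal R p E (fun t k => zv k t).
have z_in k a b : a <= b -> `[a, b] `<=` slice z k ->
    [/\ (k <= N)%N, T k <= a & b <= T k.+1].
  move=> ab abz.
  have za : slice z k a by apply: abz; rewrite /= in_itv/= lexx.
  have zb : slice z k b by apply: abz; rewrite /= in_itv/= lexx andbT.
  by move: za zb => [/= kN /andP[Ta _]] [/= _ /andP[_ bT]].
have x0c : x_ i 0 0%N @[i --> U] --> z 0 0%N.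
  have := @Hz' 0%N 0 (fun=> 0) (leq0n _); apply.
  - by rewrite T0 lexx/= -T0 Tinc.
  - apply: nearW => i; have [[T_0 tm] _ _ _ _] := path i.
    by rewrite -T_0 lexx/=; exact: tm.
  - exact: cvg_cst.
have xend k : (k <= N)%N -> x_ i (T_ i k.+1) k @[i --> U] --> zv k (T k.+1).
  move=> kN; apply: Hz' => //; last exact: HT.
    by rewrite lexx andbT Tinc.
  apply: filterS NE => i Ni; have [[_ tm] _ _ _ _] := path i.
  by rewrite lexx andbT tm// Ni.
have xstart k : (k < N)%N -> x_ i (T_ i k.+1) k.+1 @[i --> U] --> zv k.+1 (T k.+1).
  move=> kN; apply: Hz' => //; last by apply: HT; exact: leqW.
    by rewrite lexx/= Tinc.
  apply: filterS NE => i Ni; have [[_ tm] _ _ _ _] := path i.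
  by rewrite lexx/= tm// Ni.
exists N, T, z; split; last 2 first.
- by rewrite /= /E /= ltnSn lexx andbT; split => //; exact: Tinc.
- move=> e e0; near U => i; exists i; split; first by near: i.
  + by near: i; rewrite near_simpl; under eq_near do rewrite distrC; apply: cvgr_dist_le.
  + by near: i; under eq_near do rewrite distrC; apply: cvgr_dist_le => //; exact: HT.
  + by near: i; under eq_near do rewrite distrC; apply: cvgr_dist_le => //; exact: xend.
split.
- split.
    exists (fun=> E); split.
    + by move=> _; exists N.+1, T; split => // j; rewrite ltnS; exact: Tinc.
    + by move=> _ q.
    + by apply/seteqP; split => [q Eq|q [_ _ //]]; exists 0%N.
  move=> j _ a b ab abz; have [jN Ta bT] := z_in j a b ab abz.
  (* The factor [p%:R] converts the sup norm into the Euclidean one; adding 1 keeps the constant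
     positive. *)
  move=> e e0; pose L := p%:R * M + 1.
  have L0 : 0 < L by rewrite ltr_wpDl// mulr_ge0.
  exists (e / L); first by rewrite divr_gt0.
  move=> m u v h1 _ h3.
  apply: (@le_lt_trans _ _ (\sum_k L * (v k - u k))).
    apply: ler_sum => k _; have [h4 [h5 h6]] := h1 k.
    have uv : 0 <= v k - u k by rewrite subr_ge0.
    apply: le_trans (eucl_le_norm _) _.
    have := zlip j _ _ jN (le_trans Ta h4) h5 (le_trans h6 bT).
    move=> /(ler_wpM2l (ler0n _ p)) /le_trans; apply.
    by rewrite mulrA ler_wpM2r// lerDl.
  by rewrite -mulr_sumr mulrC -ltr_pdivlMr.
- split; first by rewrite /= /E /= T0 lexx/= -T0 Tinc.
  apply: (closed_cvg _ _ _ _ x0c); first exact: closedU.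
  by apply: nearW => i; have [_ ? _ _ _] := path i.
- move=> j _; apply: ae_interval_local.
    move=> a b ab [/= jN /andP[Ta _]] [/= _ /andP[_ bT]] s /=.
    rewrite in_itv/= => /andP[as_ sb]; split => //=.
    by rewrite (le_trans Ta as_) (le_trans sb bT).
  move=> a b ab [/= jN /andP[Ta _]] [/= _ /andP[_ bT]].
  rewrite ltnS in jN.
  have all t : a < t < b -> [/\ flow_set Hsys (z t j), derivable (z^~ j) t 1 &
      flow_map Hsys (z t j) ('D_1 (z^~ j) t)].
    move=> /andP[at_ tb].
    have Tt := le_lt_trans Ta at_; have tT := lt_le_trans tb bT.
    have [d1 d2] := zderiv j t jN Tt tT; split => //.
    have TT : T j < T j.+1 by exact: lt_trans tT.
    apply: (closed_cvg _ C_closed _ _ (Hz j t jN)).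
    (* A nondegenerate limit interval arises from intervals that are eventually nondegenerate, on
       which the paths lie in [C]. *)
    have lt_near : \forall i \near U, T_ i j < T_ i j.+1.
      have d0 : T_ i j.+1 - T_ i j @[i --> U] --> T j.+1 - T j.
        by apply: cvgB; apply: HT => //; exact: leqW.
      rewrite -subr_gt0 in TT; have h : \forall i \near U, 0 < T_ i j.+1 - T_ i j by exact: cvgr_gt d0 _ TT.
      by apply: filterS h => i /=; rewrite subr_gt0.
    apply: filterS2 NE lt_near => i Ni lti; rewrite -Ni in jN.
    by have [_ _ _ /(_ _ jN lti)h _] := path i; apply: h; exact: cl_in.
  by apply: negligibleS (negligible_set0 _) => t /= h; apply: h; exact: all.
- move=> t k [/= kN /andP[_ tT]] [/= kN' /andP[Tt _]].
  rewrite !ltnS in kN kN'.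
  have -> : t = T k.+1 by apply/le_anti; rewrite tT Tt.
  have jump : \forall i \near U, D (x_ i (T_ i k.+1) k) /\
      x_ i (T_ i k.+1) k.+1 = G (x_ i (T_ i k.+1) k).
    apply: filterS NE => i Ni; have [_ _ h _ _] := path i; apply: h; by rewrite Ni.
  split.
    apply: (closed_cvg _ D_closed _ _ (xend k kN)).
    by apply: filterS jump => i [].
  have Gc := cvg_comp _ _ (xend k kN) (@G_cont _).
  have Gc' : x_ i (T_ i k.+1) k.+1 @[i --> U] --> G (zv k (T k.+1)).
    apply: cvg_trans Gc; apply: near_eq_cvg.
    by apply: filterS jump => i [_ ->].
  exact: (cvg_unique _ (xstart k kN') Gc').
Unshelve. all: by end_near. Qed.

End LimitSolution.

(** * Finite-horizon stability *)

(* A class KL function need not be continuous; this majorant of [beta]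
   absorbs small perturbations of both arguments. *)
Definition KL_majorant (R : realType) (beta : R -> R -> R) (r s : R) : R :=
  beta (2 * r) (Num.max 0 (s - 1)).

Lemma KL_majorant_class_KL (R : realType) (beta : R -> R -> R) :
  class_KL beta -> class_KL (KL_majorant beta).
Proof.
move=> [b0 bmono bdec br bs]; rewrite /KL_majorant.
have m0 (s : R) : 0 <= Num.max 0 (s - 1) by rewrite le_max lexx.
split.
- by move=> r s r0 s0; apply: b0; rewrite ?mulr_ge0.
- by move=> r1 r2 s r10 r12 s0; apply: bmono; rewrite ?mulr_ge0// ler_pM2l.
- move=> r s1 s2 r0 s10 s12; apply: bdec; rewrite ?mulr_ge0//.
  by rewrite ge_max le_max lexx/= le_max lerD2r s12 orbT.
- move=> s s0; apply/cvgrPdist_le => e e0.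
  have := br _ (m0 s) => /cvgrPdist_le /(_ e e0).
  rewrite near_withinE => /nbhs_ballP[d /= d0 hd].
  rewrite near_withinE; apply/nbhs_ballP; exists (d / 2) => /=; first by rewrite divr_gt0.
  move=> r; rewrite -ball_normE/= sub0r normrN => rd r0.
  apply: hd; last by rewrite mulr_gt0.
  rewrite -ball_normE/= sub0r normrN normrM ger0_norm//; lra.
- move=> r r0; apply/cvgrPdist_le => e e0.
  have r20 : 0 <= 2 * r by rewrite mulr_ge0.
  have := bs _ r20 => /cvgrPdist_le /(_ e e0) [S [Sr hS]].
  exists (`|S| + 1); split; first exact: num_real.
  move=> s sS; apply: hS; rewrite lt_max; apply/orP; right.
  have := ler_norm S; lra.
Qed.

Section StableApproximatePaths.
Variables (R : realType) (p : nat) (C D : set 'rV[R]_p).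
Variables (F G : 'rV[R]_p -> 'rV[R]_p) (A : set 'rV[R]_p).
Variables (beta : R -> R -> R) (Delta nu : R).
Hypothesis C_closed : closed C.
Hypothesis D_closed : closed D.
Hypothesis F_cont : continuous F.
Hypothesis G_cont : continuous G.
Hypothesis A_neq0 : A !=set0.
Hypothesis beta_KL : class_KL beta.
Hypothesis nu0 : 0 < nu.

Let Hsys := {| flow_set := C; flow_map := fun x => [set F x];
               jump_set := D; jump_map := fun x => [set G x] |}.

Hypothesis stable : forall x, maximal_solution Hsys x ->
  eucl_norm (x 0 0%N) <= Delta + 1 -> forall t j, hdom x (t, j) ->
  eucl_dist A (x t j) <= beta (eucl_dist A (x 0 0%N)) (t + j%:R) + nu.

(** Otherwise each error [harmonic i] admits a violating path. The limit of these is a nominal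
    solution, whose maximal extension obeys the bound; the perturbations of the initial state, of
    the length and of the end state are absorbed by [KL_majorant] and the second [nu]. *)
Lemma approx_path_stable (rho M Hor : R) : 0 <= M -> exists2 eta, 0 < eta &
  forall N T x, approx_path C D F G rho M eta N T x -> T N.+1 + N%:R <= Hor ->
    eucl_norm (x 0 0%N) <= Delta ->
    eucl_dist A (x (T N.+1) N) <=
      KL_majorant beta (eucl_dist A (x 0 0%N)) (T N.+1 + N%:R) + 2 * nu.
Proof.
move=> M0; apply: contrapT => no.
have bad (i : nat) : exists w : nat * (nat -> R) * (R -> nat -> 'rV[R]_p),
    [/\ approx_path C D F G rho M (harmonic i) w.1.1 w.1.2 w.2,
      w.1.2 w.1.1.+1 + w.1.1%:R <= Hor, eucl_norm (w.2 0 0%N) <= Delta &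
      KL_majorant beta (eucl_dist A (w.2 0 0%N)) (w.1.2 w.1.1.+1 + w.1.1%:R) + 2 * nu <
      eucl_dist A (w.2 (w.1.2 w.1.1.+1) w.1.1)].
  apply: contrapT => nw; apply: no; exists (harmonic i); first exact: harmonic_gt0.
  move=> N T x h1 h2 h3; rewrite leNgt; apply/negP => h4; apply: nw.
  by exists (N, T, x).
have [w hw] := choice bad.
have [N [T [z [zsol zN zlim]]]] := @limit_solution R p C D F G rho M Hor
  C_closed D_closed F_cont G_cont M0 harmonic (fun i => (w i).1.1)
  (fun i => (w i).1.2) (fun i => (w i).2) cvg_harmonic
  (fun i => let: And4 h _ _ _ := hw i in h) (fun i => let: And4 _ h _ _ := hw i in h).
have [y [ymax zy yz]] := maximal_extension zsol.
have z00 : hdom z (0, 0%N) by case: zsol => _ [].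
have [b0 bmono bdec _ _] := beta_KL.
set dz := eucl_dist A (z 0 0%N).
have dz0 : 0 <= dz by exact: eucl_dist_ge0.
(* 1 keeps the limit within [Delta + 1] and the length within the unit shift of the majorant;
   [nu / 2] pays for the end state; [dz / 2] gives [dz] at most twice the perturbed initial
   distance, which is automatic when [dz] is 0. *)
pose e0 := Num.min (Num.min 1 (nu / 2)) (if 0 < dz then dz / 2 else 1).
have e00 : 0 < e0.
  by rewrite !lt_min ltr01 divr_gt0//=; case: ifPn => // dz1; rewrite divr_gt0.
have p1 : 0 < p%:R + 1 :> R by rewrite ltr_wpDl.
pose e := e0 / (p%:R + 1); have e_gt0 : 0 < e by rewrite divr_gt0.
have pe : p%:R * e <= e0.
  rewrite /e mulrA ler_pdivrMr// mulrC ler_wpM2l ?(ltW e00)// lerDl; lra.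
have ee0 : e <= e0.
  by rewrite ler_pdivrMr// ler_peMr ?(ltW e00)// lerDr.
have [i [Ni x0 Ti xN]] := zlim e e_gt0.
have [_ _ xD xbad] := hw i.
rewrite Ni in xbad.
have close (u v : 'rV[R]_p) : `|u - v| <= e -> eucl_norm (u - v) <= e0.
  move=> uv; apply: le_trans (eucl_le_norm _) _.
  by apply: le_trans pe; rewrite ler_wpM2l.
have [e01 e02 e03] : [/\ e0 <= 1, e0 <= nu / 2 & 0 < dz -> e0 <= dz / 2].
  split; first by rewrite /e0 !ge_min lexx.
    by rewrite /e0 !ge_min lexx !orbT.
  by move=> dzp; rewrite /e0 dzp !ge_min lexx !orbT.
have z0D : eucl_norm (y 0 0%N) <= Delta + 1.
  rewrite (yz _ _ z00) -(subrK ((w i).2 0 0%N) (z 0 0%N)).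
  apply: le_trans (eucl_normD _ _) _; rewrite addrC; apply: lerD => //.
  by apply: le_trans e01; rewrite distrC in x0; exact: close.
have TN0 : 0 <= T N.+1.
  have hz : hybrid_time_domain (hdom z) by case: zsol => -[].
  have [K [cK _ KT _]] := hybrid_domain_compact2 hz zN zN.
  exact: compact_domain_time_ge0 cK KT.
have := stable ymax z0D (zy _ zN).
rewrite (yz _ _ z00) (yz _ _ zN) -/dz => hz.
have hx : eucl_dist A ((w i).2 ((w i).1.2 N.+1) N) <= eucl_dist A (z (T N.+1) N) + e0.
  by apply: le_trans (eucl_dist_lip _ (z (T N.+1) N) A_neq0) _; rewrite lerD2l close.
have hd : dz <= 2 * eucl_dist A ((w i).2 0 0%N).
  have dx0 := eucl_dist_ge0 A ((w i).2 0 0%N).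
  have : dz <= eucl_dist A ((w i).2 0 0%N) + e0.
    apply: le_trans (eucl_dist_lip _ ((w i).2 0 0%N) A_neq0) _; rewrite lerD2l.
    by rewrite close// distrC.
  have [dzp|] := ltP 0 dz; last lra.
  have := e03 dzp; lra.
have hb : beta dz (T N.+1 + N%:R) <=
    KL_majorant beta (eucl_dist A ((w i).2 0 0%N)) ((w i).1.2 N.+1 + N%:R).
  have s0 : 0 <= T N.+1 + N%:R by rewrite addr_ge0.
  have r0 : 0 <= 2 * eucl_dist A ((w i).2 0 0%N) by rewrite mulr_ge0// eucl_dist_ge0.
  apply: le_trans (bmono _ _ _ dz0 hd s0) _.
  apply: bdec => //; first by rewrite le_max lexx.
  rewrite ge_max s0/=; have := ler_norm ((w i).1.2 N.+1 - T N.+1); lra.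
lra.
Qed.

End StableApproximatePaths.

(** Continuation: over a short step the norm grows by less than 1, so the weaker bound [c + 1]
    persists, and [step] improves it back to [c]. *)
Lemma bootstrap_bound (R : realType) (V : normedModType R) (a b c : R) (f : R -> V) :
  a <= b ->
  (forall e, 0 < e -> exists2 d, 0 < d & forall s t, a <= s <= b -> a <= t <= b ->
    `|s - t| < d -> `|f s - f t| < e) ->
  `|f a| <= c ->
  (forall t, a <= t <= b -> (forall s, a <= s <= t -> `|f s| <= c + 1) -> `|f t| <= c) ->
  forall t, a <= t <= b -> `|f t| <= c.
Proof.
move=> ab fu fa step.
have [d d0 hd] := fu 1 ltr01.
suff : forall s, a <= s <= b -> `|f s| <= c by [].
apply: (creeping (P := fun t => forall s, a <= s <= t -> `|f s| <= c) ab).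
  by move=> s /andP[h1 h2]; have -> : s = a by apply/le_anti; rewrite h1 h2.
move=> t tab; exists (d / 2); first by rewrite divr_gt0.
move=> u v au ut tv vb gu vg IH.
have bnd s : a <= s <= v -> `|f s| <= c + 1.
  move=> /andP[as_ sv]; have [su|/ltW us] := leP s u.
    by have := IH s; rewrite as_ su => /(_ isT); lra.
  have fu' : `|f u| <= c by apply: IH; rewrite au lexx.
  have : `|f s - f u| < 1.
    apply: hd; [by rewrite as_ (le_trans sv)|by rewrite au (le_trans us) // (le_trans sv)|].
    by rewrite ger0_norm ?subr_ge0//; lra.
  have := ler_normD (f s - f u) (f u); rewrite subrK; lra.
move=> s /andP[as_ sv]; apply: step; first by rewrite as_ (le_trans sv).
by move=> r /andP[ar rs]; apply: bnd; rewrite ar (le_trans rs).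
Qed.

Lemma approx_flow_shift (R : realType) (m : nat) (F : 'rV[R]_m -> 'rV[R]_m)
    (rho M eta a b c : R) (x : R -> 'rV[R]_m) :
  approx_flow F rho M eta (a + c) (b + c) x ->
  approx_flow F rho M eta a b (fun s => x (s + c)).
Proof.
move=> h s t as_ st tb.
have -> : t - s = (t + c) - (s + c) by ring.
by apply: h; rewrite lerD2r.
Qed.

Lemma approx_flow_degenerate (R : realType) (m : nat) (F : 'rV[R]_m -> 'rV[R]_m)
    (rho M eta a : R) (x : R -> 'rV[R]_m) :
  0 <= eta -> approx_flow F rho M eta a a x.
Proof.
move=> eta0 s t as_ st ta.
have -> : s = t by apply/le_anti; rewrite st (le_trans ta as_).
rewrite !subrr normr0 mulr0 add0r; split => // w _.
by rewrite scale0r subr0 normr0 mul0r add0r.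
Qed.

(** * Hybrid arcs seen through windows as approximate paths *)

Section PathsOfArcs.
Variables (R : realType) (m : nat) (C D : set 'rV[R]_m).
Variables (F G : 'rV[R]_m -> 'rV[R]_m) (rho M eta : R).
Variables (E : set (R * nat)) (X : R -> nat -> 'rV[R]_m).
Hypothesis eta0 : 0 <= eta.
Hypothesis E_dom : hybrid_time_domain E.
Hypothesis X_init : (C `|` D) (X 0 0%N).
Hypothesis X_cont : forall k a b, a < b -> (forall t, a <= t <= b -> E (t, k)) ->
  forall e, 0 < e -> exists2 d, 0 < d & forall s t, a <= s <= b -> a <= t <= b ->
    `|s - t| < d -> `|X s k - X t k| < e.
Hypothesis X_flow : forall k a b, a < b -> (forall t, a <= t <= b -> E (t, k)) ->
  forall t, a <= t <= b -> C (X t k) /\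
    ((forall s, a <= s <= t -> `|X s k| <= rho) ->
     approx_flow F rho M eta a t (X^~ k)).
Hypothesis X_jump : forall t j, E (t, j) -> E (t, j.+1) ->
  D (X t j) /\ X t j.+1 = G (X t j).

Section Truncated.
Variables (N : nat) (T : nat -> R).
Hypothesis T_mono : forall j, (j < N)%N -> T j <= T j.+1.
Hypothesis TE : forall l s, (l < N)%N -> T l <= s <= T l.+1 -> E (s, l).

Let T_le i j : (i <= j)%N -> (j <= N)%N -> T i <= T j.
Proof. exact: compact_domain_mono. Qed.

Variables (t0 : R) (j0 : nat).
Hypothesis j0N : (j0 < N)%N.
Hypothesis t0T : T j0 <= t0 <= T j0.+1.

(** A path restarted at an intermediate point must begin in [C] or [D]. A point with something after
    it either flows or jumps; only the original initial point is covered without that. *)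
Lemma initial_flow_or_jump s k : (j0 <= k)%N -> (k < N)%N -> t0 <= s ->
  T k <= s <= T k.+1 -> (t0, j0) = (0, 0%N) \/ (t0, j0) <> (s, k) ->
  (C `|` D) (X t0 j0).
Proof.
move=> j0k kN t0s sT [[-> ->] //|ne].
case/andP: t0T => Tt0 t0T'.
have [lt|ge] := ltP t0 (T j0.+1).
  left; have [||//] := X_flow (k := j0) lt _ (t := t0); last by rewrite lexx ltW.
  move=> t /andP[h1 h2]; apply: TE => //; by rewrite (le_trans Tt0 h1).
have t0E : t0 = T j0.+1 by apply/le_anti; rewrite t0T' ge.
move: j0k; rewrite leq_eqVlt => /predU1P[j0k|j0k].
  case: ne; congr pair => //; apply/le_anti; rewrite t0s/=.
  by rewrite -j0k in sT; case/andP: sT => _ /le_trans; apply.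
have j0N' : (j0.+1 < N)%N by exact: leq_ltn_trans kN.
have [] := @X_jump t0 j0; [|by rewrite t0E; apply: TE => //; rewrite lexx T_mono| by right].
by apply: TE => //; rewrite t0E lexx T_mono.
Qed.

Lemma approx_path_of_arc s k : (j0 <= k)%N -> (k < N)%N -> t0 <= s ->
  T k <= s <= T k.+1 -> (t0, j0) = (0, 0%N) \/ (t0, j0) <> (s, k) ->
  (forall l r, (j0 <= l <= k)%N -> T l <= r <= T l.+1 -> t0 <= r <= s ->
    `|X r l| <= rho) ->
  exists U : nat -> R, U (k - j0).+1 = s - t0 /\
    approx_path C D F G rho M eta (k - j0) U (fun r i => X (r + t0) (j0 + i)%N).
Proof.
move=> j0k kN t0s sT ne bnd; case/andP: (t0T) => Tt0 t0T'; case/andP: sT => Ts sT'.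
(* Clamping the jump times to [[t0, s]] replaces the first by [t0] and the last by [s], and leaves
   those in between unchanged. *)
pose U i := Num.max t0 (Num.min s (T (j0 + i)%N)).
have U0 : U 0%N = t0.
  by rewrite /U addn0 max_l// ge_min Tt0 orbT.
have Uend : U (k - j0).+1 = s.
  by rewrite /U addnS subnKC// min_l// max_r.
have Umono i : U i <= U i.+1 \/ (k - j0 < i)%N.
  have [ik|] := leqP i (k - j0); last by right.
  left; rewrite /U ge_max le_max lexx/= le_max; apply/orP; right.
  have iN : (j0 + i < N)%N by apply: leq_ltn_trans kN; rewrite -leq_subRL.
  by rewrite le_min !ge_min lexx/= addnS T_mono// orbT.
have t0U i : t0 <= U i by rewrite le_max lexx.
have Us i : U i <= s by rewrite ge_max t0s ge_min lexx.
have iN i : (i <= k - j0)%N -> (j0 + i <= k)%N by move=> ik; rewrite -leq_subRL.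
have Uge i : (i <= k - j0)%N -> T (j0 + i)%N <= U i.
  case: i => [_|i ik]; first by rewrite addn0 U0.
  rewrite le_max le_min lexx andbT; apply/orP; right.
  by apply: le_trans Ts; apply: T_le (iN _ ik) (ltnW kN).
have Ule i : (i <= k - j0)%N -> U i.+1 <= T (j0 + i).+1.
  move=> ik; rewrite ge_max; apply/andP; split.
    apply: le_trans t0T' _; apply: T_le; first by rewrite ltnS leq_addr.
    by apply: leq_trans kN; rewrite ltnS iN.
  by rewrite ge_min addnS lexx orbT.
have Ujump i : (i < k - j0)%N -> U i.+1 = T (j0 + i).+1.
  move=> ik; apply/le_anti; rewrite Ule ?(ltnW ik)//=.
  by have := Uge i.+1 ik; rewrite addnS.
have UE i r : (i <= k - j0)%N -> U i <= r <= U i.+1 ->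
    [/\ T (j0 + i)%N <= r <= T (j0 + i).+1, t0 <= r <= s & E (r, (j0 + i)%N)].
  move=> ik /andP[h1 h2].
  have h3 : T (j0 + i)%N <= r <= T (j0 + i).+1.
    by rewrite (le_trans (Uge i ik) h1) (le_trans h2 (Ule i ik)).
  split => //; first by rewrite (le_trans (t0U i) h1) (le_trans h2 (Us _)).
  by apply: TE => //; exact: leq_ltn_trans (iN _ ik) kN.
have rhoU i r : (i <= k - j0)%N -> U i <= r <= U i.+1 -> `|X r (j0 + i)%N| <= rho.
  move=> ik ir; have [h1 h2 _] := UE i r ik ir.
  by apply: bnd => //; rewrite leq_addr iN.
have sh i r : U i - t0 <= r <= U i.+1 - t0 -> U i <= r + t0 <= U i.+1.
  by move=> /andP[h1 h2]; apply/andP; split; lra.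
exists (fun i => U i - t0); split; first by rewrite Uend.
split.
- split; first by rewrite U0 subrr.
  by move=> i ik; rewrite lerD2r; have [//|] := Umono i; rewrite ltnNge ik.
- by rewrite add0r addn0; apply: initial_flow_or_jump j0k kN t0s _ ne; rewrite Ts.
- move=> i ik; rewrite subrK addnS Ujump//.
  have ikN : (j0 + i < k)%N by rewrite -ltn_subRL.
  apply: X_jump; apply: TE; rewrite ?lexx ?andbT.
  + exact: ltn_trans kN.
  + by apply: T_mono; exact: ltn_trans kN.
  + exact: leq_ltn_trans kN.
  + by rewrite /= T_mono//; exact: leq_ltn_trans kN.
- move=> i ik; rewrite ltrD2r => lt t tU.
  have hE r : U i <= r <= U i.+1 -> E (r, (j0 + i)%N) by move=> /(UE i r ik)[].
  by have [] := X_flow lt hE (sh _ _ tU).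
- move=> i ik; split; first by move=> t tU; apply: rhoU => //; exact: sh.
  apply: (approx_flow_shift (c := t0) (x := fun r => X r (j0 + i)%N)); rewrite !subrK.
  have [le|] := Umono i; last by rewrite ltnNge ik.
  move: le; rewrite le_eqVlt => /predU1P[->|lt]; first exact: approx_flow_degenerate.
  have hE r : U i <= r <= U i.+1 -> E (r, (j0 + i)%N) by move=> /(UE i r ik)[].
  have Uin : U i <= U i.+1 <= U i.+1 by rewrite lexx ltW.
  have [_] := X_flow lt hE Uin; apply=> r rU; exact: rhoU.
Qed.

End Truncated.

Variables (d : 'rV[R]_m -> R) (bnd : R -> R -> R) (rho0 Hor : R).
Variables (K0 K1 : set 'rV[R]_m).
Hypothesis rho01 : rho0 + 1 <= rho.
Hypothesis K01 : K0 `<=` K1.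
Hypothesis K1_bound : forall x, K1 x -> `|x| <= rho0 /\ `|G x| <= rho0.
Hypothesis K1_stable : forall x x0 s, 0 <= s -> K0 x0 -> d x <= bnd (d x0) s -> K1 x.
Hypothesis stable_path : forall N T x, approx_path C D F G rho M eta N T x ->
  T N.+1 + N%:R <= Hor -> K0 (x 0 0%N) ->
  d (x (T N.+1) N) <= bnd (d (x 0 0%N)) (T N.+1 + N%:R).

(** The estimate at a point presupposes the bound by [rho] on the way there, which itself follows
    from earlier estimates. The circle is resolved by induction on the flow intervals and, inside
    each, by [bootstrap_bound]. *)
Lemma arc_stable t0 j0 t1 j1 : E (t0, j0) -> E (t1, j1) -> t0 <= t1 -> (j0 <= j1)%N ->
  (t0, j0) = (0, 0%N) \/ (t0, j0) <> (t1, j1) ->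
  K0 (X t0 j0) -> (t1 - t0) + (j1%:R - j0%:R) <= Hor ->
  d (X t1 j1) <= bnd (d (X t0 j0)) ((t1 - t0) + (j1%:R - j0%:R)).
Proof.
move=> E0 E1 t01 j01 ne K00 len.
have [K [[N [T [T0 Tm KE]]] KsE Kp Kq]] := hybrid_domain_compact2 E_dom E0 E1.
have [/= j0N t0T] : (j0 < N)%N /\ T j0 <= t0 <= T j0.+1 by move: Kp; rewrite KE.
have [/= j1N t1T] : (j1 < N)%N /\ T j1 <= t1 <= T j1.+1 by move: Kq; rewrite KE.
have TE l s : (l < N)%N -> T l <= s <= T l.+1 -> E (s, l).
  by move=> lN sT; apply: KsE; rewrite KE.
have T_le i j : (i <= j)%N -> (j <= N)%N -> T i <= T j by exact: compact_domain_mono.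
(* The estimate at one point, conditional on the bound along the way. *)
have point s k : (j0 <= k <= j1)%N -> t0 <= s <= t1 -> T k <= s <= T k.+1 ->
    (forall l r, (j0 <= l <= k)%N -> T l <= r <= T l.+1 -> t0 <= r <= s ->
      `|X r l| <= rho) ->
    (t0, j0) = (0, 0%N) \/ (t0, j0) <> (s, k) ->
    0 <= (s - t0) + (k%:R - j0%:R) /\
    d (X s k) <= bnd (d (X t0 j0)) ((s - t0) + (k%:R - j0%:R)).
  move=> /andP[j0k kj1] /andP[t0s st1] sT hb ne'.
  have kN := leq_ltn_trans kj1 j1N.
  have [U [Uend Upath]] := approx_path_of_arc Tm TE j0N t0T j0k kN t0s sT ne' hb.
  have kj0 : (k - j0)%:R = k%:R - j0%:R :> R by rewrite natrB.
  have := stable_path Upath; rewrite Uend kj0 subrK add0r addn0 subnKC//.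
  have kj : (k%:R : R) <= j1%:R by rewrite ler_nat.
  have jk : (j0%:R : R) <= k%:R by rewrite ler_nat.
  move=> h; split; first lra.
  by apply: h => //; lra.
have rho0_le : rho0 <= rho by apply: le_trans rho01; rewrite lerDl.
suff all : forall l, (j0 <= l <= j1)%N -> forall s,
    T l <= s <= T l.+1 -> t0 <= s <= t1 -> K1 (X s l).
  have [] // := point t1 j1; rewrite ?leqnn ?j01 ?lexx ?t01//.
  move=> l r jl rT r01; apply: (le_trans _ rho0_le).
  by apply: (K1_bound _).1; exact: all.
elim/ltn_ind => l IH /andP[j0l lj1] s sT st.
case/andP: (sT) => Tls sTl; case/andP: (st) => t0s st1.
have lN := leq_ltn_trans lj1 j1N.
pose a := Num.max t0 (T l); pose b := Num.min t1 (T l.+1).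
have sab : a <= s <= b by rewrite ge_max le_min t0s Tls st1 sTl.
have abE r : a <= r <= b -> T l <= r <= T l.+1 /\ t0 <= r <= t1.
  by rewrite ge_max le_min => /andP[/andP[-> ->] /andP[-> ->]].
have ab : a <= b by case/andP: sab => /le_trans; apply.
have aab : a <= a <= b by rewrite lexx.
have lower l' r : (j0 <= l' < l)%N -> T l' <= r <= T l'.+1 -> t0 <= r <= t1 ->
    K1 (X r l').
  move=> /andP[j0l' l'l]; apply: IH => //; rewrite j0l'/=.
  exact: leq_trans (ltnW l'l) lj1.
have good r : a <= r <= b -> (forall r', a <= r' <= r -> `|X r' l| <= rho) -> K1 (X r l).
  move=> rab hr; have [rT rt] := abE r rab.
  have [[<- <-]|ne'] := pselect ((t0, j0) = (r, l)); first exact: K01.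
  have [||len0 stab] := point r l _ rt rT _ (or_intror ne'); last 1 first.
  - exact: K1_stable stab.
  - by rewrite j0l.
  - move=> l' r' /andP[j0l'] + r'T /andP[t0r' r'r].
    rewrite leq_eqVlt => /predU1P[l'E|l'l].
      by subst l'; apply: hr; rewrite r'r andbT ge_max t0r'; case/andP: r'T.
    apply: le_trans rho0_le; apply: (K1_bound _).1; apply: lower => //; first exact/andP.
    by rewrite t0r'; case/andP: rt => _; exact: le_trans.
(* An interval starts either at the restart point or right after a jump from [K1], whose image under
   [G] is bounded by [rho0] as well. *)
have start : `|X a l| <= rho0.
  have [j0E|j0ne] := eqVneq j0 l.
    have -> : a = t0 by rewrite /a -j0E max_l//; case/andP: t0T.
    by rewrite -j0E; apply: (K1_bound _).1; exact: K01.
  have {j0ne}j0ltl : (j0 < l)%N by rewrite ltn_neqAle j0ne.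
  case: l => // l in IH j0l lj1 sT Tls sTl lN a b sab abE ab aab lower good j0ltl *.
  have t0Tl : t0 <= T l.+1.
    by case/andP: t0T => _ /le_trans; apply; apply: T_le => //; exact: ltnW.
  have -> : a = T l.+1 by rewrite /a max_r.
  have lN' : (l < N)%N by exact: ltnW.
  have El : E (T l.+1, l) by apply: TE => //; rewrite lexx Tm.
  have El1 : E (T l.+1, l.+1) by apply: TE => //; rewrite lexx Tm.
  have [_ ->] := X_jump El El1; apply: (K1_bound _).2.
  apply: lower; rewrite ?ltnSn ?andbT//; first by rewrite lexx andbT Tm.
  by rewrite t0Tl (le_trans Tls st1).
have [eab|neab] := eqVneq a b.
  apply: good => // r /andP[ar rs].
  have -> : r = a.
    apply/le_anti; rewrite ar (le_trans rs)//= eab; by case/andP: sab.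
  exact: le_trans rho0_le.
have ltab : a < b by rewrite lt_neqAle neab.
have bE r : a <= r <= b -> E (r, l) by move=> /abE[h _]; exact: TE.
have bound := bootstrap_bound ab (X_cont ltab bE) start.
apply: (good) => // r /andP[ar rs]; apply: (le_trans _ rho0_le); apply: bound.
  move=> t tab ht; apply: (K1_bound _).1; apply: good => // r' r'a.
  by apply: le_trans rho01; exact: ht.
by rewrite ar (le_trans rs)//; case/andP: sab.
Qed.

End PathsOfArcs.

(** * Restarting *)

(** A jump raises the length by 1 at once, so a prescribed length may be skipped, but a window of
    width 1 below it may not. *)
Lemma hybrid_domain_between (R : realType) (E : set (R * nat)) t j (a : R) :
  hybrid_time_domain E -> E (t, j) -> 0 <= a -> a <= t + j%:R ->
  exists t' j', [/\ E (t', j'), t' <= t, (j' <= j)%N & a - 1 <= t' + j'%:R <= a].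
Proof.
move=> hE Ej a0.
have [K [[N [T [T0 Tm KE]]] KsE Kp _]] := hybrid_domain_compact2 hE Ej Ej.
have {Kp Ej} : (j < N)%N /\ T j <= t <= T j.+1 by move: Kp; rewrite KE.
elim: j t => [|j IH] t [jN /andP[Tt tT]] at_.
  exists a, 0%N; split => //; [|by rewrite addr0 in at_|by rewrite addr0 lexx andbT; lra].
  by apply: KsE; rewrite KE /= jN T0 a0 (le_trans _ tT)//; rewrite addr0 in at_.
have [h1|h1] := leP (T j.+1 + j.+1%:R) a.
  exists (a - j.+1%:R), j.+1; split => //; [|lra|by rewrite subrK lexx andbT; lra].
  by apply: KsE; rewrite KE /=; split => //; apply/andP; split; lra.
have Tj : T j <= T j.+1 <= T j.+1 by rewrite lexx andbT Tm// ltnW.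
have ETj : E (T j.+1, j) by apply: KsE; rewrite KE /= ltnW.
have [h2|h2] := leP (T j.+1 + j%:R) a.
  exists (T j.+1), j; split => //; rewrite h2 andbT; rewrite -natr1 in h1; lra.
have [|t' [j' [h3 h4 h5 h6]]] := IH (T j.+1) (conj (ltnW jN) Tj); first exact: ltW.
by exists t', j'; split => //; [exact: le_trans Tt|exact: leqW].
Qed.

(* Beyond length [L] every point has an anchor at distance at most [c] from the
   target and at most [L] behind it, from which the estimate is restarted. *)
Lemma restart_stability (R : realType) (E : set (R * nat)) (d : R -> nat -> R)
    (bnd : R -> R -> R) (c L b : R) :
  hybrid_time_domain E -> E (0, 0%N) -> 1 <= L ->
  (forall t0 j0 t1 j1, E (t0, j0) -> E (t1, j1) -> t0 <= t1 -> (j0 <= j1)%N ->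
    (t0, j0) = (0, 0%N) \/ (t0, j0) <> (t1, j1) ->
    (t0, j0) = (0, 0%N) \/ d t0 j0 <= c ->
    (t1 - t0) + (j1%:R - j0%:R) <= L + 2 ->
    d t1 j1 <= bnd (d t0 j0) ((t1 - t0) + (j1%:R - j0%:R))) ->
  (forall s, L <= s -> bnd (d 0 0%N) s <= c) ->
  (forall t j s, E (t, j) -> d t j <= c -> L <= s -> bnd (d t j) s <= c) ->
  (forall t j s, E (t, j) -> d t j <= c -> 0 <= s -> bnd (d t j) s <= b) -> c <= b ->
  forall t j, E (t, j) -> d t j <= bnd (d 0 0%N) (t + j%:R) \/ d t j <= b.
Proof.
move=> hE E00 L1 step b0 bc bb cb t j Etj.
have from0 t1 j1 : E (t1, j1) -> t1 + j1%:R <= L + 2 ->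
    d t1 j1 <= bnd (d 0 0%N) (t1 + j1%:R).
  move=> E1 len; have := step 0 0%N t1 j1 E00 E1.
  rewrite !subr0; apply => //; [|by left|by left].
  have [K [cK _ K1 _]] := hybrid_domain_compact2 hE E1 E1.
  exact: compact_domain_time_ge0 cK K1.
have anchor (n : nat) : forall t j, E (t, j) -> L <= t + j%:R -> t + j%:R <= n%:R ->
    exists t0 j0, [/\ E (t0, j0), t0 <= t, (j0 <= j)%N, d t0 j0 <= c &
      (t - t0) + (j%:R - j0%:R) <= L].
  elim: n => [|n IH] t1 j1 E1 Lt tn; first by exfalso; lra.
  have self : d t1 j1 <= c -> exists t0 j0, [/\ E (t0, j0), t0 <= t1, (j0 <= j1)%N, d t0 j0 <= c &
      (t1 - t0) + (j1%:R - j0%:R) <= L].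
    by move=> h; exists t1, j1; split => //; rewrite !subrr addr0; lra.
  have [le|gt] := leP (t1 + j1%:R) (L + 2).
    by apply: self; apply: le_trans (from0 _ _ E1 le) _; exact: b0.
  (* A point between 1 and 2 units earlier has an anchor by induction, which is then at most [L + 2]
     behind the present point: this is why the horizon is [L + 2]. *)
  have [||t' [j' [E' t't j'j /andP[h1 h2]]]] :=
    @hybrid_domain_between _ _ t1 j1 (t1 + j1%:R - 1) hE E1; [lra|lra|].
  have [||t0 [j0 [E0 t0t j0j d0 len]]] := IH t' j' E'; [lra| |].
    by rewrite -natr1 in tn; lra.
  have t0t1 := le_trans t0t t't; have j0j1 := leq_trans j0j j'j.
  have [le2|gt2] := leP ((t1 - t0) + (j1%:R - j0%:R)) L.
    by exists t0, j0.
  (* An anchor more than [L] behind is far enough for the estimate to fall below [c], so the present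
     point becomes its own anchor. *)
  apply: self; apply: le_trans (step t0 j0 t1 j1 E0 E1 t0t1 j0j1 _ _ _) _.
  - by right => -[e1 e2]; move: gt2; rewrite e1 e2 !subrr; lra.
  - by right.
  - lra.
  - by apply: bc => //; exact: ltW.
have [le|gt] := leP (t + j%:R) L.
  by left; apply: from0 => //; lra.
right.
have [|t0 [j0 [E0 t0t j0j d0 len]]] := anchor (Num.bound `|t + j%:R|) t j Etj (ltW gt).
  by apply: le_trans (ler_norm _) _; apply/ltW/archi_boundP.
have [[<- <-]|ne] := pselect ((t0, j0) = (t, j)); first exact: le_trans cb.
apply: le_trans (step t0 j0 t j E0 Etj t0t j0j (or_intror ne) (or_intror d0) _) _; first lra.
apply: bb => //; rewrite addr_ge0 ?subr_ge0// ler_nat//.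
Qed.

(** * Distances with the clock adjoined, and stability of the closed loop *)

Lemma eucl_dist_prod_nonneg_le (R : realType) (q : nat) (A : set 'rV[R]_q)
    (w : 'rV[R]_(q + 1)) :
  A !=set0 -> 0 <= clock w -> eucl_dist (prod_nonneg A) w <= eucl_dist A (lsubmx w).
Proof.
move=> A0 w0; apply/ler_addgt0Pr => e e0.
have [a Aa lt] := eucl_dist_lt (lsubmx w) A0 e0.
apply: le_trans (ltW lt).
(* Giving the competitor the clock of [w] itself removes the clock from the distance. *)
have Pa : prod_nonneg A (row_mx a (rsubmx w)).
  by rewrite /prod_nonneg /= row_mxKl; split => //; rewrite /clock row_mxKr.
apply: le_trans (eucl_dist_le w Pa) _.
rewrite le_eqVlt; apply/orP; left; apply/eqP; rewrite /eucl_norm; congr Num.sqrt.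
rewrite -{1}(hsubmxK w) row_mxB subrr big_split_ord/= [X in _ + X]big1 ?addr0.
  by apply: eq_bigr => i _; rewrite row_mxEl.
by move=> i _; rewrite row_mxEr mxE expr0n.
Qed.

Lemma eucl_dist_lsub_le (R : realType) (q : nat) (A : set 'rV[R]_q)
    (w : 'rV[R]_(q + 1)) :
  A !=set0 -> eucl_dist A (lsubmx w) <= eucl_dist (prod_nonneg A) w.
Proof.
move=> [a0 Aa0]; apply/ler_addgt0Pr => e e0.
have [|b [Ab b0] lt] := @eucl_dist_lt _ _ (prod_nonneg A) w e _ e0.
  exists (row_mx a0 0); rewrite /prod_nonneg /= row_mxKl; split => //.
  by rewrite /clock row_mxKr mxE.
apply: le_trans (ltW lt); apply: le_trans (eucl_dist_le _ Ab) _.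
by rewrite -linearB; exact: eucl_norm_lsub.
Qed.

Lemma eucl_dist_set0 (R : realType) (q : nat) (w : 'rV[R]_q) :
  eucl_dist set0 w = 0.
Proof. by rewrite /eucl_dist image_set0 inf0. Qed.

(** On a nondegenerate flow interval the flow set forces it. A point of a degenerate one is either
    initial or the image of a jump, which keeps the clock and starts from a nonnegative one. *)
Lemma es_clock_ge0 (R : realType) (n r : nat) (kappa : 'I_n -> rat)
    (J : 'rV[R]_n -> R) (C D : set 'rV[R]_(n + r))
    (Fhat : 'rV[R]_(n + r) * 'rV[R]_n -> 'rV[R]_(n + r))
    (Ghat : 'rV[R]_(n + r) -> 'rV[R]_(n + r)) (eps_a eps_w : R) y :
  solution (es_system kappa J C D Fhat Ghat eps_a eps_w) y ->
  (forall k a b, a < b -> `[a, b] `<=` slice y k ->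
    forall t, a <= t <= b -> prod_nonneg C (y t k)) ->
  forall t j, hdom y (t, j) -> 0 <= clock (y t j).
Proof.
move=> [[hE _] [_ init] _ jump] flowC t j Etj.
have [K [[N [T [T0 Tm KE]]] KsE Kp _]] := hybrid_domain_compact2 hE Etj Etj.
have [/= jN tT] : (j < N)%N /\ T j <= t <= T j.+1 by move: Kp; rewrite KE.
have [lt|ge] := ltP (T j) (T j.+1).
  have [//|_ ] := flowC j _ _ lt _ t tT; last by [].
  by move=> s; rewrite /= in_itv/= => sT; apply: KsE; rewrite KE.
have tE : t = T j.
  by case/andP: tT => h1 h2; apply/le_anti; rewrite h1 (le_trans h2 ge).
rewrite {}tE in Etj *; case: j => [|j] in Kp jN tT ge Etj *.
  by rewrite T0; case: init => -[].
have Ej : hdom y (T j.+1, j).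
  by apply: KsE; rewrite KE /= lexx andbT; split; [exact: ltnW|apply/Tm/ltnW].
have [[_ c0] ->] := jump _ _ Ej Etj.
by rewrite /clock row_mxKr mxE.
Qed.

Theorem theorem5 (R : realType) (n r : nat) (n_ge1 : (1 <= n)%N)
    (J : 'rV[R]_n -> R) (J_C2 : C2 J)
    (U O : set 'rV[R]_n) (O_opt : O = minimizers J U \/ O = maximizers J U)
    (O_neq0 : O !=set0) (O_compact : compact O)
    (C D : set 'rV[R]_(n + r))
    (Fhat : R -> 'rV[R]_(n + r) * 'rV[R]_n -> 'rV[R]_(n + r))
    (Ghat : R -> 'rV[R]_(n + r) -> 'rV[R]_(n + r))
    (kappa : 'I_n -> rat) (kappa_gt0 : forall i, 0 < kappa i)
    (kappa_inj : injective kappa)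
    (T : R) (T_gt0 : 0 < T)
    (T_period : forall eps_a : R, periodic (dither kappa eps_a) T)
    (Psi : set 'rV[R]_r) (Psi_compact : compact Psi)
    (dstar : R) (dstar_gt0 : 0 < dstar)
    (hyp_a : forall delta : R, 0 < delta <= dstar ->
      [/\ closed C /\ closed D,
          [set lsubmx x | x in C] `<=` U /\ [set lsubmx x | x in D] `<=` U,
          continuous (Fhat delta) &
          continuous (Ghat delta)])
    (hyp_b : @SGPAS R (n + r) 1
      (fun delta => nominal_system J C D (Fhat delta) (Ghat delta))
      [set x | O (lsubmx x) /\ Psi (rsubmx x)])
    (hyp_c : forall delta : R, 0 < delta <= dstar ->
      forall K : set 'rV[R]_(n + r), compact K ->
      exists2 eps_a_star : R, 0 < eps_a_star &
      exists sigma : 'rV[R]_(n + r) -> R,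
        [/\ continuous sigma,
            (forall x, 0 <= sigma x) &
            forall eps_a : R, 0 < eps_a < eps_a_star ->
            forall x, (K `&` C) x ->
              inflate
                (closed_convex_hull
                  [set nominal_flow J (Fhat delta) y
                    | y in inflate [set x] (eps_a * sigma x) `&` C])
                (eps_a * sigma x)
                (average T (es_flow kappa J (Fhat delta) eps_a) x)]) :
  @SGPAS R (n + r + 1) 3
    (fun delta eps_a eps_w =>
      es_system kappa J C D (Fhat delta) (Ghat delta) eps_a eps_w)
    (prod_nonneg [set x | O (lsubmx x) /\ Psi (rsubmx x)]).

Proof.
have [beta beta_KL Hb] := hyp_b.
set A := [set x | O (lsubmx x) /\ Psi (rsubmx x)] in Hb *.
have time_ge0 q (H : hybrid_system R q) x t j : solution H x -> hdom x (t, j) ->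
    0 <= t + j%:R.
  move=> [[hE _] _ _ _] Etj; have [K [cK _ Kp _]] := hybrid_domain_compact2 hE Etj Etj.
  by rewrite addr_ge0//; exact: compact_domain_time_ge0 cK Kp.
(* [Psi] may be empty; distances to the empty set are 0 and the bound is then nonnegativity of
   [beta]. *)
have [A_neq0|A_eq0] := pselect (A !=set0); last first.
  have -> : prod_nonneg A = set0.
    by apply/seteqP; split => // w [Aw _]; case: A_eq0; exists (lsubmx w).
  exists beta => // Delta nu nu0 _.
  exists 1 => // delta _; exists 1 => // eps_a _; exists 1 => // eps_w _.
  move=> y [ysol _] _ t j yt; rewrite !eucl_dist_set0 addr_ge0 ?(ltW nu0)//.
  by case: beta_KL => b0 _ _ _ _; apply: b0 => //; exact: time_ge0 ysol yt.
have [EA EA0 A_bound] : exists2 EA : R, 0 <= EA & forall a, A a -> eucl_norm a <= EA.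
  have id_c q : continuous (fun x : 'rV[R]_q => x) by move=> x; exact: cvg_id.
  have [MO MO0 hO] := compact_continuous_bounded (id_c n) O_compact.
  have [MP MP0 hP] := compact_continuous_bounded (id_c r) Psi_compact.
  exists ((n + r)%:R * (MO + MP)); first by rewrite mulr_ge0 ?addr_ge0.
  move=> a [Oa Pa]; apply: le_trans (eucl_le_norm _) _; rewrite ler_wpM2l//.
  rewrite -[a]hsubmxK; apply: norm_row_mx_le.
    by apply: le_trans (hO _ Oa) _; rewrite lerDl.
  by apply: le_trans (hP _ Pa) _; rewrite lerDr.
have bounded_near x b : eucl_dist A x <= b -> eucl_norm x <= EA + b + 1.
  move=> xb; have [a Aa xa] := eucl_dist_lt x A_neq0 ltr01.
  rewrite -(subrK a x); apply: le_trans (eucl_normD _ _) _.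
  have := A_bound _ Aa; lra.
have dist_bound x b : eucl_norm x <= b -> eucl_dist A x <= b + EA.
  move=> xb; have [a Aa] := A_neq0; apply: le_trans (eucl_dist_le x Aa) _.
  apply: le_trans (eucl_normD _ _) _; rewrite eucl_normN; apply: lerD => //.
  exact: A_bound.
set beta' := KL_majorant beta.
have beta'_KL : class_KL beta' by exact: KL_majorant_class_KL.
have [b'0 b'mono b'dec b'r b's] := beta'_KL.
exists beta' => // Delta nu nu0 nuD.
have nu2 : 0 < nu / 2 by rewrite divr_gt0.
have [r0 r00 hr0] : exists2 r0, 0 < r0 & forall r, 0 < r -> r < r0 -> beta' r 0 <= nu / 2.
  have := b'r _ (lexx 0) => /cvgrPdist_le /(_ _ nu2).
  rewrite near_withinE => /nbhs_ballP[d /= d0 hd]; exists d => // s s0 sd.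
  have := hd s; rewrite -ball_normE/= sub0r normrN gtr0_norm// => /(_ sd s0).
  by rewrite sub0r normrN => /(le_trans (ler_norm _)).
(* Restarts take place at distance at most [3 * nu1], less than [r0]; the estimate from there stays
   below [nu / 2 + 2 * nu1], hence below [nu]. *)
pose nu1 := Num.min (nu / 8) (r0 / 6).
have nu1_gt0 : 0 < nu1 by rewrite lt_min !divr_gt0.
have [nu1_nu nu1_r0] : nu1 <= nu / 8 /\ nu1 <= r0 / 6 by rewrite !ge_min !lexx orbT.
(* Covers the given initial states and every restart point within [3 * nu1] of the target. *)
pose Delta1 := Num.max Delta (EA + 3 * nu1 + 1).
have [D1 D2] : Delta <= Delta1 /\ EA + 3 * nu1 + 1 <= Delta1.
  by rewrite !le_max !lexx orbT.
pose dA := Delta1 + EA.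
have dA0 : 0 <= dA by rewrite /dA; lra.
have dA_nu1 : 3 * nu1 <= dA by rewrite /dA; lra.
(* After length [L] the decaying term is at most [nu1]; with the error [2 * nu1] this gives the
   restart distance [3 * nu1]. *)
have [L L1 hL] : exists2 L, 1 <= L & forall s, L <= s -> beta' dA s <= nu1.
  have := b's _ dA0 => /cvgrPdist_le /(_ _ nu1_gt0) [S [Sr hS]].
  exists (`|S| + 1); first by rewrite lerDr.
  move=> s Ss; have := hS s; have := ler_norm S => h1 /(_ ltac:(lra)).
  by rewrite sub0r normrN => /(le_trans (ler_norm _)).
(* Bounds the starting states and all states that the estimate allows from them. *)
pose rho1 := Num.max Delta1 (EA + (beta' dA 0 + 2 * nu1) + 1).
(* The initial state of a limit solution is only near that of the paths, hence the margin 1. *)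
have [delta0 delta00 Hdelta] := Hb (Delta1 + 1) nu1 nu1_gt0 ltac:(lra).
exists (Num.min delta0 dstar); first by rewrite lt_min delta00.
move=> delta /andP[delta_gt0]; rewrite lt_min => /andP[delta_lt delta_dstar].
have delta_in : 0 < delta <= dstar by rewrite delta_gt0 ltW.
have stable := Hdelta delta (introT andP (conj delta_gt0 delta_lt)).
have [[C_closed D_closed] _ Fc Gc] := hyp_a delta delta_in.
have J_C1 : C1 J by case: J_C2.
have F_cont := nominal_flow_continuous J_C1 Fc.
have [MG MG0 hMG] := compact_continuous_bounded Gc (@norm_ball_compact R (n + r) rho1).
(* [MG] bounds the states right after a jump from the ball of radius [rho1]; the extra 1 is the
   slack of the continuation argument. *)
pose rho0 := Num.max rho1 MG; pose rho := rho0 + 1.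
have [M M0 averaging] := @es_solution_approx_flow R n r kappa J C D (Fhat delta)
  (Ghat delta) T J_C1 Fc C_closed T_gt0 T_period (hyp_c delta delta_in) rho.
have [eta eta0 path_stable] := @approx_path_stable R (n + r) C D
  (nominal_flow J (Fhat delta)) (Ghat delta) A beta Delta1 nu1 C_closed D_closed
  F_cont Gc A_neq0 beta_KL nu1_gt0 stable rho M (L + 2) M0.
have [ea ea0 {}averaging] := averaging eta eta0.
exists ea => // eps_a eps_a_in; have [ew ew0 {}averaging] := averaging eps_a eps_a_in.
exists ew => // eps_w eps_w_in y [ysol _] y0D.
have {}averaging := averaging eps_w eps_w_in y ysol.
have clock_ge0 : forall t j, hdom y (t, j) -> 0 <= clock (y t j).
  by apply: es_clock_ge0 ysol _ => k a b ab abs t tab; have [] := averaging k a b ab abs t tab.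
have [[hE yac] [E00 init] _ jump] := ysol.
pose bnd r s := beta' r s + 2 * nu1.
pose X t j := lsubmx (y t j).
have X0D : eucl_norm (X 0 0%N) <= Delta1.
  by apply: le_trans D1; apply: le_trans y0D; exact: eucl_norm_lsub.
have dX0 t j : 0 <= eucl_dist A (X t j) by exact: eucl_dist_ge0.
have seg k a b : (forall t, a <= t <= b -> hdom y (t, k)) -> `[a, b] `<=` slice y k.
  by move=> h t; rewrite /= in_itv/=; exact: h.
have X_cont k a b : a < b -> (forall t, a <= t <= b -> hdom y (t, k)) ->
  forall e, 0 < e -> exists2 d, 0 < d & forall s t, a <= s <= b -> a <= t <= b ->
    `|s - t| < d -> `|X s k - X t k| < e.
  move=> ab /seg abs e e0.
  have si : (slice y k)° !=set0 by exact: segment_interior_neq0 abs.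
  have [d d0 hd] := abs_continuous_unif (yac k si a b (ltW ab) abs) e0.
  exists d => // s t sab tab st; apply: le_lt_trans (hd s t sab tab st).
  by rewrite -linearB; exact: norm_lsub.
have X_flow k a b : a < b -> (forall t, a <= t <= b -> hdom y (t, k)) ->
  forall t, a <= t <= b -> C (X t k) /\
    ((forall s, a <= s <= t -> `|X s k| <= rho) ->
     approx_flow (nominal_flow J (Fhat delta)) rho M eta a t (X^~ k)).
  move=> ab /seg abs t tab; have [[Ct _] h] := averaging k a b ab abs t tab.
  by split.
have X_jump t j : hdom y (t, j) -> hdom y (t, j.+1) ->
    D (X t j) /\ X t j.+1 = Ghat delta (X t j).
  by move=> h1 h2; have [[Dt _] yE] := jump t j h1 h2; rewrite /X yE row_mxKl.
have X_init : (C `|` D) (X 0 0%N) by case: init => -[? _]; [left|right].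
have rho01 : rho0 + 1 <= rho by [].
pose K0 := [set x : 'rV[R]_(n + r) | eucl_norm x <= Delta1].
pose K1 := [set x : 'rV[R]_(n + r) | `|x| <= rho1].
have K01 : K0 `<=` K1.
  by move=> x xD; apply: le_trans (norm_le_eucl _) _; rewrite le_max xD.
have K1_bound x : K1 x -> `|x| <= rho0 /\ `|Ghat delta x| <= rho0.
  move=> xK; have xr : `|x| <= rho1 by exact: xK.
  split; first by apply: le_trans xr _; rewrite /rho0 le_max lexx.
  by apply: le_trans (hMG _ xK) _; rewrite /rho0 le_max lexx orbT.
have K1_stable x x0 s : 0 <= s -> K0 x0 -> eucl_dist A x <= bnd (eucl_dist A x0) s -> K1 x.
  move=> s0 xK0 xb; apply: le_trans (norm_le_eucl _) _; rewrite le_max; apply/orP; right.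
  apply: bounded_near; apply: le_trans xb _; rewrite lerD2r.
  have d0 := eucl_dist_ge0 A x0.
  apply: (@le_trans _ _ (beta' dA s)); first by apply: b'mono => //; exact: dist_bound.
  exact: b'dec.
have arc := @arc_stable R (n + r) C D (nominal_flow J (Fhat delta)) (Ghat delta)
  rho M eta (hdom y) X (ltW eta0) hE X_init X_cont X_flow X_jump (eucl_dist A) bnd
  rho0 (L + 2) K0 K1 rho01 K01 K1_bound K1_stable path_stable.
move=> t j Etj.
have tj0 := time_ge0 _ _ _ _ _ ysol Etj.
apply: le_trans (eucl_dist_prod_nonneg_le A_neq0 (clock_ge0 _ _ Etj)) _.
apply: (@le_trans _ _ (beta' (eucl_dist A (X 0 0%N)) (t + j%:R) + nu)); last first.
  by rewrite lerD2r; apply: b'mono => //; exact: eucl_dist_lsub_le.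
have bnd_c s x : eucl_dist A x <= dA -> L <= s -> bnd (eucl_dist A x) s <= 3 * nu1.
  move=> xd Ls; have s0 : 0 <= s by lra.
  have := b'mono _ _ s (eucl_dist_ge0 A x) xd s0; have := hL s Ls; rewrite /bnd; lra.
have := @restart_stability R (hdom y) (fun t j => eucl_dist A (X t j)) bnd (3 * nu1) L nu
  hE E00 L1.
case/(_ _ _ _ _ _ t j Etj).
- move=> t0 j0 t1 j1 E0 E1 t01 j01 ne near0 len; apply: arc => //.
  case: near0 => [[-> ->] //|d0].
  by apply: le_trans D2; exact: bounded_near.
- by move=> s Ls; apply: bnd_c => //; exact: dist_bound.
- by move=> t0 j0 s E0 d0 Ls; apply: bnd_c => //; exact: le_trans dA_nu1.
- move=> t0 j0 s E0 d0 s0; rewrite /bnd.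
  have nu10 : 0 <= 3 * nu1 by lra.
  have h1 := b'mono _ _ s (dX0 t0 j0) d0 s0.
  have h2 := b'dec (3 * nu1) 0 s nu10 (lexx 0) s0.
  have h3 : beta' (3 * nu1) 0 <= nu / 2 by apply: hr0; lra.
  lra.
- lra.
- by move=> /le_trans; apply; rewrite /bnd; lra.
- move=> h; apply: le_trans h _; rewrite lerDr; exact: b'0.
Qed.
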